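(* Let $G$ be a geometrically rigid, residually finite, hyperbolic group. Let $X$ be a connected graph with a free and cocompact $G$-action. There exist a finite index subgroup $\dot G\le G$ and a constant $C\ge 0$ such that for every finite index subgroup $H\le \dot G$ and every injective homomorphism $\phi:H\to G$ we have $$\mathrm{AvgDist}(\phi)\le C.$$ If, moreover, the image of $\phi$ has finite index in $G$, then $$\frac1C\le \mathrm{AvgDist}(\phi)\le C.$$
   Context: A hyperbolic (Gromov/word-hyperbolic) group $G$ is geometrically rigid if it is one-ended and its Gromov boundary $\partial G$ contains no cut pair, i.e. no two distinct points $a,b$ such that $\partial G\setminus\{a,b\}$ is disconnected. Let $H\le G$ have finite index and let $\phi:H\to G$ be an injective homomorphism. A $\phi$-equivariant cellular map $\Phi:X\to X$ is a map sending vertices to vertices and edges to edge-paths, with $\Phi(hx)=\phi(h)\Phi(x)$ for all $h\in H$. For an edge $e$, $\ell(\Phi(e))$ is the length (number of edges) of the edge-path $\Phi(e)$. Let $e_1,\dots,e_k$ be representatives of the $H$-orbits of edges of $X$ (so $k=k_0[G:H]$, where $k_0$ is the number of $G$-orbits of edges). Define $$\mathrm{TotalDist}(\Phi)=\sum_{i=1}^k \ell(\Phi(e_i)),\qquad \mathrm{AvgDist}(\Phi)=\tfrac1k\,\mathrm{TotalDist}(\Phi),$$ and $\mathrm{AvgDist}(\phi)=\min_\Phi \mathrm{AvgDist}(\Phi)$, the minimum being over all $\phi$-equivariant cellular maps $\Phi:X\to X$. *)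

(* Defs.v *)
From HB Require Import structures.
From mathcomp Require Import all_boot all_order all_fingroup all_algebra.
From mathcomp Require Import all_classical all_reals all_analysis.

Set Implicit Arguments.
Unset Strict Implicit.
Unset Printing Implicit Defensive.

Import Order.TTheory GRing.Theory Num.Theory.

Local Open Scope classical_set_scope.
Local Open Scope ring_scope.

Definition subgroup (G : groupType) (H : set G) : Prop := group_closed (mem H).

Definition finite_index (G : groupType) (K H : set G) : Prop :=
  H `<=` K /\ finite_set [set [set (g * h)%g | h in H] | g in K].

(* A homomorphism H -> G is given by a map on all of G, of which only the     *)
(* restriction to H is ever used.                                             *)
Definition hom_on (G : groupType) (H : set G) (phi : G -> G) : Prop :=
  forall x y, H x -> H y -> phi (x * y)%g = (phi x * phi y)%g.

Definition residually_finite (G : groupType) : Prop :=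
  forall g : G, g <> 1%g ->
    exists (Q : finGroupType) (f : G -> Q),
      {morph f : x y / (x * y)%g} /\ f g <> 1%g.

Section WordMetric.
Variables (G : groupType) (S : seq G).

Definition word_for (g : G) (w : seq G) : Prop :=
  {in w, forall x, (x \in S) || (x^-1%g \in S)} /\
  (\big[*%g/1%g]_(x <- w) x = g).

Definition generates : Prop := forall g : G, exists w, word_for g w.

(* The default value 0 is taken only when g is not in the subgroup            *)
(* generated by S.                                                            *)
Definition word_length (g : G) : nat :=
  xget 0%N [set n | (exists2 w, word_for g w & size w = n) /\
                    (forall w, word_for g w -> (n <= size w)%N)].

Definition word_dist (x y : G) : nat := word_length (x^-1 * y)%g.

Definition gromov_product (R : realType) (o x y : G) : R :=
  ((word_dist o x)%:R + (word_dist o y)%:R - (word_dist x y)%:R) / 2.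

Definition hyperbolic (R : realType) : Prop :=
  exists delta : R, forall o x y z : G,
    Num.min (gromov_product R o x y) (gromov_product R o y z) - delta
      <= gromov_product R o x z.

Definition cayley_adj : rel G :=
  fun x y => (x^-1 * y \in S)%g || (y^-1 * x \in S)%g.

Definition component_avoiding (K : set G) (x : G) : set G :=
  [set y | exists p : seq G,
     [/\ path cayley_adj x p, last x p = y &
         forall z, z \in x :: p -> ~ K z]].

(* Exactly one end, for the locally finite Cayley graph: the complement of    *)
(* every finite set of vertices has exactly one infinite component.  In       *)
(* particular G is infinite.                                                  *)
Definition one_ended : Prop :=
  forall K : set G, finite_set K ->
    exists! C : set G,
      (exists2 x, ~ K x & C = component_avoiding K x) /\ infinite_set C.

End WordMetric.

Section Boundary.
Variables (G : groupType) (S : seq G).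

(* Geodesic rays of the Cayley graph issuing from the vertex 1, recorded by   *)
(* their sequences of vertices.                                               *)
Record ray := Ray {
  ray_fun :> nat -> G;
  ray_start : ray_fun 0%N = 1%g;
  ray_geodesic : forall i j, (i <= j)%N ->
    word_dist S (ray_fun i) (ray_fun j) = (j - i)%N }.

Definition asymptotic (c c' : ray) : Prop :=
  exists B : nat, forall t, (word_dist S (c t) (c' t) <= B)%N.

Definition ray_class (c : ray) : set ray := [set c' | asymptotic c c'].

Record boundary := BoundaryPoint {
  bd_rays :> set ray;
  bd_raysP : exists c, bd_rays = ray_class c }.

Definition endpoint (c : ray) : boundary :=
  BoundaryPoint (ex_intro _ c (erefl (ray_class c))).

(* The quotient of the topology of uniform convergence on compact sets: two   *)
(* rays are close when they agree on a long initial segment.                  *)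
Definition boundary_open (U : set boundary) : Prop :=
  forall c : ray, U (endpoint c) ->
    exists n : nat, forall c' : ray,
      (forall t, (t <= n)%N -> c' t = c t) -> U (endpoint c').

Lemma boundary_openT : boundary_open setT.
Proof. by move=> c _; exists 0%N. Qed.

Lemma boundary_openI : setI_closed boundary_open.
Proof.
move=> U V oU oV c [/oU[n nU] /oV[m mV]]; exists (maxn n m) => c' cc'.
by split; [apply: nU|apply: mV] => t tn; apply: cc'; rewrite leq_max tn ?orbT.
Qed.

Lemma boundary_open_bigU (I : Type) (f : I -> set boundary) :
  (forall i, boundary_open (f i)) -> boundary_open (\bigcup_i f i).
Proof.
move=> of_ c [i _ /of_[n nf]]; exists n => c' cc'.
by exists i => //; apply: nf.
Qed.

HB.instance Definition _ := gen_eqMixin boundary.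
HB.instance Definition _ := gen_choiceMixin boundary.
HB.instance Definition _ := isOpenTopological.Build boundary
  boundary_openT boundary_openI boundary_open_bigU.

Definition cut_pair (a b : boundary) : Prop :=
  a <> b /\ ~ connected (~` [set a; b]).

Definition geometrically_rigid : Prop :=
  one_ended S /\ ~ (exists a b : boundary, cut_pair a b).

End Boundary.

(* Serre graphs: loops and multiple edges are allowed. *)

Record graph := Graph {
  vertex : Type;
  dart : Type;
  src : dart -> vertex;
  flip : dart -> dart;
  flipK : involutive flip;
  flip_neq : forall e, flip e <> e }.

Definition tgt (X : graph) (e : dart X) : vertex X := src (flip e).

Fixpoint edge_path (X : graph) (u : vertex X) (p : seq (dart X))
    (v : vertex X) : Prop :=
  if p is e :: p' then src e = u /\ edge_path (tgt e) p' v else u = v.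

Definition rev_path (X : graph) (p : seq (dart X)) : seq (dart X) :=
  rev (map (@flip X) p).

Definition graph_connected (X : graph) : Prop :=
  inhabited (vertex X) /\
  forall u v : vertex X, exists p, edge_path u p v.

Record graph_action (G : groupType) (X : graph) := GraphAction {
  actv : G -> vertex X -> vertex X;
  acte : G -> dart X -> dart X;
  actv1 : forall v, actv 1%g v = v;
  actvM : forall g h v, actv (g * h)%g v = actv g (actv h v);
  acte1 : forall e, acte 1%g e = e;
  acteM : forall g h e, acte (g * h)%g e = acte g (acte h e);
  act_src : forall g e, src (acte g e) = actv g (src e);
  act_flip : forall g e, flip (acte g e) = acte g (flip e) }.

Section Actions.
Variables (G : groupType) (X : graph) (act : graph_action G X).

(* Freeness on the geometric realization: no nontrivial element fixes a       *)
(* vertex, or preserves an edge (possibly inverting it).                      *)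
Definition free_action : Prop :=
  (forall g v, actv act g v = v -> g = 1%g) /\
  (forall g e, acte act g e = e \/ acte act g e = flip e -> g = 1%g).

Definition cocompact_action : Prop :=
  (exists (n : nat) (v : 'I_n -> vertex X),
     forall u, exists i g, u = actv act g (v i)) /\
  (exists (n : nat) (e : 'I_n -> dart X),
     forall d, exists i g, d = acte act g (e i)).

Variables (H : set G) (phi : G -> G).

(* The H-orbits of unoriented edges. *)
Definition same_edge_orbit (d e : dart X) : Prop :=
  exists2 h, H h & d = acte act h e \/ d = flip (acte act h e).

Definition edge_reps (k : nat) (e : 'I_k -> dart X) : Prop :=
  forall d, exists! i, same_edge_orbit d (e i).

(* An edge may be sent to an edge-path of length 0. *)
Record equivariant_map := EquivariantMap {
  mapv : vertex X -> vertex X;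
  mape : dart X -> seq (dart X);
  mape_path : forall e, edge_path (mapv (src e)) (mape e) (mapv (tgt e));
  mape_flip : forall e, mape (flip e) = rev_path (mape e);
  mapv_equiv : forall h v, H h ->
    mapv (actv act h v) = actv act (phi h) (mapv v);
  mape_equiv : forall h e, H h ->
    mape (acte act h e) = map (acte act (phi h)) (mape e) }.

Definition total_dist (k : nat) (e : 'I_k -> dart X)
    (Phi : equivariant_map) : nat :=
  (\sum_(i < k) size (mape Phi (e i)))%N.

Definition avg_dist (R : realType) (k : nat) (e : 'I_k -> dart X)
    (Phi : equivariant_map) : R :=
  (total_dist e Phi)%:R / k%:R.

(* "AvgDist(phi) exists and equals a". *)
Definition is_AvgDist (R : realType) (a : R) : Prop :=
  exists (k : nat) (e : 'I_k -> dart X),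
    [/\ edge_reps e,
        (exists Phi, avg_dist R e Phi = a) &
        (forall Phi, a <= avg_dist R e Phi)].

End Actions.

(* Main.v *)
(* Consider a phi-equivariant map f : G -> G of minimal energy, the sum of     *)
(* d(f x, f(x s)) over the generators s and over x in a transversal of H; up   *)
(* to constants, AvgDist(phi) is the energy divided by [G : H].  A point p on  *)
(* a geodesic from f x to f(x s) cuts a large ball around x in two: the points *)
(* y such that f y and f x lie in the same direction as seen from p, and the   *)
(* others (for all but boundedly many p, the Gromov products at p of the       *)
(* f-values are either small or large, so that directions make sense).  The    *)
(* cut has locally minimal size, since otherwise collapsing a part of one side *)
(* to p would lower the energy.                                                *)
(*                                                                             *)
(* A minimal cut has to branch.  Indeed, in the absence of branching it has at *)
(* most two limit points at infinity, and as the group has one end and no cut  *)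
(* pair, one side of the cut accumulates only at these points.  Minimality and *)
(* nonamenability, applied to a truncated visual distance to these points,     *)
(* then force this side to grow faster than the balls of G.  By compactness    *)
(* the branching is uniform, so that iterating it yields 2^m points at         *)
(* distance O(m) from x where f still passes close to p, whereas each of these *)
(* comes from O(m) points x only.  Counting pairs (x, p) modulo H shows that   *)
(* the energy is at most half of itself plus a constant times [G : H].         *)
(* Residual finiteness is used to make balls of a fixed radius embed in H\G.   *)
(*                                                                             *)
(* For the lower bound, injectivity of phi makes the fibres of an equivariant  *)
(* map finite, and by nonamenability a positive proportion of the points of    *)
(* a finite set have a neighbour outside of it, i.e. an edge which is not      *)
(* collapsed.                                                                  *)

Require Import Defs.
From mathcomp Require Import all_boot all_order all_fingroup all_algebra.
From mathcomp Require Import all_classical all_reals all_analysis.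
From mathcomp Require Import zify lra.

Set Implicit Arguments.
Unset Strict Implicit.
Unset Printing Implicit Defensive.

Import Order.TTheory GRing.Theory Num.Theory.

(** * The word metric *)

(** The total length of a suitable equivariant map of X is at most a constant times the energy of an
    equivariant map f of G ([total_dist_energy]). The upper bound therefore rests on [energy_bound]:
    the minimal energy is at most a constant times the index, uniformly in H and phi, once balls of
    a fixed radius embed in H\G ([sparse_subgroup]).

    Three facts carry it. First, [energy_locally_minimal]: if f has minimal energy, the cut of a
    ball defined by a good point p cannot be shortened by local removals. Secondly,
    [locally_minimal_tripod]: the boundary of such a cut branches. This is where rigidity enters. A
    cut without branching has at most two limit points, so one of its sides lies in four cones
    ([thin_cones]), and [no_thin_minimal_cut] excludes this by its growth. Thirdly, [uniform_tripod]
    and [descendants] iterate the branching, and [mass_transport] plays the 2^m descendants against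
    the O(m) ancestors ([descendants_count]).

    Nonamenability comes from the same doubling argument: [tripod_one_ended] shows that G itself
    branches, and [nonamenable] follows. It is used again for the lower bound,
    [total_dist_lower]. *)

Section WordMetricTheory.
Variables (G : groupType) (S : seq G).
Hypothesis genS : generates S.
Local Open Scope nat_scope.
Local Notation len := (word_length S).
Local Notation d := (word_dist S).

(** As a list with multiplicities this is invariant under inversion, so that sums over oriented
    edges can be reversed ([gens_sumV]). *)
Definition gens := S ++ [seq x^-1%g | x <- S].

Lemma mem_gens x : (x \in gens) = (x \in S) || (x^-1%g \in S).
Proof.
rewrite mem_cat; congr (_ || _); apply/mapP/idP => [[y yS ->]|xS].
  by rewrite invgK.
by exists x^-1%g; rewrite ?invgK.
Qed.

Lemma gensV x : (x^-1%g \in gens) = (x \in gens).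
Proof. by rewrite !mem_gens invgK orbC. Qed.

Lemma word_forE g w :
  word_for S g w <-> all (mem gens) w /\ \big[*%g/1%g]_(x <- w) x = g.
Proof.
split=> -[wS wg]; split=> //.
  by apply/allP => x xw; rewrite inE mem_gens wS.
by move=> x xw; rewrite -mem_gens; apply: (allP wS).
Qed.

Lemma lenP g : (exists2 w, word_for S g w & size w = len g) /\
  (forall w, word_for S g w -> len g <= size w).
Proof.
apply: (@xgetPex _ 0 [set n | (exists2 w, word_for S g w & size w = n) /\
                    (forall w, word_for S g w -> (n <= size w)%N)]).
have ex : exists n, `[< exists2 w, word_for S g w & size w = n >].
  by case: (genS g) => w wg; exists (size w); apply/asboolP; exists w.
exists (ex_minn ex); case: ex_minnP => n /asboolP nw nmin; split=> // w wg.
by apply: nmin; apply/asboolP; exists w.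
Qed.

Lemma len_le g w : all (mem gens) w -> \big[*%g/1%g]_(x <- w) x = g ->
  len g <= size w.
Proof. by move=> wS wg; apply: (lenP g).2; apply/word_forE. Qed.

Lemma len_word g : exists w,
  [/\ all (mem gens) w, \big[*%g/1%g]_(x <- w) x = g & size w = len g].
Proof. by case: (lenP g) => -[w /word_forE[? ?] ?] _; exists w. Qed.

Lemma len1 : len 1%g = 0.
Proof. by apply/eqP; rewrite -leqn0 (@len_le _ [::]) ?big_nil. Qed.

Lemma len_eq0 g : len g = 0 -> g = 1%g.
Proof. by case: (len_word g) => w [_ <- <-] /size0nil ->; rewrite big_nil. Qed.

Lemma lenM g h : len (g * h)%g <= len g + len h.
Proof.
case: (len_word g) => w [wS <- <-]; case: (len_word h) => v [vS <- <-].
by rewrite -size_cat len_le ?all_cat ?wS ?vS // big_cat.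
Qed.

Lemma lenV_le g : len g^-1%g <= len g.
Proof.
case: (len_word g) => w [wS <- <-].
rewrite -(size_rev w) -(size_map (fun x => x^-1%g)) len_le //.
  rewrite all_map all_rev; by apply: sub_all wS => x /=; rewrite gensV.
rewrite big_map; elim: w {wS} => [|x w IH]; first by rewrite !big_nil invg1.
by rewrite rev_cons big_rcons /= IH big_cons invMg.
Qed.

Lemma lenV g : len g^-1%g = len g.
Proof. by apply/eqP; rewrite eqn_leq lenV_le -{1}(invgK g) lenV_le. Qed.

Lemma len_gens s : s \in gens -> len s <= 1.
Proof. by move=> sS; rewrite (@len_le _ [:: s]) ?big_seq1 //= andbT. Qed.

Lemma len_stepr g n : len g = n.+1 ->
  exists s, [/\ s \in gens, len (g * s)%g = n & g <> 1%g].
Proof.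
move=> gn; case: (len_word g) => w [wS wg ws].
have := ws; rewrite gn; case/lastP: w wS wg ws => // w x.
rewrite all_rcons big_rcons /= size_rcons => /andP[xS wS].
set p := (X in (X * x)%g) => wg _ [ws].
exists x^-1%g; rewrite gensV; split=> //; last first.
  by move=> g1; move: gn; rewrite g1 len1.
have pn : len p <= n by rewrite -ws len_le.
have := lenM p x; rewrite wg gn -wg mulgK.
by have := len_gens xS; lia.
Qed.

Lemma dxx x : d x x = 0. Proof. by rewrite /word_dist mulVg len1. Qed.

Lemma d_eq0 x y : d x y = 0 -> x = y.
Proof. by move/len_eq0/eqP; rewrite mulg_eq1 => /eqP/invg_inj. Qed.

Lemma d_sym x y : d x y = d y x.
Proof. by rewrite /word_dist -lenV invMg invgK. Qed.

Lemma d_tri y x z : d x z <= d x y + d y z.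
Proof. by rewrite /word_dist; have := lenM (x^-1 * y)%g (y^-1 * z)%g; rewrite -mulgA mulVKg. Qed.

Lemma d_left (g x y : G) : d (g * x)%g (g * y)%g = d x y.
Proof. by rewrite /word_dist invMg -mulgA mulKg. Qed.

Lemma d_gens (x s : G) : s \in gens -> d x (x * s)%g <= 1.
Proof. by rewrite /word_dist mulKg => /len_gens. Qed.

Lemma d1 x : d 1%g x = len x.
Proof. by rewrite /word_dist invg1 mul1g. Qed.

Lemma d_step x y n : d x y = n.+1 ->
  exists2 s, s \in gens & d x (y * s)%g = n.
Proof.
by rewrite /word_dist => /len_stepr[s [sS sn _]]; exists s; rewrite // mulgA.
Qed.

Lemma d_lip (x y s : G) : s \in gens -> d x (y * s)%g <= (d x y).+1.
Proof. by move=> /(d_gens y) h; have t := d_tri y x (y * s)%g; lia. Qed.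

Lemma d_lip' (x y s : G) : s \in gens -> d x y <= (d x (y * s)%g).+1.
Proof.
move=> /(d_gens y); have := d_tri (y * s)%g x y.
by rewrite (d_sym (y * s)%g); lia.
Qed.

Lemma geodesicP x y : exists c : nat -> G,
  [/\ c 0 = x, c (d x y) = y & forall i j, i <= j -> j <= d x y ->
    d (c i) (c j) = j - i].
Proof.
move: {2}(d x y) (erefl (d x y)) => n; elim: n y => [|n IH] y xy.
  exists (fun=> x); rewrite xy; split=> //; first exact: d_eq0 xy.
  by move=> i j ij j0; rewrite dxx; lia.
case: (d_step xy) => s sS xn; case: (IH _ xn) => c [c0 cn cg].
exists (fun i => if i <= n then c i else y); rewrite xy ltnn leq0n.
split=> // i j ij; rewrite leq_eqVlt => /predU1P[->|jn]; last first.
  rewrite ltnS in jn; rewrite jn (leq_trans ij jn) cg // xn //.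
rewrite ltnn; case: leqP => [il|ni]; last by rewrite dxx; lia.
have h1 : d (c i) (y * s)%g = n - i by rewrite -{1}cn xn cg // xn.
have h2 : d x (c i) = i by rewrite -{1}c0 cg ?xn ?subn0 //.
have := d_lip' (c i) y sS; have := d_tri (c i) x y; lia.
Qed.

(** Walk along a geodesic from [y] back to [x] until [P] holds. The two equalities keep the edge
    found on such geodesics. *)
Lemma crossing (P : pred G) x y : P x -> ~~ P y ->
  exists z s, [/\ s \in gens, P z, ~~ P (z * s)%g, d x z + d z y = d x y &
    d x (z * s)%g + d (z * s)%g y = d x y].
Proof.
move: {2}(d x y) (erefl (d x y)) => n; elim: n y => [|n IH] y xy Px nPy.
  by move: nPy; rewrite -(d_eq0 xy) Px.
case: (d_step xy) => s sS xn; have y1 := d_gens y sS.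
have t1 := d_tri (y * s)%g x y; rewrite xn (d_sym (y * s)%g y) in t1.
have yE : d y (y * s)%g = 1 by lia.
case: (boolP (P (y * s)%g)) => Pys.
  exists (y * s)%g, s^-1%g; rewrite gensV mulgK; split=> //;
    by rewrite ?dxx ?xn ?(d_sym (y * s)%g y) ?yE; lia.
case: (IH _ xn Px Pys) => z [t [tS Pz nPz e1 e2]]; exists z, t.
have y2 : d (y * s)%g y = 1 by rewrite d_sym.
split=> //.
  by have := d_tri (y * s)%g z y; have := d_tri z x y; lia.
by have := d_tri (y * s)%g (z * t)%g y; have := d_tri (z * t)%g x y; lia.
Qed.

Fixpoint ball1 n : seq G :=
  if n is n'.+1 then
    undup (ball1 n' ++ [seq (x * s)%g | x <- ball1 n', s <- gens])
  else [:: 1%g].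

Definition ball x n := [seq (x * y)%g | y <- ball1 n].

Lemma mem_ball1 n x : (x \in ball1 n) = (len x <= n).
Proof.
elim: n x => [|n IH] x /=.
  rewrite inE leqn0; apply/eqP/eqP => [->|/len_eq0//]; exact: len1.
rewrite mem_undup mem_cat IH; apply/orP/idP => [[|/allpairsP[[y s] /=]]|].
- by move/leq_trans; apply.
- by rewrite IH => -[yn sS ->]; have := lenM y s; have := len_gens sS; lia.
rewrite leq_eqVlt => /predU1P[/len_stepr[s [sS sn _]]|]; last by left.
right; apply/allpairsP; exists ((x * s)%g, s^-1%g); rewrite /= IH sn gensV.
by rewrite mulgK.
Qed.

Lemma mem_ball x n y : (y \in ball x n) = (d x y <= n).
Proof.
rewrite /word_dist -mem_ball1; apply/mapP/idP => [[z zn ->]|]; rewrite ?mulKg //.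
by move=> h; exists (x^-1 * y)%g; rewrite ?mulVKg.
Qed.

Lemma ball_uniq x n : uniq (ball x n).
Proof.
rewrite map_inj_uniq; last exact: mulgI.
by case: n => //= n; rewrite undup_uniq.
Qed.

Definition vol n := size (ball1 n).

Lemma size_ball x n : size (ball x n) = vol n. Proof. exact: size_map. Qed.

Lemma uniq_ball_size (A : seq G) x n : uniq A ->
  (forall y, y \in A -> d x y <= n) -> size A <= vol n.
Proof.
move=> uA An; rewrite -(size_ball x); apply: uniq_leq_size => // y /An.
by rewrite mem_ball.
Qed.

Lemma vol_gt0 n : 0 < vol n.
Proof. by rewrite -(size_ball 1%g) -has_predT; apply/hasP; exists 1%g; rewrite ?mem_ball ?dxx. Qed.

Lemma volM n k : vol (n + k) <= vol n * vol k.
Proof.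
rewrite /vol -(size_allpairs (fun x y => (x * y)%g)).
apply: uniq_leq_size => [|x].
  by case: (n + k) => //= ?; rewrite undup_uniq.
rewrite mem_ball1 => xnk; apply/allpairsP.
case: (geodesicP 1%g x) => c [c0 cx cg].
have [i [il ni ik]] : exists i, [/\ i <= d 1%g x, i <= n & len x - i <= k].
  by exists (minn n (len x)); rewrite d1; split; lia.
have h1 := cg 0 i (leq0n i) il; rewrite c0 d1 in h1.
have h2 := cg i _ il (leqnn _); rewrite cx d1 /word_dist in h2.
by exists (c i, ((c i)^-1 * x)%g); rewrite /= mulVKg !mem_ball1 h1 h2; split=> //; lia.
Qed.

Lemma vol_exp n : vol n <= vol 1 ^ n.
Proof.
elim: n => [|n IH]; first by [].
by rewrite expnS -add1n (leq_trans (volM _ _)) // leq_mul2l IH orbT.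
Qed.

End WordMetricTheory.

(** * Gromov products *)

Lemma size_fibers (T T' : eqType) (A : seq T) (B : seq T') (f : T -> T') V :
  (forall x, x \in A -> f x \in B) ->
  (forall y, y \in B -> (size [seq x <- A | f x == y] <= V)%N) ->
  (size A <= size B * V)%N.
Proof.
elim: B A => [|y B IH] A AB fV /=.
  by case: A AB {fV} => // x A /(_ x); rewrite mem_head => /(_ isT).
rewrite mulSn -(count_predC (fun x => f x == y)) leq_add //.
  by rewrite -size_filter fV ?mem_head.
rewrite -size_filter IH // => [x|z zB].
  by rewrite mem_filter /= => /andP[xy /AB]; rewrite inE (negPf xy).
rewrite (leq_trans _ (fV z _)) ?inE ?zB ?orbT // -filter_predI !size_filter.
by apply: sub_count => x /= /andP[].
Qed.

(** Double counting of the pairs related by [r]; it serves to compare points with their descendants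
    and with nearby boundary points. *)
Lemma size_pairs (T T' : eqType) (A : seq T) (B : seq T') (r : T -> T' -> bool) m V :
  (forall x, x \in A -> (m <= count (r x) B)%N) ->
  (forall y, y \in B -> (count (r^~ y) A <= V)%N) ->
  (size A * m <= size B * V)%N.
Proof.
move=> Am BV; have le1 : (size A * m <= \sum_(x <- A) count (r x) B)%N.
  elim: A Am {BV} => [|x A IH] Am; first by rewrite mul0n.
  rewrite big_cons mulSn leq_add ?Am ?mem_head // IH // => y yA.
  by rewrite Am // inE yA orbT.
apply: (leq_trans le1); under eq_bigr do rewrite -sum1_count big_mkcond.
rewrite exchange_big /=.
elim: B BV {le1 Am} => [|y B IH] BV; first by rewrite big_nil.
rewrite big_cons /= mulSn leq_add //.
  by rewrite -big_mkcond sum1_count BV ?mem_head.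
by rewrite IH // => z zB; rewrite BV // inE zB orbT.
Qed.

Section Hyperbolic.
Variables (G : groupType) (S : seq G).
Hypothesis genS : generates S.
Local Open Scope nat_scope.
Local Notation d := (word_dist S).

(* Twice the Gromov product, which is a natural number. *)
Definition gp (o x y : G) : nat := d o x + d o y - d x y.

Definition four_point (D : nat) : Prop :=
  forall o x y z, minn (gp o x y) (gp o y z) <= gp o x z + D.

Lemma gpE o x y : gp o x y + d x y = d o x + d o y.
Proof. by rewrite /gp; have := d_tri genS o x y; rewrite (d_sym genS x o); lia. Qed.

Lemma gpC o x y : gp o x y = gp o y x.
Proof. by rewrite /gp (d_sym genS y) addnC. Qed.

Lemma gpxx o x : gp o x x = (d o x).*2.
Proof. by have := gpE o x x; rewrite dxx //; lia. Qed.

Lemma gp_le o x y : gp o x y <= (d o x).*2.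
Proof. by have := gpE o x y; have := d_tri genS x o y; lia. Qed.

Lemma gp_le' o x y : gp o x y <= (d o y).*2.
Proof. by rewrite gpC gp_le. Qed.

Lemma gp_lip o x y z : gp o x y <= gp o x z + (d y z).*2.
Proof.
have := gpE o x y; have := gpE o x z; have := d_tri genS z o y.
by have := d_tri genS y x z; rewrite (d_sym genS z y); lia.
Qed.

Lemma gp_base o o' x y : gp o x y <= gp o' x y + (d o o').*2.
Proof.
have := gpE o x y; have := gpE o' x y; have := d_tri genS o' o y.
by have := d_tri genS o' o x; lia.
Qed.

Lemma gp_left g o x y : gp (g * o)%g (g * x)%g (g * y)%g = gp o x y.
Proof. by rewrite /gp !d_left. Qed.

Lemma gp_swap o x y : gp o x y + gp x o y = (d o x).*2.
Proof.
by have := gpE o x y; have := gpE x o y; rewrite (d_sym genS x o); lia.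
Qed.

Section FourPoint.
Variable D : nat.
Hypothesis hypD : four_point D.

Lemma gp_tri o x y z : minn (gp o x y) (gp o y z) <= gp o x z + D.
Proof. exact: hypD. Qed.

(** Both points are close to a geodesic from [u] to [v]. The four-point condition at [u], applied
    through [v], shows that such points are determined up to a bounded error by their distance to
    [u]. *)
Lemma gp_slice u v p p' c w : gp p u v <= c -> gp p' u v <= c ->
  d u p <= d u p' + w -> d u p' <= d u p + w -> d p p' <= w + c + D.
Proof.
have := gp_tri u p v p'; rewrite (gpC u v).
have := gp_swap u p v; have := gp_swap u p' v; have := gpE u p p'; lia.
Qed.

Lemma slice_count (A : seq G) u v c w i : uniq A ->
  (forall p, p \in A -> [/\ gp p u v <= c, i <= d u p & d u p <= i + w]) ->
  size A <= vol S (w + c + D).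
Proof.
case: A => [|p0 A] uA hA; first by rewrite /= ltnW ?vol_gt0.
have [g0 i0 w0] := hA p0 (mem_head _ _).
apply: (@uniq_ball_size _ _ genS _ p0) => // p /hA[gp1 i1 w1].
by apply: (gp_slice g0 gp1); lia.
Qed.

Lemma slab_count (A : seq G) u v c n : uniq A ->
  (forall p, p \in A -> gp p u v <= c /\ d u p <= n) ->
  size A <= n.+1 * vol S (c + D).
Proof.
move=> uA hA; rewrite -(size_iota 0 n.+1).
apply: (@size_fibers _ _ _ _ (d u)) => [p /hA[_ h]|i _].
  by rewrite mem_iota add0n ltnS.
rewrite -[c]add0n (@slice_count _ u v c 0 i) ?filter_uniq // => p.
by rewrite mem_filter => /andP[/eqP-> /hA[]]; rewrite addn0.
Qed.

End FourPoint.

Lemma hyperbolic_four_point (R : realType) : hyperbolic S R ->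
  exists D, four_point D.
Proof.
move=> [delta hd].
have [N hN] : exists N : nat, ((delta *+ 2) <= N%:R :> R)%R.
  exists (Num.truncn `|(delta *+ 2)%R|%R).+1.
  by rewrite (le_trans (ler_norm _)) // ltW // truncnS_gt.
exists N => o x y z; have := hd o x y z.
have gR a b : gromov_product S R o a b = ((gp o a b)%:R / 2)%R.
  by rewrite /gromov_product -natrD -gpE natrD addrK.
rewrite !gR => h.
have {h}: ((minn (gp o x y) (gp o y z))%:R <= (gp o x z)%:R + N%:R :> R)%R.
  case: (leqP (gp o x y) (gp o y z)) => le.
    have : ((gp o x y)%:R <= (gp o y z)%:R :> R)%R by rewrite ler_nat.
    by move=> le'; move: h; rewrite min_l; lra.
  have : ((gp o y z)%:R <= (gp o x y)%:R :> R)%R by rewrite ler_nat ltnW.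
  by move=> le'; move: h; rewrite min_r; lra.
by rewrite -natrD ler_nat.
Qed.

End Hyperbolic.

(** * Tripods *)

(** This is how m is chosen in the doubling arguments: 2^m descendants against a number of ancestors
    linear in m. *)
Lemma exp_beats a b : exists m, (a * (m * b + 1) <= 2 ^ m)%N.
Proof.
have lin n : (2 * n + 2 <= 2 ^ n.+1)%N.
  by elim: n => // n; rewrite [X in _ -> (_ <= X)%N]expnS; move: (2 ^ n.+1)%N => e; lia.
have sq n : (n * n <= 2 ^ n.+1)%N.
  elim: n => // n; rewrite [X in _ -> (_ <= X)%N]expnS; have := lin n.
  by move: (2 ^ n.+1)%N => e; nia.
have key m : (0 < m -> a * (m * b + 1) <= (a * b + a) * m)%N.
  move=> m0; rewrite mulnDr muln1 mulnCA mulnDl (mulnC m) leq_add2l.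
  by rewrite -{1}(muln1 a) leq_mul2l m0 orbT.
move: (a * b + a)%N key => c key; exists (4 * c + 3)%N.
apply: (leq_trans (key _ _)); first by rewrite addn3.
have := sq (4 * c + 2)%N; rewrite -addnS; apply: leq_trans; nia.
Qed.

Section Trees.
Variables (G : groupType) (S : seq G).
Hypothesis genS : generates S.
Variable D : nat.
Hypothesis hypD : four_point S D.
Local Open Scope nat_scope.
Local Notation d := (word_dist S).
Local Notation gp := (gp S).

(** Three points of [A] in pairwise different directions from [x]: for [L] large compared to [K], a
    branching of [A]. The bound [rho] makes this a property of a ball, to which compactness
    applies. *)
Definition tripod (A : pred G) (x : G) (K L rho : nat) : Prop :=
  exists y : 'I_3 -> G,
    (forall i, A (y i) /\ L <= d x (y i) <= rho) /\
    (forall i j, i != j -> gp x (y i) (y j) <= K).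

(** By the four-point condition, two arms whose products with [o] exceed [K + D] would have a
    product exceeding [K] with each other. Hence at most one arm points towards [o], and two others
    lead away from it. *)
Lemma tripod_away (A : pred G) x K L rho (o : G) : tripod A x K L rho ->
  exists y1 y2, [/\ A y1 /\ L <= d x y1 <= rho, A y2 /\ L <= d x y2 <= rho,
    gp x y1 y2 <= K, gp x o y1 <= K + D & gp x o y2 <= K + D].
Proof.
move=> [y [Ay yK]].
have [i0 hi0] : exists i0, forall j, j != i0 -> gp x o (y j) <= K + D.
  case: (pselect (exists i, K + D < gp x o (y i))) => [[i hi]|no].
    exists i => j ji; rewrite leqNgt; apply/negP => hj.
    have := gp_tri hypD x (y i) o (y j); rewrite (gpC genS x (y i)).
    by have := yK i j; rewrite eq_sym ji => /(_ isT); lia.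
  exists ord0 => j _; rewrite leqNgt; apply/negP => hj; apply: no.
  by exists j.
have [j1 [j2 [j10 j20 j12]]] : exists j1 j2 : 'I_3, [/\ j1 != i0, j2 != i0 & j1 != j2].
  case: i0 {hi0} => -[|[|[]]] // i0.
  - by exists (inord 1), (inord 2); rewrite -!val_eqE /= !inordK.
  - by exists (inord 0), (inord 2); rewrite -!val_eqE /= !inordK.
  - by exists (inord 0), (inord 1); rewrite -!val_eqE /= !inordK.
by exists (y j1), (y j2); split=> //; [exact: yK|exact: hi0|exact: hi0].
Qed.

(* Starting from x, keep moving away from o: the two branches of a tripod     *)
(* never meet again, so that the number of descendants doubles.               *)
Lemma descendants (A : pred G) K L rho (o : G) m x : K + 3 * D < L -> A x ->
  (forall z, A z -> d x z <= m * rho -> tripod A z K L rho) ->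
  exists Z : seq G, [/\ uniq Z, size Z = 2 ^ m &
    forall z, z \in Z -> [/\ A z, d x z <= m * rho & gp x o z <= K + 2 * D]].
Proof.
move=> KL; elim: m x => [|m IH] x Ax tr.
  exists [:: x]; split=> // z; rewrite inE => /eqP->; split=> //.
    by rewrite dxx.
  by have := gpE genS x o x; rewrite dxx // (d_sym genS o x); lia.
have [|y1 [y2 [[A1 /andP[L1 r1]] [A2 /andP[L2 r2]] y12 o1 o2]]] :=
  tripod_away o (tr x Ax _); first by rewrite dxx.
have main y : A y -> L <= d x y -> d x y <= rho -> gp x o y <= K + D ->
    exists Z : seq G, [/\ uniq Z, size Z = 2 ^ m & forall z, z \in Z ->
      [/\ A z, d x z <= m.+1 * rho, gp x o z <= K + 2 * D &
          K + D < gp x y z]].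
  move=> Ay Ly ry oy; case: (IH y Ay) => [z Az yz|Z [uZ sZ hZ]].
    by apply: tr => //; have := d_tri genS y x z; rewrite mulSn; lia.
  exists Z; split=> // z /hZ[Az yz oz].
  have h1 : gp y x z <= K + 3 * D.
    have := gp_tri hypD y o x z; have := gp_swap genS y x o.
    by rewrite (gpC genS x y) (gpC genS y x o) (d_sym genS y); lia.
  have h2 : 2 * L - K - 3 * D <= gp x y z.
    by have := gp_swap genS x y z; lia.
  have := gp_tri hypD x o z y; rewrite (gpC genS x z).
  by have := d_tri genS y x z; rewrite mulSn; split=> //; lia.
have [Z1 [u1 s1 h1]] := main _ A1 L1 r1 o1.
have [Z2 [u2 s2 h2]] := main _ A2 L2 r2 o2.
exists (Z1 ++ Z2); split.
- rewrite cat_uniq u1 u2 andbT; apply/hasPn => z /h2[_ _ _ z2].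
  apply/negP => /h1[_ _ _ z1]; have := gp_tri hypD x y1 z y2.
  by rewrite (gpC genS x z); lia.
- by rewrite size_cat s1 s2 addnn expnS mul2n.
- by move=> z; rewrite mem_cat => /orP[/h1[]|/h2[]].
Qed.

(** A point x with [gp x o z <= c] is close to a geodesic from z to [o], so that z has a number of
    ancestors within distance [k] which is at most linear in [k]. *)
Lemma descendants_count (P Z : seq G) o n c k : uniq P -> uniq Z ->
  (forall x, x \in P -> exists Z', [/\ uniq Z', n <= size Z' & forall z, z \in Z' ->
     [/\ z \in Z, d x z <= k & gp x o z <= c]]) ->
  size P * n <= size Z * (k.+1 * vol S (c + D)).
Proof.
move=> uP uZ PZ.
apply: (@size_pairs _ _ P Z (fun x z => (d x z <= k) && (gp x o z <= c))).
  move=> x /PZ[Z' [uZ' nZ' hZ']]; apply: (leq_trans nZ'); rewrite -size_filter.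
  apply: uniq_leq_size => // z /hZ'[zZ zk zc].
  by rewrite mem_filter zZ zk zc.
move=> z _; rewrite -size_filter.
apply: (@slab_count _ _ genS D hypD _ z o); rewrite ?filter_uniq // => p.
by rewrite mem_filter => /andP[/andP[h1 h2] _]; rewrite (gpC genS) d_sym.
Qed.

Lemma tripod_left (A : pred G) x K L rho : tripod predT 1%g K L rho ->
  A =1 predT -> tripod A x K L rho.
Proof.
move=> [y [hy1 hy2]] AT; exists (fun i => x * y i)%g; split=> [i|i j ij].
  by rewrite AT -[X in d X]mulg1 d_left //; split=> //; case: (hy1 i).
by rewrite -[X in gp X]mulg1 gp_left // hy2.
Qed.

(** A point deep inside A has 2^m descendants in A, each of which has O(m) ancestors. For the chosen
    m, at most half of the points of A are deep; the others are within [m * rho] of an edge leaving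
    A. *)
Lemma nonamenable K L rho : tripod predT 1%g K L rho -> K + 3 * D < L ->
  exists h, forall A : seq G, uniq A ->
    size A <= h * \sum_(x <- A) \sum_(s <- gens S) (x * s \notin A)%g.
Proof.
move=> tr KL.
have [m hm] := exp_beats (2 * vol S (K + 2 * D + D)) rho.
exists (2 * vol S (m * rho)) => A uA.
pose inner x := all (mem A) (ball S x (m * rho)).
pose A0 := [seq x <- A | inner x]; pose A1 := [seq x <- A | ~~ inner x].
pose A2 := [seq x <- A | has (fun s => x * s \notin A)%g (gens S)].
have sA : size A = size A0 + size A1 by rewrite !size_filter count_predC.
have le0 : size A0 * 2 ^ m <= size A * ((m * rho).+1 * vol S (K + 2 * D + D)).
  apply: (@descendants_count _ _ 1%g); rewrite ?filter_uniq // => x.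
  rewrite mem_filter => /andP[/allP xA _].
  have [//|z _ _|Z [uZ sZ hZ]] := @descendants predT K L rho 1%g m x KL.
    exact: tripod_left.
  exists Z; split=> // [|z /hZ[_ z1 z2]]; first by rewrite sZ.
  by split=> //; apply: xA; rewrite mem_ball.
have le1 : size A1 <= size A2 * vol S (m * rho).
  rewrite -[size A1]muln1.
  apply: (@size_pairs _ _ A1 A2 (fun x y => d x y <= m * rho)) => [x|y _].
    rewrite mem_filter => /andP[/allPn[z]]; rewrite mem_ball // => xz nz xA.
    have [y [s [sS yA nyA e _]]] := @crossing _ _ genS (mem A) x z xA nz.
    rewrite -has_count; apply/hasP; exists y; last by lia.
    by rewrite mem_filter [y \in A]yA andbT; apply/hasP; exists s.
  rewrite -size_filter (@uniq_ball_size _ _ genS _ y) ?filter_uniq // => x.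
  by rewrite mem_filter d_sym // => /andP[].
have le2 : size A2 <= \sum_(x <- A) \sum_(s <- gens S) (x * s \notin A)%g.
  rewrite -sum1_size big_filter big_mkcond leq_sum //= => x _.
  case: ifP => // /hasP[s sS xs].
  by rewrite (big_rem s) //= xs.
have : 2 * size A0 <= size A.
  have v0 := vol_gt0 genS (K + 2 * D + D); have m0 : 0 < 2 ^ m by rewrite expn_gt0.
  by nia.
by nia.
Qed.

End Trees.

(** * Tripods at a uniform scale *)

Section Stability.
Variables (G : groupType) (S : seq G).
Hypothesis genS : generates S.
Variable D : nat.
Hypothesis hypD : four_point S D.
Local Open Scope nat_scope.
Local Notation d := (word_dist S).
Local Notation gp := (gp S).
Variables (A : pred G) (K0 Kmax rho : nat).
Hypotheses (DK0 : D <= K0) (K0_gt0 : 0 < K0).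

Definition tripod_upto K z :=
  exists2 k, K0 <= k <= K & tripod S A z k (10 * k) rho.

(** Repeatedly move along an arm leading away from [y]. Near [y] the scales are at most [K], and
    further out [d y z] exceeds [Kmax + 2 * D]; in both cases a move increases the distance to [y]
    and keeps the direction of [z]. *)
Lemma outward y K M z :
  (forall w, A w -> d y w <= Kmax + 2 * D -> tripod_upto K w) ->
  (forall w, A w -> d y w <= M -> tripod_upto Kmax w) ->
  A z -> 10 * K <= d y z <= M + rho ->
  exists q, [/\ A q, M < d y q <= M + rho & d y z <= gp y z q].
Proof.
move=> near far; move: {2}(M.+1 - d y z) (leqnn (M.+1 - d y z)) => n.
elim: n z => [|n IH] z zn Az /andP[Kz zM].
  by exists z; rewrite gpxx //; split=> //; lia.
case: (ltnP M (d y z)) => Mz; first by exists z; rewrite gpxx //; split=> //; lia.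
have [k [kK0 dk tr]] : exists k, [/\ K0 <= k, k + 2 * D <= d y z & tripod S A z k (10 * k) rho].
  case: (leqP (d y z) (Kmax + 2 * D)) => dz.
    by case: (near z Az dz) => k /andP[k0 kK] tr; exists k; split=> //; lia.
  by case: (far z Az Mz) => k /andP[k0 kK] tr; exists k; split=> //; lia.
have [z' [_ [[Az' /andP[Lz' rz']] _ _ oz' _]]] := tripod_away genS hypD y tr.
have dz' : d y z + D + 1 <= d y z'.
  have := gp_swap genS z y z'; have := gpE genS z y z'.
  by rewrite (d_sym genS z y); lia.
have [||q [Aq Mq gq]] := IH z' _ Az'; first by lia.
  by have := d_tri genS z y z'; lia.
exists q; split=> //.
have := gp_tri hypD y z z' q; have := gp_swap genS y z z'.
by lia.
Qed.

Definition stab_rad := (Kmax + 1) * (Kmax + 2 * D).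

(** Whenever some nearby point has no tripod of scale at most K, move to it and take its larger
    scale. As scales are bounded by [Kmax], there are at most [Kmax] moves, for which [stab_rad]
    leaves room. *)
Lemma stable_point x0 N : A x0 -> stab_rad <= N ->
  (forall z, A z -> d x0 z <= N -> tripod_upto Kmax z) ->
  exists y K, [/\ A y, d x0 y <= stab_rad, K0 <= K <= Kmax, tripod S A y K (10 * K) rho &
    forall w, A w -> d x0 w <= N -> d y w <= Kmax + 2 * D -> tripod_upto K w].
Proof.
move=> Ax0 BN tr.
suff main n : forall z K, A z -> K0 <= K <= Kmax -> Kmax - K <= n ->
    d x0 z + n * (Kmax + 2 * D) <= stab_rad -> tripod S A z K (10 * K) rho ->
    exists y K, [/\ A y, d x0 y <= stab_rad, K0 <= K <= Kmax, tripod S A y K (10 * K) rho &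
    forall w, A w -> d x0 w <= N -> d y w <= Kmax + 2 * D -> tripod_upto K w].
  have [|K KK trx] := tr x0 Ax0; first by rewrite dxx.
  apply: (main Kmax x0 K) => //; first by lia.
  by rewrite dxx // /stab_rad; nia.
elim: n => [|n IH] z K Az KK Kn zn trz.
  exists z, K; split=> //; first by lia.
  by move=> w Aw wN _; case: (tr w Aw wN) => k hk trk; exists k => //; lia.
case: (pselect (forall w, A w -> d x0 w <= N -> d z w <= Kmax + 2 * D -> tripod_upto K w)).
  by move=> h; exists z, K; split=> //; lia.
move/existsNP => [w /not_implyP[Aw /not_implyP[wN /not_implyP[zw no]]]].
have [k /andP[k0 kM] trk] := tr w Aw wN.
have Kk : K < k.
  by rewrite ltnNge; apply/negP => kK; apply: no; exists k => //; lia.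
apply: (IH w k) => //; [lia|lia|].
by have := d_tri genS z x0 w; rewrite mulSn in zn; lia.
Qed.

(* The scales K vary from point to point.  Around a point where K is locally  *)
(* maximal, tripods can be prolonged to any length without turning back.      *)
Lemma uniform_tripod x0 L : A x0 ->
  (forall z, A z -> d x0 z <= 2 * stab_rad + L + rho + Kmax + 2 * D -> tripod_upto Kmax z) ->
  tripod S A x0 (Kmax + 2 * D + 2 * stab_rad) L (2 * stab_rad + L + rho).
Proof.
move=> Ax0; set N := 2 * stab_rad + L + rho + Kmax + 2 * D => tr.
have [||y [K [Ay xy KK [t [At tK]] near]]] := stable_point Ax0 (N := N) => //.
  by rewrite /N; lia.
set M := L + stab_rad.
have far w : A w -> d y w <= M -> tripod_upto Kmax w.
  by move=> Aw yw; apply: tr => //; have := d_tri genS y x0 w; rewrite /N /M in yw *; lia.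
have near' w : A w -> d y w <= Kmax + 2 * D -> tripod_upto K w.
  by move=> Aw yw; apply: near => //; have := d_tri genS y x0 w; rewrite /N; lia.
have ex i : exists q, [/\ A q, M < d y q <= M + rho & d y (t i) <= gp y (t i) q].
  have [Ati /andP[L1 L2]] := At i.
  by apply: (outward near' far) => //; lia.
have [q hq] := choice ex.
exists q; split=> [i|i j ij].
  have [Aq /andP[q1 q2] _] := hq i; split=> //; rewrite /M in q1 q2.
  have := d_tri genS y x0 (q i); have := d_tri genS x0 y (q i).
  by rewrite (d_sym genS y x0); lia.
have [_ _ gi] := hq i; have [_ _ gj] := hq j.
have [_ /andP[ti _]] := At i; have [_ /andP[tj _]] := At j.
have := gp_base genS x0 y (q i) (q j).
have := gp_tri hypD y (t i) (q i) (q j).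
have := gp_tri hypD y (t i) (q j) (t j).
by have := tK i j ij; rewrite (gpC genS y (q j)); lia.
Qed.

End Stability.

(** * Thin minimal cuts *)

Section Frink.
Variables (T : eqType) (rho : T -> T -> nat).
Local Open Scope nat_scope.
Hypothesis rho2 : forall x y z, rho x z <= 2 * maxn (rho x y) (rho y z).
Hypothesis rho3 : forall x y z t,
  rho x t <= 2 * maxn (rho x y) (maxn (rho y z) (rho z t)).

Fixpoint chain_cost x (s : seq T) :=
  if s is y :: s' then rho x y + chain_cost y s' else 0.

Lemma chain_cost_cat x s t :
  chain_cost x (s ++ t) = chain_cost x s + chain_cost (last x s) t.
Proof. by elim: s x => //= y s IH x; rewrite IH addnA. Qed.

(** [c] is the cost already spent and [b] the total budget; the prefix [p] stops just before more
    than half of the budget is used. *)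
Lemma chain_split x s b c : s != [::] -> 2 * c <= b ->
  exists p y q, [/\ s = p ++ y :: q, 2 * (c + chain_cost x p) <= b &
    q = [::] \/ b < 2 * (c + chain_cost x p + rho (last x p) y)].
Proof.
elim: s x c => // y s IH x c _ cb.
have [->|sn] := eqVneq s [::].
  by exists [::], y, [::]; rewrite addn0; split=> //; left.
case: (ltnP b (2 * (c + rho x y))) => h.
  by exists [::], y, s; rewrite addn0; split=> //; right.
have [p [z [q [-> h1 h2]]]] := IH y _ sn h.
by exists (y :: p), z, q; rewrite /= addnA; split.
Qed.

(* Frink's metrization lemma: cut the chain at half of its length.            *)
Lemma frink x s : s != [::] -> rho x (last x s) <= 2 * chain_cost x s.
Proof.
move: {2}(size s) (leqnn (size s)) => n.
elim: n x s => [|n IH] x s; first by rewrite leqn0 size_eq0 => /eqP->.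
move=> sn snil; have [|p [y [q [se h1 h2]]]] := @chain_split x s (chain_cost x s) 0 snil.
  by rewrite muln0.
have cE : chain_cost x s = chain_cost x p + (rho (last x p) y + chain_cost y q).
  by rewrite se chain_cost_cat.
have lE : last x s = last y q by rewrite se last_cat.
have sE : size s = size p + (size q).+1 by rewrite se size_cat.
rewrite add0n in h1; rewrite add0n in h2.
have hp : p != [::] -> rho x (last x p) <= chain_cost x s.
  by move=> pn; apply: leq_trans (IH x p _ pn) h1; lia.
have hq : q != [::] -> rho y (last y q) <= chain_cost x s.
  move=> qn; apply: leq_trans (IH y q _ qn) _; first by lia.
  by case: h2 => [qe|]; [rewrite qe in qn|rewrite cE; lia].
rewrite lE; case: (eqVneq p [::]) => [pe|/hp {}hp].
  case: (eqVneq q [::]) => [->|/hq {}hq]; first by rewrite cE pe /=; lia.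
  by have := rho2 x y (last y q); rewrite cE pe /= in hq *; lia.
case: (eqVneq q [::]) => [->|/hq {}hq] /=.
  by have := rho2 x (last x p) y; lia.
by have := rho3 x (last x p) y (last y q); lia.
Qed.

(** [u z] is the least cost of a nonempty chain from z to [a]; unlike [rho], it satisfies an exact
    triangle inequality. *)
Lemma frink_fun a : exists u : T -> nat, [/\ forall z, rho z a <= 2 * u z,
  forall z, u z <= rho z a & forall z z', u z <= rho z z' + u z'].
Proof.
pose P z n := exists s, [/\ s != [::], last z s = a & chain_cost z s = n].
have exP z : exists n, `[< P z n >].
  by exists (rho z a); apply/asboolP; exists [:: a]; rewrite /= addn0.
pose u z := ex_minn (exP z).
have uP z : P z (u z) by rewrite /u; case: ex_minnP => n /asboolP.
have umin z n : P z n -> u z <= n.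
  by move=> zn; rewrite /u; case: ex_minnP => k _; apply; apply/asboolP.
exists u; split=> [z|z|z z'].
- by case: (uP z) => s [sn <- <-]; apply: frink.
- by apply: umin; exists [:: a]; rewrite /= addn0.
- by case: (uP z') => s [sn sl <-]; apply: umin; exists (z' :: s).
Qed.

End Frink.

Section ThinMinimalCut.
Variables (G : groupType) (S : seq G).
Hypothesis genS : generates S.
Variable D : nat.
Hypothesis hypD : four_point S D.
Local Open Scope nat_scope.
Local Notation d := (word_dist S).
Local Notation gp := (gp S).

(* Discarding a finite subset from V does not decrease the number of edges    *)
(* leaving V.                                                                 *)
Definition removal_minimal (V : pred G) := forall A : seq G, uniq A -> all V A ->
  \sum_(x <- A) \sum_(s <- gens S) ~~ V (x * s)%g <=
  \sum_(x <- A) \sum_(s <- gens S) (V (x * s)%g && (x * s \notin A)%g).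

Variable h : nat.
Hypothesis nonam : forall A : seq G, uniq A ->
  size A <= h * \sum_(x <- A) \sum_(s <- gens S) (x * s \notin A)%g.

Section Fixed.
Variable V : pred G.
Hypothesis minV : removal_minimal V.

(** Nonamenability bounds [A] by the edges leaving it. By minimality, those which also leave [V] are
    no more than those which end in [V], whence the factor 2. *)
Lemma minimal_bound (A : seq G) : uniq A -> all V A -> size A <=
  2 * h * \sum_(x <- A) \sum_(s <- gens S) (V (x * s)%g && (x * s \notin A)%g).
Proof.
move=> uA AV; have hm := minV uA AV; have hn := nonam uA.
apply: (leq_trans hn); rewrite (mulnC 2) -mulnA leq_mul2l; apply/orP; right.
rewrite mul2n -addnn; apply: leq_trans (leq_add hm (leqnn _)).
rewrite -big_split leq_sum //= => x _; rewrite -big_split leq_sum //= => s _.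
by case: (V _); case: (_ \in A).
Qed.

(** Sum [minimal_bound] over the superlevel sets of [w]: this gives a Poincare inequality for
    functions on [V] with finite support. *)
Lemma coarea (L : seq G) (w : G -> nat) theta : uniq L -> all V L ->
  (forall z, w z <= theta) -> (forall z, V z -> 0 < w z -> z \in L) ->
  \sum_(z <- L) w z <=
  2 * h * \sum_(z <- L) \sum_(s <- gens S) V (z * s)%g * (w z - w (z * s)%g).
Proof.
move=> uL LV wth wL; pose A t := [seq z <- L | t < w z].
have lay (a b : nat) : a <= theta -> \sum_(t < theta) ((t < a) && (b <= t)) = a - b.
  move=> ath; suff -> : forall n, \sum_(t < n) ((t < a) && (b <= t)) = minn a n - b.
    by rewrite (minn_idPl ath).
  elim=> [|n IH]; first by rewrite big_ord0 minn0.
  by rewrite big_ord_recr /= IH; case: (ltnP n a); case: (leqP b n); lia.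
have -> : \sum_(z <- L) w z = \sum_(t < theta) size (A t).
  under [RHS]eq_bigr do rewrite size_filter -sum1_count big_mkcond.
  rewrite exchange_big /=; apply: eq_bigr => z _; rewrite -{1}[w z]subn0 -(lay _ 0) //.
  by apply: eq_bigr => t _; rewrite andbT; case: (_ < _).
have -> : \sum_(z <- L) \sum_(s <- gens S) V (z * s)%g * (w z - w (z * s)%g) =
    \sum_(t < theta) \sum_(x <- A t) \sum_(s <- gens S) (V (x * s)%g && (x * s \notin A t)%g).
  under [RHS]eq_bigr do rewrite big_filter big_mkcond.
  rewrite [RHS]exchange_big /= big_seq [RHS]big_seq; apply: eq_bigr => z zL.
  under [RHS]eq_bigr => t _.
    rewrite (_ : (if _ then _ else _) = \sum_(s <- gens S)
       ((t < w z) && (V (z * s)%g && (z * s \notin A t)%g))); last first.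
      by case: (_ < _) => //; rewrite big1.
    over.
  rewrite exchange_big; apply: eq_bigr => s _.
  case Vs: (V (z * s)%g); last by rewrite mul0n big1 // => t _; rewrite andbF.
  rewrite mul1n -lay //; apply: eq_bigr => t _; rewrite andTb mem_filter.
  congr (nat_of_bool (_ && _)); rewrite leqNgt.
  case: (ltnP t (w (z * s)%g)) => //= tw.
  by rewrite wL // (leq_ltn_trans _ tw).
rewrite big_distrr leq_sum //= => t _.
apply: minimal_bound; first exact: filter_uniq.
by apply/allP => z; rewrite mem_filter => /andP[_]; apply: (allP LV).
Qed.

End Fixed.

End ThinMinimalCut.

Section Thin.
Variables (G : groupType) (S : seq G).
Hypothesis genS : generates S.
Variable D : nat.
Hypothesis hypD : four_point S D.
Local Open Scope nat_scope.
Local Notation d := (word_dist S).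
Local Notation len := (word_length S).
Local Notation gp := (gp S).

(** A chain of three products loses 2 D, and an edge changes a doubled product by at most 2. In this
    unit either loss amounts to a single level. *)
Definition step := 2 * D + 3.
Definition lev x y := gp 1%g x y %/ step.

Lemma lev_ge k x y : (k <= lev x y) = (k * step <= gp 1%g x y).
Proof. by rewrite leq_divRL // /step addn3. Qed.

Lemma lev_tri3 x y z t :
  minn (lev x y) (minn (lev y z) (lev z t)) <= (lev x t).+1.
Proof.
case kE: (minn _ _) => [//|k]; rewrite ltnS lev_ge.
have := leqnn k.+1; rewrite -{2}kE !leq_min !lev_ge mulSn => /and3P[h1 h2 h3].
have := gp_tri hypD 1%g x y t; have := gp_tri hypD 1%g y z t; rewrite /step in h1 h2 h3 *.
by lia.
Qed.

Lemma lev_lip (x y s a : G) : s \in gens S -> y = (x * s)%g -> lev x a <= (lev y a).+1.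
Proof.
move=> sS ->; case kE: (lev x a) => [//|k]; rewrite ltnS lev_ge.
have := leqnn k.+1; rewrite -{2}kE lev_ge mulSn.
have := gp_lip genS 1%g a x (x * s)%g; rewrite !(gpC genS _ a).
by have := d_gens genS x sS; rewrite /step; lia.
Qed.

(* 2 ^ (- lev) is a visual quasi-metric on the points far away from 1; the    *)
(* factor 2 ^ M keeps it in nat.                                              *)
Definition vis M x y := 2 ^ (M - lev x y).

Lemma vis3 M x y z t : vis M x t <=
  2 * maxn (vis M x y) (maxn (vis M y z) (vis M z t)).
Proof.
rewrite /vis.
have mono a b : (2 ^ a <= 2 ^ b) = (a <= b) by rewrite leq_exp2l.
have h := lev_tri3 x y z t.
suff [k [hk kle]] : exists k, [/\ M - lev x t <= k.+1 &
    2 ^ k <= maxn (2 ^ (M - lev x y)) (maxn (2 ^ (M - lev y z)) (2 ^ (M - lev z t)))].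
  rewrite (leq_trans _ (leq_mul (leqnn 2) kle)) // -expnS mono //.
exists (M - minn (lev x y) (minn (lev y z) (lev z t))); split; first by lia.
rewrite !leq_max !mono; lia.
Qed.

Lemma vis2 M x y z : vis M x z <= 2 * maxn (vis M x y) (vis M y z).
Proof.
have h := vis3 M x y y z; apply: (leq_trans h).
have : vis M y y <= maxn (vis M x y) (vis M y z); last by lia.
rewrite leq_max /vis !leq_exp2l //; have : lev x y <= lev y y \/ lev y z <= lev y y; last by lia.
by left; rewrite leq_div2r // gpxx // gp_le'.
Qed.

Section Level.
Variables (V : pred G) (cs : seq G).

Definition level_pred l z := V z && all (fun a => lev z a <= l) cs.

(* w is a truncated distance to cs for the metric which Frink's lemma         *)
(* extracts from vis (M := l + 2 + T).                                        *)
Lemma test_function l T : exists w : G -> nat, [/\ forall z, w z <= 2 ^ T,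
  forall z, all (fun a => lev z a <= l) cs -> w z = 2 ^ T,
  forall z, 0 < w z -> all (fun a => lev z a <= l.+1) cs &
  forall z z', w z - w z' <= 2 ^ (l + 2 + T - lev z z')].
Proof.
pose M := l + 2 + T; pose th := 2 ^ T.
have ex a : exists u : G -> nat, [/\ forall z, vis M z a <= 2 * u z,
    forall z, u z <= vis M z a & forall z z', u z <= vis M z z' + u z'].
  by apply: frink_fun; [exact: vis2|exact: vis3].
have [u hu] := choice ex.
pose w z := foldr (fun a m => minn (minn th (u a z - th)) m) th cs.
exists w; rewrite /w /level_pred; split=> z.
- by elim: cs => //= a r IH; rewrite geq_min IH orbT.
- elim: cs => //= a r IH /andP[al /IH->]; rewrite (minn_idPl _) //.
    apply/minn_idPl; have [h _ _] := hu a; have := h z; rewrite /vis.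
    have : 2 ^ (M - l) <= 2 ^ (M - lev z a) by rewrite leq_exp2l //; lia.
    have -> : M - l = T.+2 by rewrite /M; lia.
    by rewrite !expnS -/th; lia.
  by rewrite geq_minl.
- elim: cs => //= a r IH; rewrite !leq_min => /andP[/andP[_ h0] /IH->].
  rewrite andbT leqNgt; apply/negP => al; have [_ h _] := hu a; have := h z.
  have : vis M z a <= th; last by lia.
  by rewrite /vis /th leq_exp2l // /M; lia.
- move=> z'; elim: cs => [|a r IH] /=; first by rewrite subnn.
  have [_ _ h] := hu a; have := h z z'; rewrite -/M; rewrite /vis.
  by move: (2 ^ _) (foldr _ _ _) (foldr _ _ _) IH => *; lia.
Qed.

Variable h : nat.
Hypothesis nonam : forall A : seq G, uniq A ->
  size A <= h * \sum_(x <- A) \sum_(s <- gens S) (x * s \notin A)%g.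
Hypothesis minV : removal_minimal S V.

Definition near_const T := (T + 2) * step + 2 + D.

(** This is [coarea] for the test function w, which equals 2^T on [L0]. Its decrease along an edge
    inside [V] is at most 1, except at points lying in boundedly many balls, where it is at most
    2^T. *)
Lemma level_recursion R l T (L0 L1 : seq G) :
  L0 = [seq z <- ball S 1%g R | level_pred l z] ->
  L1 = [seq z <- ball S 1%g R | level_pred l.+1 z] ->
  (forall z, level_pred l.+1 z -> z \in L1) ->
  2 ^ T * size L0 <= 2 * h * size (gens S) *
    (2 ^ T * (size cs * vol S (near_const T)) + size L1).
Proof.
move=> L0E L1E cover.
have [w [wth w1 w0 wlip]] := test_function l T.
have uL1 : uniq L1 by rewrite L1E filter_uniq // ball_uniq.
have uL0 : uniq L0 by rewrite L0E filter_uniq // ball_uniq.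
have L1V : all V L1.
  by apply/allP => z; rewrite L1E mem_filter => /andP[/andP[]].
have step1 : 2 ^ T * size L0 <= \sum_(z <- L1) w z.
  have sub : {subset L0 <= L1}.
    move=> z; rewrite L0E L1E !mem_filter => /andP[/andP[zV /allP zl] ->].
    by rewrite andbT /level_pred zV; apply/allP => a /zl; exact: leqW.
  have -> : 2 ^ T * size L0 = \sum_(z <- L1 | z \in L0) w z.
    rewrite (eq_bigr (fun=> 2 ^ T)) => [|z]; last first.
      by rewrite L0E mem_filter => /andP[/andP[_ /w1]].
    rewrite big_const_seq iter_addn_0; congr (_ * _).
    rewrite -size_filter; apply/perm_size/uniq_perm; rewrite ?filter_uniq //.
    by move=> z; rewrite mem_filter; case: (boolP (z \in L0)) => // /sub->.
  by rewrite [leqRHS](bigID (mem L0)) /= leq_addr.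
apply: (leq_trans step1).
apply: (leq_trans (coarea nonam minV uL1 L1V wth _)).
  by move=> z Vz /w0 zl; apply: cover; rewrite /level_pred Vz.
rewrite -!mulnA !leq_mul2l; apply/orP; right; apply/orP; right.
(* Outside [near], either w is maximal at the neighbours of z, or z is so far from 1 that its edges
   have visual length 1, the least value of [vis]. *)
pose near z := has (fun a => l <= lev z a) cs && ((len z).*2 < (l + 2 + T) * step + 2).
have term (z s : G) : z \in L1 -> s \in gens S ->
    V (z * s)%g * (w z - w (z * s)%g) <= near z * 2 ^ T + 1.
  move=> zL sS; case: (V _); rewrite ?mul0n // mul1n.
  case: (ltnP ((len z).*2) ((l + 2 + T) * step + 2)) => hz; last first.
    rewrite (leq_trans (wlip _ _)) //.
    have -> : l + 2 + T - lev z (z * s)%g = 0; last by rewrite expn0 leq_addl.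
    apply/eqP; rewrite subn_eq0 lev_ge.
    have := gpE genS 1%g z (z * s)%g; have := d_gens genS z sS.
    by have := d_tri genS (z * s)%g 1%g z; rewrite !d1 (d_sym genS (z * s)%g z); lia.
  rewrite /near hz andbT; case: hasP => hc.
    by rewrite mul1n; have := wth z; lia.
  rewrite [w (z * s)%g]w1; first by have := wth z; lia.
  apply/allP => a ac; rewrite leqNgt; apply/negP => la; apply: hc.
  exists a => //; rewrite -ltnS (leq_trans la) //.
  apply: (@lev_lip _ _ s^-1%g); rewrite ?gensV // mulgK //.
have cnt : size [seq z <- L1 | near z] * 1 <= size cs * vol S (near_const T).
  apply: (@size_pairs _ _ _ cs (fun z a => l <= lev z a)) => [z|a ac].
    by rewrite mem_filter => /andP[/andP[hs _] _]; rewrite -has_count.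
  rewrite -size_filter.
  set B := [seq _ <- _ | _].
  have uB : uniq B by rewrite !filter_uniq.
  have hB z : z \in B -> l * step <= gp 1%g z a /\ (len z).*2 < (l + 2 + T) * step + 2.
    by rewrite !mem_filter lev_ge => /and3P[-> /andP[_ ->]].
  case: B uB hB => [|z0 B] uB hB; first by rewrite ltnW ?vol_gt0.
  have [g0 n0] := hB z0 (mem_head _ _).
  apply: (@uniq_ball_size _ _ genS _ z0) => // z /hB[g1 n1].
  have := gp_tri hypD 1%g z0 a z; rewrite (gpC genS _ a).
  have := gpE genS 1%g z0 z; rewrite !d1 /near_const.
  by rewrite !mulnDl in n0 n1 *; lia.
have le2 : \sum_(z <- L1) \sum_(s <- gens S) V (z * s)%g * (w z - w (z * s)%g) <=
    \sum_(z <- L1) size (gens S) * (near z * 2 ^ T + 1).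
  rewrite big_seq [leqRHS]big_seq leq_sum // => z zL.
  rewrite -sum1_size big_distrl /= big_seq [leqRHS]big_seq leq_sum // => s sS.
  by rewrite mul1n term.
apply: (leq_trans le2); rewrite -big_distrr leq_mul2l /=; apply/orP; right.
rewrite big_split /= sum1_size leq_add2r -big_distrl [leqRHS]mulnC leq_mul2r.
apply/orP; right; rewrite (leq_trans _ cnt) // muln1 size_filter -sum1_count.
by rewrite [leqRHS]big_mkcond leq_sum // => z _; case: near.
Qed.

End Level.
End Thin.

Section NoThin.
Variables (G : groupType) (S : seq G).
Hypothesis genS : generates S.
Variable D : nat.
Hypothesis hypD : four_point S D.
Local Open Scope nat_scope.
Local Notation len := (word_length S).
Local Notation lev := (lev S D).
Variable h : nat.
Hypothesis nonam : forall A : seq G, uniq A ->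
  size A <= h * \sum_(x <- A) \sum_(s <- gens S) (x * s \notin A)%g.

(* The points of V which stay at visual distance 2 ^ (- l) from cs would be   *)
(* multiplied by Q each time that l increases by one, which outgrows the      *)
(* volume of the balls containing them.                                       *)
Lemma no_thin_minimal_cut alpha beta : exists lmax, forall (V : pred G) cs x0,
  removal_minimal S V -> size cs <= 4 -> V x0 ->
  (forall a, a \in cs -> lev x0 a = 0) ->
  ~ (forall z, V z -> (forall a, a \in cs -> lev z a <= lmax) ->
       len z <= alpha * lmax + beta).
Proof.
pose m := vol S 1; have m_gt0 : 0 < m := vol_gt0 genS 1.
(* Q^n beats the volume of the ball of radius R. T is such that the recursion multiplies by Q,
   provided that the additive error c is at most half of the size, which holds after n levels. *)
pose b := 2 * h * size (gens S); pose Q := 2 * m ^ (2 * alpha + beta).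
pose T := b * (2 * Q); have TQ : b * (2 * Q) <= 2 ^ T by rewrite ltnW // ltn_expl.
pose c := b * (4 * vol S (near_const D T)); pose n := (2 * c).+1.
exists (2 * n) => V cs x0 minV cs4 Vx0 lx0 thin.
pose R := alpha * (2 * n) + beta.
pose L l := [seq z <- ball S 1%g R | level_pred S D V cs l z].
have uL l : uniq (L l) by rewrite filter_uniq // ball_uniq.
have cover l z : l <= 2 * n -> level_pred S D V cs l z -> z \in L l.
  move=> ln hz; rewrite mem_filter hz mem_ball // d1.
  move: hz => /andP[Vz /allP zl]; apply: thin => // a /zl/leq_trans; exact.
have rec l : l < 2 * n ->
  2 ^ T * size (L l) <= b * (2 ^ T * (4 * vol S (near_const D T)) + size (L l.+1)).
  move=> ln; have := @level_recursion _ _ genS D hypD V cs h nonam minV R l T _ _ erefl erefl.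
  move=> /(_ (fun z => cover l.+1 z ln)) /leq_trans; apply.
  by rewrite leq_mul2l leq_add2r leq_mul2l leq_mul2r cs4 !orbT.
have V0 : x0 \in L 0.
  by apply: cover => //; apply/andP; split=> //; apply/allP => a /lx0->.
have mono l : {subset L l <= L l.+1}.
  move=> z; rewrite !mem_filter => /andP[/andP[Vz /allP zl] ->]; rewrite andbT.
  by apply/andP; split=> //; apply/allP => a /zl /leqW.
(* If no point is added, then no edge joins [L l] to the rest of [V], contrary to
   [minimal_bound]. *)
have grow l : l < 2 * n -> size (L l) < size (L l.+1).
  move=> ln; rewrite ltnNge; apply/negP => le.
  have eqL : L l.+1 =i L l.
    by move=> z; have [_ ->] := uniq_min_size (uL l) (mono l) le.
  have LV : all V (L l).
    by apply/allP => z; rewrite mem_filter => /andP[/andP[]].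
  have := minimal_bound nonam minV (uL l) LV; rewrite big_seq big1 ?muln0.
    rewrite leqn0 size_eq0 => /eqP L0; have : x0 \in L l; last by rewrite L0.
    by elim: l {ln le eqL LV L0} => // l IH; apply: mono.
  move=> x xL; rewrite big_seq big1 // => s sS; apply/eqP; rewrite eqb0.
  apply/negP => /andP[Vxs]; rewrite -eqL cover // /level_pred Vxs.
  move: xL; rewrite mem_filter => /andP[/andP[_ /allP xl] _].
  apply/allP => a /xl; rewrite -ltnS; apply: leq_trans.
  by apply: (@lev_lip _ _ genS D _ _ s^-1%g); rewrite ?gensV // mulgK.
have big l : l <= 2 * n -> l < size (L l).
  elim: l => [|l IH] ln; first by case: (L 0) V0.
  by apply: leq_ltn_trans (IH _) (grow _ _); lia.
have mult l : n <= l < 2 * n -> Q * size (L l) <= size (L l.+1).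
  move=> /andP[nl ln]; have r := rec l ln; have bl := big l (ltnW ln).
  rewrite mulnDr mulnCA -/c in r; move: (size (L l)) (size (L l.+1)) r bl => v v' r bl.
  have e0 : 0 < 2 ^ T by rewrite expn_gt0.
  have cv : 2 * c <= v by rewrite /n in nl; lia.
  have r2 : 2 ^ T * v <= 2 * (b * v').
    have : 2 ^ T * (2 * c) <= 2 ^ T * v by rewrite leq_mul2l cv orbT.
    by rewrite mulnCA; lia.
  have b0 : 0 < b.
    by case: (posnP b) => // b0; move: r2; rewrite b0 mul0n muln0; nia.
  have : b * (2 * Q) * v <= 2 * (b * v') by apply: leq_trans r2; rewrite leq_mul2r TQ orbT.
  have -> : b * (2 * Q) * v = 2 * (b * (Q * v)) by rewrite (mulnCA b 2 Q) !mulnA.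
  by rewrite (leq_pmul2l (isT : 0 < 2)) (leq_pmul2l b0).
have pow j : j <= n -> Q ^ j <= size (L (n + j)).
  elim: j => [|j IH] jn.
    by rewrite expn0 addn0; apply: leq_ltn_trans (big n _); lia.
  rewrite expnS addnS (leq_trans _ (mult _ _)) //; last by lia.
  by rewrite leq_mul2l IH ?orbT // ltnW.
have := pow n (leqnn _); rewrite leqNgt => /negP; apply.
rewrite addnn -mul2n (leq_ltn_trans (uniq_ball_size genS (x := 1%g) (n := R) (uL _) _)) //.
  by move=> z; rewrite mem_filter mem_ball // => /andP[].
rewrite (leq_ltn_trans (vol_exp genS _)) // -/m /Q expnMn -expnM.
have le : m ^ R <= m ^ ((2 * alpha + beta) * n).
  by case: (m) m_gt0 => // k _; case: k => [|k]; rewrite ?exp1n // leq_exp2l // /R /n; nia.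
apply: (leq_ltn_trans le); rewrite -{1}[m ^ _]mul1n ltn_mul2r expn_gt0 m_gt0 /=.
by rewrite -{1}(expn0 2) ltn_exp2l.
Qed.

End NoThin.

(** * Rays *)

(** A free ultrafilter replaces the extraction of subsequences: a sequence in a finite set is
    constant on exactly one large set of indices. *)
Record free_ultra (F : set (set nat)) : Prop := FreeUltra {
  ultraS : forall A B : set nat, (forall k, A k -> B k) -> F A -> F B;
  ultraI : forall A B : set nat, F A -> F B -> F (fun k => A k /\ B k);
  ultraVC : forall A : set nat, F A \/ F (fun k => ~ A k);
  ultra_ex : forall A : set nat, F A -> exists k, A k;
  ultra_ge : forall n, F (fun k => (n <= k)%N) }.

Lemma exists_free_ultra : exists F, free_ultra F.
Proof.
have [F [UF sF]] := @ultraFilterLemma nat \oo%classic _.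
exists F; split.
- by move=> A B AB FA; apply: filterS FA.
- by move=> A B; exact: filterI.
- by move=> A; exact: in_ultra_setVsetC.
- by move=> A /filter_ex.
- by move=> n; apply: sF; exists n.
Qed.

Section Ultra.
Variable F : set (set nat).
Hypothesis UF : free_ultra F.

Lemma ultraT (A : set nat) : (forall k, A k) -> F A.
Proof. by move=> AT; apply: (ultraS UF) (ultra_ge UF 0). Qed.

Lemma ultra_fin (T : eqType) (u : nat -> T) (s : seq T) :
  F (fun k => u k \in s) -> exists2 v, v \in s & F (fun k => u k = v).
Proof.
elim: s => [|v s IH] Fs; first by case: (ultra_ex UF Fs).
have [Fv|Fv] := ultraVC UF (fun k => u k = v); first by exists v; rewrite ?mem_head.
case: IH => [|z zs Fz]; last by exists z; rewrite // inE zs orbT.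
apply: (ultraS UF) (ultraI UF Fs Fv) => k [].
by rewrite inE => /orP[/eqP|].
Qed.

Lemma ultra_list (T : eqType) (P : T -> set nat) (s : seq T) :
  (forall x, x \in s -> F (P x)) -> F (fun k => forall x, x \in s -> P x k).
Proof.
elim: s => [|v s IH] Fs; first by apply: ultraT.
have /IH h : forall x, x \in s -> F (P x) by move=> x xs; apply: Fs; rewrite inE xs orbT.
apply: (ultraS UF) (ultraI UF h (Fs v (mem_head _ _))) => k [hk Pk] x.
by rewrite inE => /orP[/eqP->|/hk].
Qed.

End Ultra.

Section Rays.
Variables (G : groupType) (S : seq G).
Hypothesis genS : generates S.
Variable D : nat.
Hypothesis hypD : four_point S D.
Local Open Scope nat_scope.
Local Notation d := (word_dist S).
Local Notation len := (word_length S).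
Local Notation gp := (gp S).

Lemma ultra_limit F (UF : free_ultra F) (c : nat -> nat -> G) :
  (forall i, F (fun k => d 1%g (c k i) <= i)) ->
  exists cl : nat -> G, forall i, F (fun k => c k i = cl i).
Proof.
move=> ci.
have ex i : exists v, F (fun k => c k i = v).
  have [|v _ Fv] := ultra_fin UF (u := c^~ i) (s := ball S 1%g i); last by exists v.
  by apply: (ultraS UF) (ci i) => k; rewrite mem_ball.
by have [cl hcl] := choice ex; exists cl.
Qed.

Lemma one_ended_infinite : one_ended S -> forall n, exists g : G, len g = n.
Proof.
move=> oneS n; have [C [[_ infC] _]] := oneS set0 (finite_set0 _).
have [g gn] : exists g, n <= len g.
  apply: contrapT => no; apply: infC.
  apply: (@sub_finite_set _ _ [set` ball S 1%g n]); last exact: finite_seq.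
  move=> g _ /=; rewrite mem_ball // d1 leqNgt; apply/negP => ng.
  by apply: no; exists g; exact: ltnW.
have [c [c0 cg gc]] := geodesicP genS 1%g g; exists (c n).
by have := gc 0 n; rewrite c0 !d1 subn0; apply.
Qed.

(** Translate geodesics of length 2 k so that their midpoints lie at 1, and take an ultralimit. *)
Lemma geodesic_line : (forall n, exists g : G, len g = n) ->
  exists p q : nat -> G, [/\ p 0 = 1%g, q 0 = 1%g,
    forall i j, i <= j -> d (p i) (p j) = j - i,
    forall i j, i <= j -> d (q i) (q j) = j - i &
    forall i j, d (p i) (q j) = i + j].
Proof.
move=> inf; have [F UF] := exists_free_ultra.
have ex k : exists c : nat -> G, forall i j, i <= j -> j <= 2 * k -> d (c i) (c j) = j - i.
  have [g gk] := inf (2 * k); have [c [_ _ hc]] := geodesicP genS 1%g g.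
  by exists c; rewrite -gk -d1.
have [c hc] := choice ex.
pose P k i := ((c k k)^-1 * c k (k + i))%g; pose Q k i := ((c k k)^-1 * c k (k - i))%g.
have PP k i j : i <= j -> j <= k -> d (P k i) (P k j) = j - i.
  by move=> ij jk; rewrite d_left // hc; lia.
have QQ k i j : i <= j -> j <= k -> d (Q k i) (Q k j) = j - i.
  by move=> ij jk; rewrite d_left // (d_sym genS) hc; lia.
have PQ k i j : i <= k -> j <= k -> d (P k i) (Q k j) = i + j.
  by move=> ij jk; rewrite d_left // (d_sym genS) hc; lia.
have P0 k : P k 0 = 1%g by rewrite /P addn0 mulVg.
have Q0 k : Q k 0 = 1%g by rewrite /Q subn0 mulVg.
have [i|p hp] := @ultra_limit F UF P.
  apply: (ultraS UF) (ultra_ge UF i) => k ik.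
  by rewrite -(P0 k) PP // subn0.
have [i|q hq] := @ultra_limit F UF Q.
  apply: (ultraS UF) (ultra_ge UF i) => k ik.
  by rewrite -(Q0 k) QQ // subn0.
exists p, q; split.
- by have [k <-] := ultra_ex UF (hp 0).
- by have [k <-] := ultra_ex UF (hq 0).
- move=> i j ij;
  have [k [[<- <-] jk]] := ultra_ex UF (ultraI UF (ultraI UF (hp i) (hp j)) (ultra_ge UF j)).
  exact: PP.
- move=> i j ij;
  have [k [[<- <-] jk]] := ultra_ex UF (ultraI UF (ultraI UF (hq i) (hq j)) (ultra_ge UF j)).
  exact: QQ.
- move=> i j;
  have [k [[<- <-] jk]] := ultra_ex UF (ultraI UF (ultraI UF (hp i) (hq j)) (ultra_ge UF (i + j))).
  by apply: PQ; lia.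
Qed.

Lemma ray_len (c : ray S) i : len (c i) = i.
Proof. by rewrite -d1 -(ray_start c) (ray_geodesic c) ?subn0. Qed.

Lemma gp_ray (c : ray S) i j : gp 1%g (c i) (c j) = (minn i j).*2.
Proof.
have := gpE genS 1%g (c i) (c j); rewrite !d1 !ray_len.
case: (leqP i j) => ij; first by rewrite (ray_geodesic c) //; lia.
by rewrite (d_sym genS) (ray_geodesic c); lia.
Qed.

(** Translate a geodesic line to z. Its two halves have product 0 at z, so that one of them leads
    away from 1. Geodesics from 1 to points of this half pass near z, and the ray is an ultralimit
    of them. *)
Lemma outward_ray : (forall n, exists g : G, len g = n) -> forall z : G,
  exists c : ray S, forall i, len z <= i -> (len z).*2 <= gp 1%g z (c i) + 2 * D.
Proof.
move=> /geodesic_line[p [q [p0 q0 pp qq pq]]] z.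
have [r [rr0 rr rz]] : exists r : nat -> G, [/\ r 0 = 1%g,
    forall i j, i <= j -> d (r i) (r j) = j - i &
    forall t, gp z 1%g (z * r t)%g <= D].
  have mono (r : nat -> G) : r 0 = 1%g -> (forall i j, i <= j -> d (r i) (r j) = j - i) ->
      forall i j, i <= j -> gp z 1%g (z * r i)%g <= gp z 1%g (z * r j)%g.
    move=> r0 rr i j ij; have := gpE genS z 1%g (z * r i)%g; have := gpE genS z 1%g (z * r j)%g.
    have zr k : d z (z * r k)%g = k by rewrite -{1}(mulg1 z) d_left // -r0 rr // subn0.
    rewrite !zr; have := d_tri genS (z * r i)%g 1%g (z * r j)%g.
    by rewrite d_left // rr //; lia.
  have pq0 i j : minn (gp z 1%g (z * p i)%g) (gp z 1%g (z * q j)%g) <= D.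
    have := gp_tri hypD z (z * p i)%g 1%g (z * q j)%g; rewrite (gpC genS z _ 1%g).
    have -> : gp z (z * p i)%g (z * q j)%g = 0; last by [].
    rewrite -{1}(mulg1 z) gp_left // /gp pq -{1}p0 -{1}q0 pp // qq //; lia.
  case: (pselect (exists t0, D < gp z 1%g (z * p t0)%g)) => [[t0 ht0]|no].
    exists q; split=> // t; have := pq0 t0 t; lia.
  exists p; split=> // t; rewrite leqNgt; apply/negP => ht; apply: no.
  by exists t.
have [F UF] := exists_free_ultra.
have [g hg] := choice (fun t => geodesicP genS 1%g (z * r t)%g).
have zrt t : t <= d 1%g (z * r t)%g + len z.
  have := d_tri genS 1%g z (z * r t)%g; rewrite -{1}(mulg1 z) d_left //.
  by rewrite -rr0 rr // subn0 rr0 (d_sym genS z) d1; lia.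
have [i|c hc] := @ultra_limit F UF g.
  apply: (ultraS UF) (ultra_ge UF (i + len z)) => t it.
  have [g0 _ gg] := hg t; rewrite -g0 gg //; last by have := zrt t; lia.
  by rewrite subn0.
have cg i j : i <= j -> d (c i) (c j) = j - i.
  move=> ij; have [t [[<- <-] jk]] :=
    ultra_ex UF (ultraI UF (ultraI UF (hc i) (hc j)) (ultra_ge UF (j + len z))).
  by have [_ _ gg] := hg t; rewrite gg //; have := zrt t; lia.
have c0 : c 0 = 1%g by have [t <-] := ultra_ex UF (hc 0); case: (hg t).
exists (Ray c0 cg) => i zi /=.
have [t [<- it]] := ultra_ex UF (ultraI UF (hc i) (ultra_ge UF (i + len z))).
have [g0 ge gg] := hg t; have il : i <= d 1%g (z * r t)%g by have := zrt t; lia.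
have l1 : len (g t i) = i by rewrite -d1 -g0 gg // subn0.
have l2 : d (g t i) (z * r t)%g = d 1%g (z * r t)%g - i by rewrite -{1}ge gg.
have := gp_tri hypD 1%g z (z * r t)%g (g t i).
have := gpE genS 1%g (z * r t)%g (g t i); rewrite (d_sym genS _ (g t i)) l2 !d1 l1.
have := rz t; have := gp_swap genS 1%g z (z * r t)%g; rewrite !d1 in il *.
by lia.
Qed.

(** For s large, the points c t, c s, c' s, c' t have consecutive products at least 2 t at 1; two
    uses of the four-point condition lose 2 D. *)
Lemma asymptotic_close (c c' : ray S) :
  (forall B, exists s, B < gp 1%g (c s) (c' s)) -> forall t, d (c t) (c' t) <= 2 * D.
Proof.
move=> unb t; have [s hs] := unb t.*2.
have := gp_le genS 1%g (c s) (c' s); rewrite d1 ray_len => st.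
have := gp_tri hypD 1%g (c t) (c s) (c' t); have := gp_tri hypD 1%g (c s) (c' s) (c' t).
rewrite !gp_ray; have := gpE genS 1%g (c t) (c' t); rewrite !d1 !ray_len.
by lia.
Qed.

Lemma asymptotic_dist (c c' : ray S) : asymptotic c c' ->
  forall t, d (c t) (c' t) <= 2 * D.
Proof.
move=> [B hB]; apply: asymptotic_close => B'; exists (B + B').+1.
by have := gpE genS 1%g (c (B + B').+1) (c' (B + B').+1); rewrite !d1 !ray_len;
  have := hB (B + B').+1; lia.
Qed.

Lemma not_asymptotic (c c' : ray S) : ~ asymptotic c c' ->
  exists B, forall s t, gp 1%g (c s) (c' t) <= B.
Proof.
move=> nas; case: (pselect (exists B, forall s, gp 1%g (c s) (c' s) <= B)) => [[B hB]|no].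
  exists (B + D) => s t; have := hB (minn s t).
  have := gp_ray c (minn s t) s; have := gp_ray c' (minn s t) t.
  have := gp_le genS 1%g (c s) (c' t); have := gp_le' genS 1%g (c s) (c' t).
  rewrite !d1 !ray_len; case: (leqP s t) => st.
    rewrite minnn (minn_idPl st) => h1 h2 h3 h4 h5.
    have := gp_tri hypD 1%g (c s) (c' t) (c' s); rewrite (gpC genS _ (c' t)); lia.
  rewrite minnn (minn_idPl (ltnW st)) => h1 h2 h3 h4 h5.
  by have := gp_tri hypD 1%g (c t) (c s) (c' t); lia.
case: nas; exists (2 * D); apply: asymptotic_close => B.
apply: contrapT => no'; apply: no; exists B => s; rewrite leqNgt; apply/negP => h.
by apply: no'; exists s.
Qed.

Lemma asymptotic_refl (c : ray S) : asymptotic c c.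
Proof. by exists 0 => t; rewrite dxx. Qed.

Lemma asymptotic_sym (c c' : ray S) : asymptotic c c' -> asymptotic c' c.
Proof. by move=> [B hB]; exists B => t; rewrite d_sym. Qed.

Lemma asymptotic_trans (c c' c'' : ray S) :
  asymptotic c c' -> asymptotic c' c'' -> asymptotic c c''.
Proof.
move=> [B hB] [B' hB']; exists (B + B') => t.
by have := d_tri genS (c' t) (c t) (c'' t); have := hB t; have := hB' t; lia.
Qed.

Lemma endpoint_eq (c c' : ray S) : endpoint c = endpoint c' <-> asymptotic c c'.
Proof.
split=> [|cc'].
  move/(congr1 (fun x : boundary S => bd_rays x c')) => /= h.
  by rewrite -[asymptotic _ _]/(ray_class c c') h; exact: asymptotic_refl.
have e : ray_class c = ray_class c'.
  apply/seteqP; split=> r; rewrite /ray_class /=.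
    by apply: asymptotic_trans; exact: asymptotic_sym.
  exact: asymptotic_trans.
rewrite /endpoint; move: (ex_intro _ _ _) (ex_intro _ _ _); rewrite e => p1 p2.
by congr BoundaryPoint; exact: Prop_irrelevance.
Qed.

Lemma endpoint_surj (xi : boundary S) : exists c, xi = endpoint c.
Proof.
case: xi => X [c cE]; exists c; subst X.
by rewrite /endpoint; congr BoundaryPoint; exact: Prop_irrelevance.
Qed.

Lemma cayley_adjE x y : cayley_adj S x y = ((x^-1 * y)%g \in gens S).
Proof. by rewrite mem_gens invMg invgK. Qed.

Lemma d_eq1 (x y : G) : d x y = 1 -> (x^-1 * y)%g \in gens S.
Proof.
move=> /(d_step genS)[t tS /(d_eq0 genS)->].
by rewrite invMg mulgVK gensV.
Qed.

Lemma path_crossing (T : eqType) (e : rel T) (P : pred T) x s :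
  path e x s -> P x -> ~~ P (last x s) ->
  exists z z', [/\ z' \in s, e z z', P z & ~~ P z'].
Proof.
elim: s x => [|y s IH] x /=; first by move=> _ ->.
case/andP=> exy ps Px nP; case Py: (P y).
  have [z [z' [zs ? ? ?]]] := IH y ps Py nP.
  by exists z, z'; rewrite inE zs orbT.
by exists x, y; rewrite mem_head Px Py.
Qed.

(** Both halves of a geodesic line enter the unique infinite component outside a ball. Along a path
    joining them there, the product with the first half falls to 0 in steps of at most 2. Where it
    reaches [D + 2] it still exceeds D, so that the product with the other half is at most D: this
    point is the third arm. *)
Lemma tripod_one_ended : one_ended S -> forall L, exists rho,
  tripod S predT 1%g (D + 2) L rho.
Proof.
move=> oneS L0; pose L := L0 + D + 2.
have [p [q [p0 q0 pp qq pq]]] := geodesic_line (one_ended_infinite oneS).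
have lp i : len (p i) = i by rewrite -d1 -p0 pp // subn0.
have lq i : len (q i) = i by rewrite -d1 -q0 qq // subn0.
pose K : set G := (fun g : G => len g <= L).
have finK : finite_set K.
  apply: (@sub_finite_set _ _ [set` ball S 1%g L]%classic); last exact: finite_seq.
  by move=> g /=; rewrite mem_ball // d1.
have [C [_ Cuniq]] := oneS K finK.
have comp (r : nat -> G) : (forall i, len (r i) = i) ->
    (forall i j, i <= j -> d (r i) (r j) = j - i) -> C = component_avoiding S K (r L.+1).
  move=> lr rr; apply: Cuniq; split.
    by exists (r L.+1) => //; rewrite /K /= lr ltnn.
  have sub i : component_avoiding S K (r L.+1) (r (L.+1 + i)).
    elim: i => [|i [s [ps ls hs]]].
      exists [::]; rewrite addn0; split=> // z; rewrite inE => /eqP->.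
      by rewrite /K /= lr ltnn.
    exists (rcons s (r (L.+1 + i.+1))); rewrite rcons_path last_rcons ps ls cayley_adjE /=.
    split=> //; first by apply: d_eq1; rewrite rr; lia.
    move=> z; rewrite -rcons_cons mem_rcons inE => /orP[/eqP->|/hs//].
    by rewrite /K /= lr; lia.
  case/finite_seqP => s sE.
  have bnd g : g \in s -> len g <= \max_(g <- s) len g by move=> gs; apply: leq_bigmax_seq.
  move: (\max_(g <- s) len g) bnd => m bnd.
  by have := sub m; rewrite sE /= => /bnd; rewrite lr; lia.
have [s [ps ls hs]] : component_avoiding S K (p L.+1) (q L.+1).
  rewrite -(comp p) // (comp q) //; exists [::]; split=> // z.
  by rewrite inE => /eqP->; rewrite /K /= lq ltnn.
have gpq : gp 1%g (q L.+1) (p L.+1) = 0.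
  by have := gpE genS 1%g (q L.+1) (p L.+1); rewrite (d_sym genS) pq !d1 lp lq; lia.
have [||z [z' [z's zz' Pz Pz']]] := @path_crossing _ _ (fun z => D + 2 < gp 1%g z (p L.+1)) _ _ ps.
- by rewrite gpxx // d1 lp /L; lia.
- by rewrite ls gpq.
have z'L : L < len z'.
  by rewrite ltnNge; apply/negP => le; apply: (hs z') => //; rewrite inE z's orbT.
have dzz : d z' z <= 1.
  by move: zz'; rewrite cayley_adjE => /(len_gens); rewrite (d_sym genS); apply.
have h1 := gp_lip genS 1%g (p L.+1) z z'; rewrite !(gpC genS 1%g (p L.+1)) (d_sym genS z) in h1.
have h2 := gp_tri hypD 1%g (p L.+1) z' (q L.+1).
rewrite (gpC genS 1%g (p L.+1) (q L.+1)) gpq (gpC genS 1%g (p L.+1)) in h2.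
exists (L + len z').+1,
  (fun i => if i == 0 :> nat then p L.+1 else if i == 1 :> nat then q L.+1 else z').
have gpq' : gp 1%g (p L.+1) (q L.+1) = 0 by rewrite gpC.
have a1 : gp 1%g z' (p L.+1) <= D + 2 by rewrite leqNgt.
have a2 : gp 1%g z' (q L.+1) <= D + 2 by lia.
have a1' : gp 1%g (p L.+1) z' <= D + 2 by rewrite gpC.
have a2' : gp 1%g (q L.+1) z' <= D + 2 by rewrite gpC.
split=> [[[|[|[|//]]] i]|[[|[|[|//]]] i] [[|[|[|//]]] j]] //=; rewrite ?gpq ?gpq' ?d1 ?lp ?lq;
  split=> //; rewrite /L in z'L *; lia.
Qed.

End Rays.

(** * Branching of minimal cuts *)

Section Branch.
Variables (G : groupType) (S : seq G).
Hypothesis genS : generates S.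
Variable D : nat.
Hypothesis hypD : four_point S D.
Hypothesis rigidS : geometrically_rigid S.
Local Open Scope nat_scope.
Local Notation d := (word_dist S).
Local Notation len := (word_length S).
Local Notation gp := (gp S).

Definition bdry (U : pred G) : pred G :=
  fun x => U x && has (fun s => ~~ U (x * s)%g) (gens S).

Lemma bdry_crossing (U : pred G) (x y : G) : U x != U y ->
  exists z, [/\ bdry U z, d x z <= d x y & d y z <= d x y].
Proof.
wlog Ux : x y / U x.
  move=> wl; case Ux: (U x); first by move=> h; apply: wl => //; rewrite Ux.
  case Uy: (U y) => // _; have [|z [zU z1 z2]] := wl y x Uy; first by rewrite Ux Uy.
  by exists z; rewrite (d_sym genS x y).
rewrite Ux; case Uy: (U y) => // _.
have [|z [s [sS Uz Uzs e _]]] := @crossing _ _ genS U x y Ux; first by rewrite Uy.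
exists z; rewrite (d_sym genS y) /bdry Uz; split; [|lia|lia].
by apply/hasP; exists s.
Qed.

Lemma bdryC (U : pred G) (x : G) : bdry U x -> exists2 s, s \in gens S & bdry (predC U) (x * s)%g.
Proof.
case/andP=> Ux /hasP[s sS Uxs]; exists s => //; rewrite /bdry /= Uxs.
by apply/hasP; exists s^-1%g; rewrite ?gensV // mulgK /= negbK.
Qed.

Section Cut.
Variable U : pred G.

(* The constant 4 D + 4 makes limit_ray a condition on the endpoint of c:     *)
(* dull rays (the negation) see no boundary of U nearby, also after replacing *)
(* c by an asymptotic ray.                                                    *)
Definition limit_ray (c : ray S) := forall n, exists2 y, bdry U y &
  2 * n <= gp 1%g y (c n) + (4 * D + 4).

Definition dull n (c : ray S) := forall y, bdry U y ->
  gp 1%g y (c n) + (4 * D + 4) < 2 * n.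

Lemma not_limitP (c : ray S) : ~ limit_ray c -> exists n, dull n c.
Proof.
move=> /existsNP[n hn]; exists n => y yU; rewrite ltnNge; apply/negP => h.
by apply: hn; exists y.
Qed.

Lemma dull_near n (c : ray S) t y : dull n c -> n <= t -> d (c t) y <= 2 * D + 2 ->
  ~~ bdry U y.
Proof.
move=> dc nt yt; apply/negP => /dc; have := gp_lip genS 1%g (c n) (c t) y.
by rewrite gp_ray // (minn_idPl nt) (gpC genS _ y); lia.
Qed.

Lemma dull_const n (c : ray S) t : dull n c -> n <= t -> U (c t) = U (c n).
Proof.
move=> dc; elim: t => [|t IH]; first by rewrite leqn0 => /eqP->.
rewrite leq_eqVlt => /predU1P[->//|]; rewrite ltnS => nt; rewrite -IH //.
apply/eqP; apply/negPn/negP => ne; have [z [zU _ z1]] := bdry_crossing ne.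
move: zU; apply/negP; apply: (dull_near dc nt).
have := ray_geodesic c (leqnSn t); rewrite subSnn => e.
have := d_tri genS (c t.+1) (c t) z; rewrite (d_sym genS (c t.+1) (c t)) in z1 *.
by lia.
Qed.

Lemma dull_asymptotic n (c c' : ray S) t : dull n c -> asymptotic c c' -> n <= t ->
  U (c' t) = U (c n).
Proof.
move=> dc cc' nt; rewrite -(dull_const dc nt); apply/eqP/negPn/negP => ne.
have [z [zU _ z1]] := bdry_crossing ne; have := asymptotic_dist genS hypD cc' t => e.
move: zU; apply/negP; apply: (dull_near dc nt).
by rewrite (d_sym genS (c' t)) in z1; lia.
Qed.

Variable K0 : nat.
Hypothesis noT : forall K rho, K0 <= K -> ~ tripod S (bdry U) 1%g K (10 * K) rho.

(** Boundary points far out along three pairwise non-asymptotic limit rays would form a tripod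
    excluded by [noT]. *)
Lemma two_limit_rays (c1 c2 c3 : ray S) :
  limit_ray c1 -> limit_ray c2 -> limit_ray c3 ->
  [\/ asymptotic c1 c2, asymptotic c1 c3 | asymptotic c2 c3].
Proof.
move=> l1 l2 l3; apply: contrapT => no.
have n12 : ~ asymptotic c1 c2 by move=> h; apply: no; constructor 1.
have n13 : ~ asymptotic c1 c3 by move=> h; apply: no; constructor 2.
have n23 : ~ asymptotic c2 c3 by move=> h; apply: no; constructor 3.
have [B1 h12] := not_asymptotic genS hypD n12.
have [B2 h13] := not_asymptotic genS hypD n13.
have [B3 h23] := not_asymptotic genS hypD n23.
pose K := K0 + B1 + B2 + B3 + 2 * D; pose n := 10 * K + (4 * D + 4).
have [y1 b1 g1] := l1 n; have [y2 b2 g2] := l2 n; have [y3 b3 g3] := l3 n.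
have big (c : ray S) y : 2 * n <= gp 1%g y (c n) + (4 * D + 4) -> 10 * K <= len y.
  by have := gp_le genS 1%g y (c n); rewrite d1 /n; lia.
have far (c c' : ray S) y y' B : B + 2 * D <= K -> (forall s t, gp 1%g (c s) (c' t) <= B) ->
    2 * n <= gp 1%g y (c n) + (4 * D + 4) -> 2 * n <= gp 1%g y' (c' n) + (4 * D + 4) ->
    gp 1%g y y' <= K.
  move=> BK hB hy hy'; have := gp_tri hypD 1%g (c n) y y'.
  have := gp_tri hypD 1%g (c n) y' (c' n); rewrite (gpC genS 1%g (c n) y).
  by have := hB n n; rewrite /n in hy hy' *; lia.
have f12 : gp 1%g y1 y2 <= K by apply: (far c1 c2 _ _ B1) => //; rewrite /K; lia.
have f13 : gp 1%g y1 y3 <= K by apply: (far c1 c3 _ _ B2) => //; rewrite /K; lia.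
have f23 : gp 1%g y2 y3 <= K by apply: (far c2 c3 _ _ B3) => //; rewrite /K; lia.
apply: (@noT K (len y1 + len y2 + len y3)); first by rewrite /K; lia.
exists (fun i : 'I_3 => if i == 0 :> nat then y1 else if i == 1 :> nat then y2 else y3).
have [L1 L2 L3] := And3 (big _ _ g1) (big _ _ g2) (big _ _ g3).
split=> [[[|[|[|//]]] i]|[[|[|[|//]]] i] [[|[|[|//]]] j]] //=;
  rewrite ?d1 ?(gpC genS 1%g y2 y1) ?(gpC genS 1%g y3) //; split=> //; lia.
Qed.

(** If there are fewer than two limit rays up to asymptoty, the pair is completed by halves of a
    geodesic line. *)
Lemma limit_pair : exists a b : ray S, ~ asymptotic a b /\
  forall c, limit_ray c -> asymptotic c a \/ asymptotic c b.
Proof.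
have [oneS _] := rigidS.
have [p [q [p0 q0 pp qq pq]]] := geodesic_line genS (one_ended_infinite genS oneS).
pose rp := Ray p0 pp; pose rq := Ray q0 qq.
have npq : ~ asymptotic rp rq.
  by move=> /(asymptotic_dist genS hypD) /(_ (2 * D).+1); rewrite /= pq; lia.
case: (pselect (exists c1 c2, [/\ limit_ray c1, limit_ray c2 & ~ asymptotic c1 c2])).
  move=> [c1 [c2 [l1 l2 n12]]]; exists c1, c2; split=> // c lc.
  by case: (two_limit_rays l1 l2 lc) => // h; [left|right]; apply: asymptotic_sym.
move=> no; case: (pselect (exists c1, limit_ray c1)) => [[c1 l1]|no1]; last first.
  by exists rp, rq; split=> // c lc; case: no1; exists c.
have all1 c : limit_ray c -> asymptotic c c1.
  by move=> lc; apply: contrapT => nc; apply: no; exists c, c1.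
case: (pselect (asymptotic c1 rp)) => h1.
  exists c1, rq; split=> [h2|c lc]; last by left; apply: all1.
  by apply: npq; apply: asymptotic_trans h2 => //; apply: asymptotic_sym.
by exists c1, rp; split=> // c lc; left; apply: all1.
Qed.

(* By noT, the boundary of U has at most two limit points a and b at          *)
(* infinity.  The other points at infinity are split into two open sets, the  *)
(* ends of U and those of its complement; as {a, b} is not a cut pair, one of *)
(* them is empty.                                                             *)
Lemma thin_side : exists (a b : ray S) (V : pred G), (V = U \/ V = predC U) /\
  forall c, ~ asymptotic c a -> ~ asymptotic c b -> exists n, forall t, n <= t -> ~~ V (c t).
Proof.
have [a [b [nab lab]]] := limit_pair; exists a, b.
have conn : connected (~` [set endpoint a; endpoint b])%classic.
  apply: contrapT => nc; have [_ []] := rigidS; exists (endpoint a), (endpoint b).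
  by split=> // /(endpoint_eq genS).
pose avoid (c : ray S) := ~ asymptotic c a /\ ~ asymptotic c b.
pose B (V : pred G) : set (boundary S) := fun xi => exists c,
  [/\ xi = endpoint c, avoid c & exists n, forall t, n <= t -> V (c t)].
have side (c : ray S) : avoid c -> exists n, dull n c.
  by move=> [na nb]; apply: not_limitP => /lab[].
have avoid_asym (c c' : ray S) : avoid c -> asymptotic c c' -> avoid c'.
  by move=> [na nb] cc'; split=> h; [apply: na|apply: nb]; apply: asymptotic_trans h.
have openB (V : pred G) : (V = U \/ V = predC U) -> open (B V).
  move=> VU; suff: boundary_open (B V) by [].
  move=> c [c0 [/(endpoint_eq genS) cc0 av0 [n0 hn0]]].
  have av : avoid c by apply: avoid_asym av0 _; apply: asymptotic_sym.
  have [n1 d1c] := side c av; have [na nb] := av.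
  have [Ba hBa] := not_asymptotic genS hypD na; have [Bb hBb] := not_asymptotic genS hypD nb.
  have Vconst t : n1 <= t -> V (c t) = V (c n1).
    by move=> nt; case: VU => ->; rewrite /= (dull_const d1c nt).
  have Vc : V (c n1).
    pose t := maxn n0 n1; have /hn0 : n0 <= t by rewrite leq_maxl.
    have e : U (c0 t) = U (c n1) by apply: dull_asymptotic d1c cc0 _; rewrite leq_maxr.
    by case: VU => -> /=; rewrite e.
  pose n := n1 + Ba + Bb + 2 * D + 1.
  exists n => c' hc'; exists c'.
  have nasym (r : ray S) Br : (forall s t, gp 1%g (c s) (r t) <= Br) -> Br + 2 * D < n ->
    ~ asymptotic c' r.
    move=> hr Brn as'; have := gpE genS 1%g (c' n) (r n); rewrite !d1 !ray_len //.
    by have := asymptotic_dist genS hypD as' n; have := hr n n; rewrite -hc' //; lia.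
  have d1c' : dull n1 c' by move=> y /d1c; rewrite hc' // /n; lia.
  split=> //.
    by split; [apply: (nasym _ Ba)|apply: (nasym _ Bb)] => //; rewrite /n; lia.
  exists n1 => t nt; have := dull_const d1c' nt; rewrite (hc' n1); last by rewrite /n; lia.
  by case: VU Vc => -> /= ? ->.
have disj xi : B U xi -> ~ B (predC U) xi.
  move=> [c [-> av [n hn]]] [c' [/(endpoint_eq genS) cc' _ [n' hn']]].
  have [m dm] := side c av; pose t := n + n' + m.
  have h1 : U (c t) by apply: hn; rewrite /t; lia.
  have h2 : ~~ U (c' t) by apply: hn'; rewrite /t; lia.
  rewrite (dull_asymptotic dm cc') in h2; last by rewrite /t; lia.
  by rewrite (dull_const dm) in h1; [rewrite h1 in h2|rewrite /t; lia].
have cover c : avoid c -> B U (endpoint c) \/ B (predC U) (endpoint c).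
  move=> av; have [n dn] := side c av; case Uc: (U (c n)); [left|right].
    by exists c; split=> //; exists n => t nt; rewrite (dull_const dn).
  by exists c; split=> //; exists n => t nt /=; rewrite (dull_const dn) // Uc.
have subA V xi : B V xi -> (~` [set endpoint a; endpoint b])%classic xi.
  by move=> [c [-> [na nb] _]] [] /(endpoint_eq genS).
case: (pselect (B U !=set0)%classic) => [ne|em]; last first.
  exists U; split; first by left.
  move=> c na nb; have [|Bc|Bc] := cover c; first by split.
    by case: em; exists (endpoint c).
  have [c' [/(endpoint_eq genS) cc' av' [n hn]]] := Bc.
  have [m dm] := side c (conj na nb).
  exists m => t mt; rewrite (dull_const dm) //.
  by rewrite -(dull_asymptotic dm cc' (t := n + m)) ?hn ?leq_addl ?leq_addr //;
    exact: (hn _ (leq_addr _ _)).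
exists (predC U); split; first by right.
have BA : B U = (~` [set endpoint a; endpoint b])%classic.
  apply: conn => //.
    exists (B U); first by apply: openB; left.
    by apply/seteqP; split=> xi; [move=> h; split=> //; exact: subA h|case].
  exists (~` B (predC U))%classic; first by apply: open_closedC; apply: openB; right.
  apply/seteqP; split=> xi.
    by move=> h; split; [exact: subA h|exact: disj].
  have [c ->] := endpoint_surj xi => -[nab' nB].
  have [|//|//] := cover c; split=> h; apply: nab'; [left|right]; exact/(endpoint_eq genS).
move=> c na nb.
have [c' [/(endpoint_eq genS) cc' av' [n hn]]] : B U (endpoint c).
  by rewrite BA => -[] /(endpoint_eq genS).
have [m dm] := side c (conj na nb).
exists m => t mt; rewrite /= negbK (dull_const dm) //.
by rewrite -(dull_asymptotic dm cc' (t := n + m)) ?leq_addl //; exact: (hn _ (leq_addr _ _)).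
Qed.

(** Two far boundary points in different directions account for all the others, as a third direction
    would give a tripod. *)
Lemma two_cones K : K0 <= K -> exists a b : G, forall y, bdry U y ->
  10 * K <= len y -> K < gp 1%g y a \/ K < gp 1%g y b.
Proof.
move=> KK; case: (pselect (exists2 a, bdry U a & 10 * K <= len a)); last first.
  by move=> no; exists 1%g, 1%g => y yU yK; case: no; exists y.
move=> [a aU aK].
case: (pselect (exists b, [/\ bdry U b, 10 * K <= len b & gp 1%g b a <= K])); last first.
  move=> no; exists a, a => y yU yK; left; rewrite ltnNge; apply/negP => h.
  by apply: no; exists y.
move=> [b [bU bK ba]]; exists a, b => y yU yK.
apply: contrapT => /not_orP[/negP]; rewrite -leqNgt => ya /negP; rewrite -leqNgt => yb.
apply: (@noT K (len y + len a + len b)) => //.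
exists (fun i : 'I_3 => if i == 0 :> nat then y else if i == 1 :> nat then a else b).
split=> [[[|[|[|//]]] i]|[[|[|[|//]]] i] [[|[|[|//]]] j]] //=;
  rewrite ?d1 ?(gpC genS 1%g a) ?(gpC genS 1%g b y) //; split=> //; lia.
Qed.

(** Take a ray from 1 passing near z. If it tends to one of the two points of [thin_side], then z is
    in a cone around that point. Otherwise the ray ends up outside V, so that the boundary of U is
    met near z or beyond it, and z is in one of the cones of [two_cones]. *)
Lemma thin_cones : exists V : pred G, (V = U \/ V = predC U) /\
  forall K, K0 <= K -> exists cs : seq G, size cs <= 4 /\ forall z, V z ->
    10 * K + 7 * D + 1 <= len z -> exists2 c, c \in cs & K <= gp 1%g z c + D.
Proof.
have [a [b [V [VU hV]]]] := thin_side; exists V; split=> // K KK.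
have [a' [b' hab]] := two_cones KK; pose N := 10 * K + 7 * D.
exists [:: a'; b'; a N; b N]; split=> // z Vz zK.
have [oneS _] := rigidS.
have [c hc] := outward_ray genS hypD (one_ended_infinite genS oneS) z.
have asym (r : ray S) : asymptotic c r -> K <= gp 1%g z (r N) + D.
  move=> cr; have := hc (len z + N) (leq_addr _ _).
  have := asymptotic_dist genS hypD cr N; have := gp_lip genS 1%g z (c N) (r N).
  have := gp_tri hypD 1%g z (c (len z + N)) (c N).
  rewrite gp_ray // (minn_idPr (leq_addl _ _)) -/N in zK *.
  by rewrite /N in zK *; lia.
case: (pselect (asymptotic c a)) => [ca|nca].
  by exists (a N); [rewrite !inE eqxx !orbT|exact: asym].
case: (pselect (asymptotic c b)) => [cb|ncb].
  by exists (b N); [rewrite !inE eqxx !orbT|exact: asym].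
have [n hn] := hV c nca ncb.
have zc := hc _ (leqnn (len z)).
have [y [yU yz]] : exists y, bdry U y /\ (len z).*2 <= gp 1%g z y + 4 * D + 2.
  have UV (x y : G) : V x != V y -> U x != U y.
    by case: VU => -> //=; case: (U x); case: (U y).
  case Vc: (V (c (len z))); last first.
    have [|y [yU zy _]] := @bdry_crossing U z (c (len z)); first by apply: UV; rewrite Vz Vc.
    exists y; split=> //; have := gp_lip genS 1%g z z y; rewrite gpxx // d1.
    have := gpE genS 1%g z (c (len z)); rewrite !d1 ray_len //.
    by lia.
  have [t [zt Vt Vt1]] : exists t, [/\ len z <= t, V (c t) & ~~ V (c t.+1)].
    apply: contrapT => no; have Vall t : V (c (len z + t)).
      elim: t => [|t IH]; first by rewrite addn0.
      apply: contrapT => /negP nVt; apply: no; exists (len z + t).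
      by rewrite -addnS leq_addr.
    by have := hn (len z + n) (leq_addl _ _); rewrite Vall.
  have [|y [yU ty _]] := @bdry_crossing U (c t) (c t.+1); first by apply: UV;
    rewrite Vt (negPf Vt1).
  exists y; split=> //; rewrite (ray_geodesic c) ?leqnSn // subSnn in ty.
  by have := hc t zt; have := gp_lip genS 1%g z (c t) y; lia.
have yl : 10 * K <= len y by have := gp_le' genS 1%g z y; rewrite d1; lia.
have := gp_tri hypD 1%g z y; case: (hab y yU yl) => h /(_ a') ha.
  by exists a'; [rewrite !inE eqxx|have := ha; lia].
by exists b'; [rewrite !inE eqxx !orbT|have := gp_tri hypD 1%g z y b'; lia].
Qed.

End Cut.

Variable h : nat.
Hypothesis nonam : forall A : seq G, uniq A ->
  size A <= h * \sum_(x <- A) \sum_(s <- gens S) (x * s \notin A)%g.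

Lemma minimal_cut_tripod (U : pred G) K0 : removal_minimal S U ->
  removal_minimal S (predC U) -> bdry U 1%g ->
  exists K rho, K0 <= K /\ tripod S (bdry U) 1%g K (10 * K) rho.
Proof.
move=> minU minC bU; apply: contrapT => no.
have noT K rho : K0 <= K -> ~ tripod S (bdry U) 1%g K (10 * K) rho.
  by move=> KK tr; apply: no; exists K, rho.
have [V [VU hV]] := thin_cones noT.
pose alpha := 10 * step D; pose beta := 10 * (step D + D + K0) + 7 * D + 1.
have [lmax hl] := no_thin_minimal_cut genS hypD nonam alpha beta.
(* A cone at scale K forces a level above lmax, and the radius [10 * K + 7 * D + 1] of [thin_cones]
   equals [alpha * lmax + beta]. *)
pose K := lmax.+1 * step D + D + K0.
have [|cs [cs4 hcs]] := hV K; first by rewrite /K; lia.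
have [x0 [Vx0 lx0]] : exists x0, V x0 /\ len x0 <= 1.
  case: VU => ->; first by exists 1%g; rewrite len1 //; case/andP: bU.
  have [s sS] := bdryC bU; rewrite mul1g => /andP[Us _]; exists s.
  by split=> //; apply: len_gens.
apply: (hl V cs x0) => //; first by case: VU => ->.
  move=> a ac; rewrite /lev divn_small // (leq_ltn_trans (gp_le genS _ _ _)) // d1.
  by rewrite /step; lia.
move=> z Vz lz; rewrite leqNgt; apply/negP => hz.
have [|c cc kc] := hcs z Vz; first by rewrite /alpha /beta /K mulSn in hz *; lia.
have := lz c cc; rewrite leqNgt => /negP; apply.
by rewrite lev_ge; rewrite /K in kc; lia.
Qed.

End Branch.

(** * Exponential growth of locally minimal cuts *)

Section LocalGrowth.
Variables (G : groupType) (S : seq G).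
Hypothesis genS : generates S.
Variable D : nat.
Hypothesis hypD : four_point S D.
Hypothesis rigidS : geometrically_rigid S.
Local Open Scope nat_scope.
Local Notation d := (word_dist S).
Local Notation len := (word_length S).
Local Notation gp := (gp S).
Local Notation bdry := (bdry S).

Definition locally_minimal (U : pred G) (x : G) (R : nat) := forall A : seq G,
  uniq A -> (forall z, z \in A -> U z /\ d x z <= R) ->
  \sum_(z <- A) \sum_(s <- gens S) ~~ U (z * s)%g <=
  \sum_(z <- A) \sum_(s <- gens S) (U (z * s)%g && (z * s \notin A)%g).

Lemma locally_minimal_sub U x y R R' : d x y + R' <= R ->
  locally_minimal U x R -> locally_minimal U y R'.
Proof.
move=> yR mU A uA hA; apply: mU => // z /hA[Uz yz]; split=> //.
by have := d_tri genS y x z; lia.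
Qed.

Lemma eq_locally_minimal U V x R : U =1 V -> locally_minimal U x R -> locally_minimal V x R.
Proof.
move=> UV mU A uA hA; have := mU A uA; under eq_bigr do under eq_bigr do rewrite UV.
under [X in _ <= X]eq_bigr do under eq_bigr do rewrite UV.
by apply=> z /hA; rewrite UV.
Qed.

Lemma locally_minimal_left (g : G) U x R : locally_minimal U (g * x)%g R ->
  locally_minimal (fun z => U (g * z)%g) x R.
Proof.
move=> mU A uA hA; have := mU [seq (g * z)%g | z <- A].
rewrite !big_map map_inj_uniq; last exact: mulgI.
move=> /(_ uA) h; have {h} := h _; under eq_bigr do under eq_bigr do rewrite -mulgA.
under [X in _ <= X]eq_bigr do under eq_bigr do
  rewrite -mulgA (mem_map (mulgI g)).
by apply=> z /mapP[y /hA[Uy xy] ->]; rewrite d_left.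
Qed.

Lemma bdry_left (g : G) U x : bdry (fun z => U (g * z)%g) x = bdry U (g * x)%g.
Proof. by congr (_ && _); apply: eq_has => s; rewrite mulgA. Qed.

Lemma tripod_weaken A x K L rho rho' : rho <= rho' ->
  tripod S A x K L rho -> tripod S A x K L rho'.
Proof.
move=> rr [y [hy yK]]; exists y; split=> // i; have [Ay /andP[h1 h2]] := hy i.
by split=> //; rewrite h1 (leq_trans h2).
Qed.

Lemma tripod_translate (g : G) (A B : pred G) x K L rho :
  (forall z, B z -> A (g * z)%g) -> tripod S B x K L rho -> tripod S A (g * x)%g K L rho.
Proof.
move=> BA [y [hy yK]]; exists (fun i => g * y i)%g; split=> [i|i j ij].
  by have [/BA ? ?] := hy i; rewrite d_left.
by rewrite gp_left // yK.
Qed.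

Variable h : nat.
Hypothesis nonam : forall A : seq G, uniq A ->
  size A <= h * \sum_(x <- A) \sum_(s <- gens S) (x * s \notin A)%g.

(* Compactness: an ultralimit of cuts without such tripods would be a         *)
(* globally minimal cut without tripods.                                      *)
Lemma locally_minimal_tripod K0 : exists Kmax rho R, forall (U : pred G) x,
  bdry U x -> locally_minimal U x R -> locally_minimal (predC U) x R ->
  exists2 K, K0 <= K <= Kmax & tripod S (bdry U) x K (10 * K) rho.
Proof.
suff [n hn] : exists n, forall U : pred G, bdry U 1%g -> locally_minimal U 1%g n ->
    locally_minimal (predC U) 1%g n ->
    exists2 K, K0 <= K <= n & tripod S (bdry U) 1%g K (10 * K) n.
  exists n, n, n => U x bU mU mC.
  have [|||K KK tr] := hn (fun z => U (x * z)%g).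
  - by rewrite bdry_left mulg1.
  - by apply: locally_minimal_left; rewrite mulg1.
  - apply: (@eq_locally_minimal (fun z => predC U (x * z)%g)) => //.
    by apply: (@locally_minimal_left x (predC U)); rewrite mulg1.
  exists K => //; rewrite -{1}(mulg1 x); apply: tripod_translate tr => z.
  by rewrite bdry_left.
apply: contrapT => no.
have ex n : exists U : pred G, [/\ bdry U 1%g, locally_minimal U 1%g n,
    locally_minimal (predC U) 1%g n &
    ~ exists2 K, K0 <= K <= n & tripod S (bdry U) 1%g K (10 * K) n].
  apply: contrapT => no'; apply: no; exists n => U bU mU mC.
  by apply: contrapT => noK; apply: no'; exists U.
have [Us hUs] := choice ex; have [F UF] := exists_free_ultra.
pose U : pred G := fun z => `[< F (fun n => Us n z) >].
have agree (s : seq G) : F (fun n => forall z, z \in s -> Us n z = U z).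
  apply: (ultra_list UF (P := fun z n => Us n z = U z)) => z _.
  have [Fz|Fz] := ultraVC UF (fun n => Us n z).
    have Uz : U z by apply/asboolP.
    by apply: (ultraS UF) Fz => n ->; rewrite Uz.
  have nU : U z = false.
    apply/asboolP => Fz'; have [n [h1 h2]] := ultra_ex UF (ultraI UF Fz Fz').
    exact: h1.
  by apply: (ultraS UF) Fz => n /negP/negbTE ->.
pose nbr (A : seq G) := A ++ [seq (z * s)%g | z <- A, s <- gens S].
have inl A z : z \in A -> z \in nbr A by move=> zA; rewrite mem_cat zA.
have inr A z s : z \in A -> s \in gens S -> (z * s)%g \in nbr A.
  by move=> zA sS; rewrite mem_cat; apply/orP; right; apply: allpairs_f.
(* [f] is the identity or the negation, to treat U and its complement together. For a finite A,
   minimality involves only the values on [nbr A]. *)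
have mins (f : bool -> bool) : (forall n, locally_minimal (fun z => f (Us n z)) 1%g n) ->
    removal_minimal S (fun z => f (U z)).
  move=> mf A uA /allP AU.
  have [n [hn nA]] := ultra_ex UF (ultraI UF (agree (nbr A)) (ultra_ge UF (\max_(z <- A) len z))).
  have := mf n A uA; rewrite big_seq [X in _ <= X]big_seq.
  rewrite (eq_bigr (fun z => \sum_(s <- gens S) ~~ f (U (z * s)%g))); last first.
    move=> z zA; rewrite big_seq [RHS]big_seq; apply: eq_bigr => s sS.
    by rewrite hn // inr.
  rewrite [leqRHS](eq_bigr (fun z =>
    \sum_(s <- gens S) (f (U (z * s)%g) && (z * s \notin A)%g))); last first.
    move=> z zA; rewrite big_seq [RHS]big_seq; apply: eq_bigr => s sS.
    by rewrite hn // inr.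
  rewrite -!big_seq; apply=> z zA; rewrite hn ?inl //; split; first exact: AU.
  by rewrite d1 (leq_trans _ nA) // leq_bigmax_seq.
have [n0 [hn0 _]] := ultra_ex UF (ultraI UF (agree (nbr [:: 1%g])) (ultra_ge UF 0)).
have bU : bdry U 1%g.
  have [/andP[b1 /hasP[s sS b2]] _ _ _] := hUs n0.
  rewrite /bdry -hn0 ?inl ?mem_head // b1 /=; apply/hasP; exists s => //.
  by rewrite -hn0 // inr ?mem_head.
have [|||K [rho [KK [y [hy yK]]]]] := @minimal_cut_tripod _ _ genS D hypD rigidS h nonam U K0.
- by apply: (mins id) => n; case: (hUs n).
- by apply: (mins negb) => n; case: (hUs n).
- exact: bU.
have [n [hn nK]] :=
  ultra_ex UF (ultraI UF (agree (nbr [seq y i | i <- enum 'I_3])) (ultra_ge UF (K + rho))).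
have [_ _ _] := hUs n; apply; exists K; first by lia.
apply: (@tripod_weaken _ _ _ _ rho); first by lia.
exists y; split=> // i; have [/andP[b1 /hasP[s sS b2]] b3] := hy i; split=> //.
have yi : y i \in [seq y i | i <- enum 'I_3] by apply: map_f; rewrite mem_enum.
rewrite /bdry hn ?inl // b1; apply/hasP; exists s => //.
by rewrite hn // inr.
Qed.

(** [locally_minimal_tripod] gives tripods at scales between D + 1 and Kmax, and [uniform_tripod]
    turns them into tripods of a single scale k1 with arms longer than k1 + 3 D, as [descendants]
    requires. *)
Lemma local_growth : exists kappa a b, forall m (U : pred G) x o, bdry U x ->
  locally_minimal U x (m * a + b) -> locally_minimal (predC U) x (m * a + b) ->
  exists Z : seq G, [/\ uniq Z, size Z = 2 ^ m & forall z, z \in Z ->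
     [/\ bdry U z, d x z <= m * a & gp x o z <= kappa]].
Proof.
have [Kmax [rho [R hK]]] := locally_minimal_tripod D.+1.
pose r := stab_rad D Kmax; pose k1 := Kmax + 2 * D + 2 * r.
pose L1 := k1 + 3 * D + 1; pose a := 2 * r + L1 + rho.
pose N1 := 2 * r + L1 + rho + Kmax + 2 * D.
exists (k1 + 2 * D), a, (N1 + R) => m U x o bU mU mC.
apply: (@descendants _ _ genS D hypD (bdry U) k1 L1 a o m x) => //.
  by rewrite /L1; lia.
move=> z bz xz; apply: (@uniform_tripod _ _ genS D hypD (bdry U) D.+1 Kmax rho) => //.
move=> w bw zw; apply: hK => //.
  by apply: locally_minimal_sub mU; have := d_tri genS z x w; rewrite /N1 /r; lia.
by apply: locally_minimal_sub mC; have := d_tri genS z x w; rewrite /N1 /r; lia.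
Qed.

End LocalGrowth.

(** * Equivariant maps of minimal energy *)

Section Subgroups.
Variables (G : groupType) (H : set G).
Hypothesis sgH : subgroup H.

Lemma sub1 : H 1%g.
Proof. by case: sgH => + _; rewrite inE. Qed.

Lemma subF x y : H x -> H y -> H (x * y^-1)%g.
Proof.
move=> Hx Hy; case: sgH => _ /(_ x y); rewrite /in_mem /= => h.
by have := h (mem_set Hx) (mem_set Hy) => /set_mem.
Qed.

Lemma subV x : H x -> H x^-1%g.
Proof. by move=> Hx; rewrite -[x^-1%g]mul1g; apply: subF => //; exact: sub1. Qed.

Lemma subM x y : H x -> H y -> H (x * y)%g.
Proof. by move=> Hx Hy; rewrite -(invgK y); apply: subF => //; exact: subV. Qed.

Variable phi : G -> G.
Hypothesis homphi : hom_on H phi.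

Lemma phi1 : phi 1%g = 1%g.
Proof.
have := homphi sub1 sub1; rewrite mulg1 => /(congr1 (fun z => (phi 1)^-1 * z)%g).
by rewrite mulKg mulVg.
Qed.

Lemma phiV x : H x -> phi x^-1%g = (phi x)^-1%g.
Proof.
move=> Hx; apply/eqP; rewrite -mulg_eq1 -homphi ?mulVg ?phi1 //; exact: subV.
Qed.

Definition transversal (T : seq G) : Prop := [/\ uniq T,
  forall x, exists t h, [/\ t \in T, H h & x = (h * t)%g] &
  forall t t' h, t \in T -> t' \in T -> H h -> t = (h * t')%g -> t = t'].

Lemma transversal_sum (T T' : seq G) (F : G -> nat) :
  transversal T -> transversal T' -> (forall h x, H h -> F (h * x)%g = F x) ->
  \sum_(x <- T) F x = \sum_(x <- T') F x.
Proof.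
move=> [uT cT iT] [uT' cT' iT'] FH; have [r hr] := choice cT'.
rewrite (eq_bigr (F \o r)) => [|x _]; last first.
  by have [h [_ Hh e]] := hr x; rewrite {1}e FH.
rewrite -(big_map r xpredT); apply: perm_big; apply: uniq_perm => //.
  rewrite map_inj_in_uniq // => x y xT yT rxy.
  have [h [_ Hh ex]] := hr x; have [h' [_ Hh' ey]] := hr y.
  apply: (iT _ _ (h * h'^-1)%g) => //; first exact: subF.
  by rewrite [in LHS]ex [in RHS]ey rxy -mulgA mulKg.
move=> y; apply/mapP/idP => [[x xT ->]|yT']; first by have [h []] := hr x.
have [t [h [tT Hh e]]] := cT y; exists t => //.
have [h' [rT' Hh' e']] := hr t; apply: (iT' _ _ (h * h')%g) => //; first exact: subM.
by rewrite -mulgA -e'.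
Qed.

(** This allows the energy to be computed on a transversal containing an embedded ball. *)
Lemma transversal_extend (T B : seq G) : transversal T -> uniq B ->
  (forall b b' h, b \in B -> b' \in B -> H h -> b = (h * b')%g -> b = b') ->
  exists T', transversal (B ++ T') /\
    (forall t h b, t \in T' -> H h -> b \in B -> t <> (h * b)%g).
Proof.
move=> [uT cT iT] uB iB.
pose hit t := `[< exists h b, [/\ H h, b \in B & t = (h * b)%g] >].
have nohit t h b : t \in [seq t <- T | ~~ hit t] -> H h -> b \in B -> t <> (h * b)%g.
  by rewrite mem_filter => /andP[/asboolPn no _] Hh bB e; apply: no; exists h, b.
exists [seq t <- T | ~~ hit t]; split=> //; split.
- rewrite cat_uniq uB filter_uniq // andbT; apply/hasPn => t tT.
  by apply/negP => tB; apply: (nohit t 1%g t tT sub1 tB); rewrite mul1g.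
- move=> x; have [t [h [tT Hh e]]] := cT x.
  case: (boolP (hit t)) => [/asboolP[h' [b [Hh' bB tb]]]|nt].
    exists b, (h * h')%g; rewrite mem_cat bB -mulgA -tb; split=> //; exact: subM.
  by exists t, h; rewrite mem_cat mem_filter nt tT orbT.
- move=> t t' h; rewrite !mem_cat => /orP[tB|tT] /orP[tB'|tT'] Hh e.
  + exact: iB e.
  + case: (nohit t' h^-1%g t tT' (subV Hh) tB); by rewrite e mulKg.
  + by case: (nohit t h t' tT Hh tB').
  + by move: tT tT'; rewrite !mem_filter => /andP[_ tT] /andP[_ tT']; exact: iT e.
Qed.

End Subgroups.

Section Energy.
Variables (G : groupType) (S : seq G).
Hypothesis genS : generates S.
Local Open Scope nat_scope.
Local Notation d := (word_dist S).
Local Notation len := (word_length S).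
Local Notation gp := (gp S).

Lemma gens_sumV (F : G -> nat) :
  \sum_(s <- gens S) F s^-1%g = \sum_(s <- gens S) F s.
Proof.
rewrite -(big_map (fun s => s^-1%g) xpredT); apply: perm_big.
rewrite /gens map_cat -map_comp perm_catC perm_cat2r.
set s := map _ S; have -> : s = S; last exact: perm_refl.
by rewrite -[RHS]map_id; apply: eq_map => x /=; rewrite invgK.
Qed.

Lemma edge_swap (A B : seq G) (Q : pred G) : uniq A -> uniq B ->
  (forall y s, y \in A -> s \in gens S -> (y * s)%g \in B) ->
  \sum_(x <- B) \sum_(s <- gens S) (Q x && (x * s \in A)%g) =
  \sum_(y <- A) \sum_(s <- gens S) Q (y * s)%g.
Proof.
move=> uA uB AB.
have memE (L : seq G) z : uniq L -> (z \in L) = \sum_(y <- L) (y == z) :> nat.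
  by move=> uL; rewrite -big_mkcond sum1_count; rewrite count_uniq_mem.
transitivity (\sum_(x <- B) \sum_(s <- gens S) \sum_(y <- A) (Q x && (x == (y * s)%g))).
  apply: eq_bigr => x _; rewrite -[RHS]gens_sumV; apply: eq_bigr => s _.
  case: (Q x); last by rewrite big1.
  rewrite memE //; apply: eq_bigr => y _; congr nat_of_bool.
  by apply/eqP/eqP => ->; rewrite ?mulgK // mulgVK.
under eq_bigr do rewrite exchange_big; rewrite exchange_big /=.
rewrite big_seq [RHS]big_seq; apply: eq_bigr => y yA.
rewrite exchange_big big_seq [RHS]big_seq; apply: eq_bigr => s sS.
case Qys: (Q (y * s)%g); last first.
  by rewrite big1 // => x _; case: eqP => [->|]; rewrite ?Qys // andbF.
rewrite -[RHS](congr1 nat_of_bool (AB y s yA sS)) memE //; apply: eq_bigr => x _.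
by case: eqP => [->|]; rewrite ?Qys // andbF.
Qed.

Definition perimeter (B : seq G) (P : pred G) :=
  \sum_(x <- B) \sum_(s <- gens S) (P x != P (x * s)%g).

(** Only edges at [A] change, and each is seen from both of its ends because [B] contains the
    neighbours of [A]; hence the factors 2. *)
Lemma perimeter_removal (A B : seq G) (U : pred G) : uniq A -> uniq B -> all U A ->
  {subset A <= B} -> (forall y s, y \in A -> s \in gens S -> (y * s)%g \in B) ->
  perimeter B (fun z => U z && (z \notin A)) +
    2 * \sum_(x <- A) \sum_(s <- gens S) ~~ U (x * s)%g =
  perimeter B U + 2 * \sum_(x <- A) \sum_(s <- gens S) (U (x * s)%g && (x * s \notin A)%g).
Proof.
move=> uA uB /allP UA AB ABs; rewrite !mul2n -!addnn !addnA.
rewrite -{2}(edge_swap (predC U) uA uB ABs).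
rewrite -{2}(edge_swap (fun z => U z && (z \notin A)) uA uB ABs).
have ext (F : G -> G -> bool) : \sum_(x <- A) \sum_(s <- gens S) F x (x * s)%g =
    \sum_(x <- B) \sum_(s <- gens S) ((x \in A) && F x (x * s)%g).
  rewrite [RHS](bigID (mem A)) /= [X in _ = _ + X]big1 ?addn0; last first.
    by move=> x /negPf xA; rewrite big1 // => s _; rewrite xA.
  rewrite -[RHS]big_filter [RHS](perm_big A) /=.
    by apply: eq_big_seq => x xA; apply: eq_bigr => s _; rewrite xA.
  apply: uniq_perm; rewrite ?filter_uniq // => z; rewrite mem_filter /=.
  by case zA: (z \in A) => //; rewrite AB.
rewrite (ext (fun x y => ~~ U y)) (ext (fun x y => U y && (y \notin A))).
rewrite /perimeter -!big_split; apply: eq_bigr => x _ /=.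
rewrite -!big_split; apply: eq_bigr => s _ /=.
case xA: (x \in A); case yA: ((x * s)%g \in A) => /=; rewrite ?(UA _ xA) ?(UA _ yA) //=.
- by case: (U (x * s)%g).
- by case: (U x).
- by rewrite !andbT !andbF; case: (U x); case: (U (x * s)%g).
Qed.

End Energy.

Section Minimizer.
Variables (G : groupType) (S : seq G).
Hypothesis genS : generates S.
Local Open Scope nat_scope.
Local Notation d := (word_dist S).
Local Notation gp := (gp S).
Variables (H : set G) (phi : G -> G).
Hypotheses (sgH : subgroup H) (homphi : hom_on H phi).

Definition equivariant (f : G -> G) := forall h x, H h -> f (h * x)%g = (phi h * f x)%g.

Definition energy (T : seq G) (f : G -> G) :=
  \sum_(x <- T) \sum_(s <- gens S) d (f x) (f (x * s)%g).

Lemma energy_transversal T T' f : transversal H T -> transversal H T' -> equivariant f ->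
  energy T f = energy T' f.
Proof.
move=> hT hT' ef; apply: (transversal_sum sgH hT hT') => h x Hh.
by apply: eq_bigr => s _; rewrite -mulgA !(ef h) // d_left.
Qed.

Section Competitor.
Variables (x0 : G) (r : nat) (A : seq G) (p : G) (f : G -> G).
Hypothesis ef : equivariant f.
Hypothesis emb : forall h x, H h -> d x (h * x)%g <= 2 * r -> h = 1%g.
Hypothesis Ar : forall y, y \in A -> d x0 y <= r.

(** Send h A to phi(h) p. Translates by distinct h are disjoint because the ball embeds in H\G, so
    that this is well defined and equivariant. *)
Lemma collapse : exists f', [/\ equivariant f',
  forall y, d x0 y <= r -> f' y = if y \in A then p else f y &
  forall y, (forall h b, H h -> b \in A -> y <> (h * b)%g) -> f' y = f y].
Proof.
have emb' y y' h : d x0 y <= r -> d x0 y' <= r -> H h -> y = (h * y')%g -> h = 1%g.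
  move=> yr yr' Hh e; apply: (emb (x := y') Hh); rewrite -e.
  by have := d_tri genS x0 y' y; rewrite (d_sym genS y' x0); lia.
pose hit y h := H h /\ exists2 b, b \in A & y = (h * b)%g.
have hit_uniq y h h' : hit y h -> hit y h' -> h = h'.
  move=> [Hh [b bA e]] [Hh' [b' bA' e']].
  have := @emb' b' b (h'^-1 * h)%g; rewrite -mulgA -e e' mulKg => /(_ (Ar bA') (Ar bA)).
  have HH : H (h'^-1 * h)%g by apply: (subM sgH) => //; apply: (subV sgH).
  by move=> /(_ HH erefl) /(congr1 (fun z => h' * z)%g); rewrite mulVKg mulg1.
pose f' y := if pselect (exists h, hit y h) is left e then (phi (projT1 (cid e)) * p)%g else f y.
have f'hit y h : hit y h -> f' y = (phi h * p)%g.
  move=> yh; rewrite /f'; case: pselect => [e|[]]; last by exists h.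
  by case: (cid e) => h' /= yh'; rewrite (hit_uniq y h' h).
have f'no y : (forall h, ~ hit y h) -> f' y = f y.
  by move=> no; rewrite /f'; case: pselect => // e; exfalso; case: e => h; exact: no.
exists f'; split.
- move=> h y Hh; case: (pselect (exists k, hit y k)) => [[k yk]|no].
    rewrite (f'hit y k yk) (f'hit (h * y)%g (h * k)%g).
      by case: yk => Hk _; rewrite homphi // mulgA.
    by case: yk => Hk [b bA ->]; split; [exact: (subM sgH)|exists b; rewrite ?mulgA].
  rewrite !f'no ?ef //; first by move=> k yk; apply: no; exists k.
  move=> k [Hk [b bA e]]; apply: no; exists (h^-1 * k)%g; split.
    by apply: (subM sgH) => //; apply: (subV sgH).
  by exists b => //; rewrite -mulgA -e mulKg.
- move=> y yr; case: ifP => yA.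
    rewrite (f'hit y 1%g) ?(phi1 sgH homphi) ?mul1g //.
    by split; [exact: (sub1 sgH)|exists y; rewrite ?mul1g].
  apply: f'no => h [Hh [b bA e]]; move: yA.
  by rewrite e (emb' y b h) ?mul1g ?bA //; exact: Ar.
- by move=> y no; apply: f'no => h [Hh [b bA e]]; exact: (no h b).
Qed.

End Competitor.

(* Let A be a removal from U of least perimeter, and send A to p.  By coarea  *)
(* for y |-> d p (f y), the energy in B increases by N * perimeter (rem A)    *)
(* and decreases by the sum over t < N of perimeter (lay t), up to the Gromov *)
(* products c.  All these layers are removals from U, and the W lowest ones   *)
(* are U itself, so that perimeter (rem A) < perimeter U would make f' better *)
(* than f.                                                                    *)
Lemma energy_locally_minimal (T : seq G) (f : G -> G) (x0 p : G) R (U : pred G) c W :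
  transversal H T -> equivariant f ->
  (forall g, equivariant g -> energy T f <= energy T g) ->
  (forall h x, H h -> d x (h * x)%g <= 2 * (R + 2) -> h = 1%g) ->
  (forall y y', d x0 y <= R + 1 -> d x0 y' <= R + 1 -> U y -> ~~ U y' ->
     gp p (f y) (f y') <= c) ->
  (forall y, d x0 y <= R -> W <= d p (f y)) ->
  c * (vol S (R + 1) * size (gens S)) < W ->
  locally_minimal S U x0 R.
Proof.
move=> hT ef fmin emb gpU Wf cW A0 uA0 hA0; rewrite leqNgt; apply/negP => lt0.
pose B := ball S x0 (R + 1); have uB : uniq B by apply: ball_uniq.
have Bin y : (y \in B) = (d x0 y <= R + 1) by rewrite mem_ball.
pose rem (A : seq G) : pred G := fun z => U z && (z \notin A).
pose ok (A : seq G) := uniq A /\ forall z, z \in A -> U z /\ d x0 z <= R.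
have AB A : ok A -> {subset A <= B}.
  by move=> [_ hA] z /hA[_ zR]; rewrite Bin; lia.
have ABs A : ok A -> forall y s : G, y \in A -> s \in gens S -> (y * s)%g \in B.
  by move=> [_ hA] y s /hA[_ yR] sS; rewrite Bin; have := d_lip genS x0 y sS; lia.
have AU A : ok A -> all U A by move=> [_ hA]; apply/allP => z /hA[].
have okA0 : ok A0 by [].
have [A [okA Amin]] : exists A, ok A /\ forall A', ok A' ->
    perimeter S B (rem A) <= perimeter S B (rem A').
  have ex : exists n, `[< exists2 A, ok A & perimeter S B (rem A) = n >].
    by exists (perimeter S B (rem A0)); apply/asboolP; exists A0.
  case: (ex_minnP ex) => n /asboolP[A okA <-] nmin; exists A; split=> // A' okA'.
  by apply: nmin; apply/asboolP; exists A'.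
have ltA : perimeter S B (rem A) < perimeter S B U.
  apply: (leq_ltn_trans (Amin _ okA0)).
  have := perimeter_removal uA0 uB (AU _ okA0) (AB _ okA0) (ABs _ okA0).
  by rewrite -/(rem A0); lia.
have [uA hA] := okA.
have [f' [ef' f'B f'no]] :=
  @collapse x0 (R + 2) A p f ef emb (fun y yA => leq_trans (hA y yA).2 (leq_addr _ _)).
(* [lay t] removes only those points of A whose image is within t of p. N exceeds W and all values
   of [a] on A. *)
pose a y := d p (f y); pose N := (W + \max_(y <- A) a y).+1.
pose lay t : pred G := rem [seq z <- A | a z <= t].
have okt t : ok [seq z <- A | a z <= t].
  by split; [exact: filter_uniq|move=> z; rewrite mem_filter => /andP[_ /hA]].
have layE t z : lay t z = U z && ((z \notin A) || (t < a z)).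
  by rewrite /lay /rem mem_filter negb_and -ltnNge orbC.
have aN y : y \in A -> a y < N.
  by move=> yA; rewrite ltnS (leq_trans _ (leq_addl _ _)) // leq_bigmax_seq.
have cnt m : m <= N -> \sum_(t < N) (t < m) = m.
  move=> mN; rewrite -[RHS](minn_idPl mN).
  elim: (N) => [|n IH]; first by rewrite big_ord0 minn0.
  by rewrite big_ord_recr /= IH; case: (ltnP n m); lia.
have diff (m k : nat) : m <= N -> k <= N ->
    \sum_(t < N) ((t < m) != (t < k)) = (m - k) + (k - m).
  move=> mN kN; rewrite -[in RHS](minn_idPl mN) -[in RHS](minn_idPl kN).
  elim: (N) => [|n IH]; first by rewrite big_ord0 !minn0.
  by rewrite big_ord_recr /= IH; case: (ltnP n m); case: (ltnP n k); lia.
have pair (x y : G) : d x0 x <= R + 2 -> d x0 y <= R + 2 -> d x y <= 1 ->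
    d (f' x) (f' y) + \sum_(t < N) (lay t x != lay t y) <=
    d (f x) (f y) + N * (rem A x != rem A y) + c.
  wlog xA : x y / (x \in A) || (y \notin A).
    move=> wl; case: (boolP (x \in A)) => xA; first by apply: wl; rewrite xA.
    case: (boolP (y \in A)) => yA xR yR xy; last by apply: wl; rewrite ?yA ?orbT.
    have := wl y x; rewrite yA (d_sym genS y) (d_sym genS (f' y)) (d_sym genS (f y)).
    rewrite [rem A y == _]eq_sym; under eq_bigr do rewrite eq_sym.
    by apply.
  move=> xR yR xy; rewrite !f'B //; case: (boolP (x \in A)) xA => /= [xA _|xA /negPf yA].
    have [Ux xr] := hA x xA; have ax := aN x xA.
    have yr : d x0 y <= R + 1 by have := d_tri genS x x0 y; lia.
    have dx := d_tri genS (f x) p (f y).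
    have layx t : lay t x = (t < a x) by rewrite layE Ux xA.
    case: (boolP (y \in A)) => yA.
      have [Uy _] := hA y yA; have ay := aN y yA.
      have layy t : lay t y = (t < a y) by rewrite layE Uy yA.
      under eq_bigr do rewrite layx layy; rewrite diff ?(ltnW ax) ?(ltnW ay) // dxx //.
      have dy := d_tri genS (f y) p (f x); rewrite (d_sym genS (f y)) in dy.
      by rewrite /a in dx dy *; lia.
    case Uy: (U y).
      have layy t : lay t y = (t < N.+1 + t) by rewrite layE Uy yA; lia.
      have -> : \sum_(t < N) (lay t x != lay t y) = N - a x.
        rewrite (eq_bigr (fun t : 'I_N => ((t < a x) != (t < N)) : nat)).
          by rewrite diff ?(ltnW ax) //; lia.
        by move=> t _; rewrite layx layE Uy yA ltn_ord.
      rewrite /rem Ux xA Uy yA /= muln1 /a in ax dx *; lia.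
    have -> : \sum_(t < N) (lay t x != lay t y) = a x.
      rewrite (eq_bigr (fun t : 'I_N => ((t < a x) != (t < 0)) : nat)).
        by rewrite diff ?(ltnW ax) //; lia.
      by move=> t _; rewrite layx layE Uy.
    (* This is the only case with the error c: x is in A and y outside U, and [d (f x) (f y)] falls
       short of [a x + a y] by a product at p. *)
    have := gpU x y _ yr Ux; rewrite Uy => /(_ _ isT) gpxy.
    have := gpE genS p (f x) (f y); rewrite /rem Ux xA Uy /= muln0 /a.
    by have := gpxy _; have : d x0 x <= R + 1; lia.
  rewrite yA; rewrite (eq_bigr (fun=> (rem A x != rem A y) : nat)).
    by rewrite sum_nat_const card_ord leq_addr.
  by move=> t _; rewrite !layE /rem yA (negPf xA).
have [|T' [hT' restT']] := transversal_extend sgH hT uB.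
- move=> b b'; rewrite !Bin => h bB bB' Hh e; have h1 : h = 1%g; last by rewrite e h1 mul1g.
  apply: (emb _ b' Hh); rewrite -e; have := d_tri genS x0 b' b.
  by rewrite (d_sym genS b' x0); lia.
have := fmin f' ef'; rewrite leqNgt => /negP; apply.
rewrite (energy_transversal hT hT' ef) (energy_transversal hT hT' ef').
rewrite /energy !big_cat /=.
(* Edges starting in T' have both ends outside the translates of A, since B contains the neighbours
   of A; f' agrees with f there. *)
have -> : \sum_(x <- T') \sum_(s <- gens S) d (f' x) (f' (x * s)%g) =
    \sum_(x <- T') \sum_(s <- gens S) d (f x) (f (x * s)%g).
  rewrite big_seq [RHS]big_seq; apply: eq_bigr => x xT'.
  rewrite big_seq [RHS]big_seq; apply: eq_bigr => s sS; rewrite !f'no //.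
    move=> h b Hh bA e; apply: (restT' x h (b * s^-1)%g xT' Hh).
      by apply: (ABs A okA); rewrite ?gensV.
    by rewrite mulgA -e mulgK.
  by move=> h b Hh bA; apply: (restT' x h b xT' Hh); exact: (AB A okA).
rewrite ltn_add2r.
have sumB : \sum_(x <- B) \sum_(s <- gens S) d (f' x) (f' (x * s)%g) +
    \sum_(t < N) perimeter S B (lay t) <=
    \sum_(x <- B) \sum_(s <- gens S) d (f x) (f (x * s)%g) +
    N * perimeter S B (rem A) + c * (vol S (R + 1) * size (gens S)).
  have -> : \sum_(t < N) perimeter S B (lay t) =
      \sum_(x <- B) \sum_(s <- gens S) \sum_(t < N) (lay t x != lay t (x * s)%g).
    by rewrite exchange_big /=; apply: eq_bigr => x _; rewrite exchange_big.
  have -> : c * (vol S (R + 1) * size (gens S)) = \sum_(x <- B) \sum_(s <- gens S) c.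
    under eq_bigr do rewrite big_const_seq count_predT iter_addn_0.
    by rewrite big_const_seq count_predT iter_addn_0 size_ball -mulnA (mulnC (size _)).
  rewrite /perimeter big_distrr -!big_split big_seq [X in _ <= X]big_seq.
  apply: leq_sum => x; rewrite Bin => xB /=; rewrite big_distrr -!big_split.
  rewrite big_seq [X in _ <= X]big_seq; apply: leq_sum => s sS /=.
  apply: pair; [lia| |exact: d_gens].
  by have := d_lip genS x0 x sS; lia.
have lays : N * perimeter S B (rem A) + W <= \sum_(t < N) perimeter S B (lay t).
  have -> : N * perimeter S B (rem A) + W =
      \sum_(t < N) (perimeter S B (rem A) + (t < W)).
    rewrite big_split /= sum_nat_const card_ord cnt //.
    by rewrite /N leqW // leq_addr.
  apply: leq_sum => t _; case: (ltnP t W) => tW; last by rewrite addn0 Amin.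
  rewrite addn1; suff -> : perimeter S B (lay t) = perimeter S B U by [].
  have e : lay t =1 U.
    move=> z; rewrite layE; case: (boolP (z \in A)) => zA; last by rewrite andbT.
    by rewrite (leq_trans tW) ?andbT // Wf //; case: (hA z zA).
  by apply: eq_bigr => x _; apply: eq_bigr => s _; rewrite !e.
have arith (e1 e2 l n k : nat) : e1 + l <= e2 + n + k -> n + W <= l -> k < W -> e1 < e2.
  by lia.
exact: arith sumB lays cW.
Qed.

End Minimizer.

(** * Double counting *)

Lemma irredundant (T : eqType) (R : T -> T -> Prop) (s : seq T) :
  (forall x, R x x) -> (forall x y, R x y -> R y x) ->
  exists s', [/\ uniq s', {subset s' <= s},
    forall x, x \in s -> exists2 y, y \in s' & R x y &
    forall x y, x \in s' -> y \in s' -> R x y -> x = y].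
Proof.
move=> Rxx Rsym; elim: s => [|x s [s' [us' ss' cs' is']]]; first by exists [::].
case: (pselect (exists2 y, y \in s' & R x y)) => [[y ys' xy]|no].
  exists s'; split=> // [z /ss'|z]; rewrite inE; first by move->; rewrite orbT.
  by case/orP => [/eqP->|/cs'//]; exists y.
exists (x :: s'); split.
- rewrite /= us' andbT; apply/negP => xs'; apply: no; exists x => //.
- by move=> z; rewrite !inE => /orP[->|/ss' ->]; rewrite ?orbT.
- move=> z; rewrite inE => /orP[/eqP->|/cs'[y ys' zy]].
    by exists x; rewrite ?mem_head.
  by exists y; rewrite // inE ys' orbT.
- move=> z z'; rewrite !inE => /orP[/eqP->|zs] /orP[/eqP->|zs'] //.
  + by move=> xz'; case: no; exists z'.
  + by move=> /Rsym xz; case: no; exists z.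
  + exact: is'.
Qed.

Section MassTransport.
Variables (G : groupType) (H : set G) (phi : G -> G).
Hypotheses (sgH : subgroup H) (homphi : hom_on H phi) (injphi : set_inj H phi).
Local Open Scope nat_scope.
Variable T : seq G.
Hypothesis hT : transversal H T.

(** To be read as a relation between points x and p, finite over each x and invariant under all
    pairs (h, phi h). *)
Definition invariant_family (fa : G -> seq G) := (forall x, uniq (fa x)) /\
  forall h x p, H h -> (phi h * p \in fa (h * x))%g = (p \in fa x).

Lemma phi_inj h h' : H h -> H h' -> phi h = phi h' -> h = h'.
Proof. by move=> Hh Hh'; apply: injphi; rewrite inE. Qed.

(** Up to H there are finitely many related pairs (t, q). As phi is injective, each has at most one
    translate with second entry p, so that p is related to finitely many x. *)
Lemma fiber fa : invariant_family fa -> exists ga : G -> seq G,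
  forall p, uniq (ga p) /\ forall x, (x \in ga p) = (p \in fa x).
Proof.
move=> [ufa ifa];
  suff ex : forall p, exists g : seq G, uniq g /\ forall x, (x \in g) = (p \in fa x).
  by have [g hg] := choice ex; exists g.
move=> p.
have [uT cT iT] := hT.
pose back (tq : G * G) x :=
  p \in fa x /\ exists h, [/\ H h, x = (h * tq.1)%g & (phi h * tq.2)%g = p].
have back_uniq tq x x' : back tq x -> back tq x' -> x = x'.
  move=> [_ [h [Hh -> e]]] [_ [h' [Hh' -> e']]]; congr (_ * _)%g.
  by apply: phi_inj => //; apply: (@mulIg _ tq.2); rewrite e e'.
pose L := [seq (t, q) | t <- T, q <- fa t].
have [s hs] : exists s : seq G, forall x, p \in fa x -> x \in s.
  have [r hr] : exists r : G * G -> G, forall tq x, back tq x -> r tq = x.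
    suff ex : forall tq, exists y, forall x, back tq x -> y = x.
      by have [r hr] := choice ex; exists r.
    move=> tq.
    case: (pselect (exists x, back tq x)) => [[x bx]|no].
      by exists x => x'; exact: back_uniq.
    by exists 1%g => x bx; case: no; exists x.
  exists [seq r tq | tq <- L] => x px; have [t [h [tT Hh e]]] := cT x.
  pose q := ((phi h)^-1 * p)%g; apply/mapP; exists (t, q).
    apply/allpairsPdep; exists t, q; split=> //.
    by rewrite -(ifa h t q Hh) -e /q mulVKg.
  symmetry; apply: hr; split=> //; exists h; split=> //=.
  by rewrite /q mulVKg.
exists (undup [seq x <- s | p \in fa x]); rewrite undup_uniq; split=> // x.
rewrite mem_undup mem_filter; case px: (p \in fa x) => //=; exact: hs.
Qed.

Lemma fiber_sum fa ga P0 : invariant_family fa ->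
  (forall p, uniq (ga p) /\ forall x, (x \in ga p) = (p \in fa x)) ->
  uniq P0 ->
  (forall t q, t \in T -> q \in fa t -> exists h, H h /\ (phi h * q)%g \in P0) ->
  (forall p h, p \in P0 -> H h -> (phi h * p)%g \in P0 -> (phi h * p)%g = p) ->
  \sum_(t <- T) size (fa t) = \sum_(p <- P0) size (ga p).
Proof.
move=> [ufa ifa] hga uP0 cP0 iP0; have [uT cT iT] := hT.
pose LA := [seq (t, q) | t <- T, q <- fa t]; pose LB := [seq (p, x) | p <- P0, x <- ga p].
have uLA : uniq LA.
  by apply: allpairs_uniq_dep => // -[a b] [a' b'] _ _ [-> ->].
have uLB : uniq LB.
  by apply: allpairs_uniq_dep => // [p _|[a b] [a' b'] _ _ [-> ->]] //; case: (hga p).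
have sA : \sum_(t <- T) size (fa t) = size LA.
  by rewrite size_allpairs_dep sumnE big_map.
have sB : \sum_(p <- P0) size (ga p) = size LB.
  by rewrite size_allpairs_dep sumnE big_map.
have memA t q : (t, q) \in LA -> t \in T /\ q \in fa t.
  by case/allpairsPdep => t' [q' [tT qf [-> ->]]].
have memB p x : (p, x) \in LB -> p \in P0 /\ p \in fa x.
  by case/allpairsPdep => t' [q' [tT qf [-> ->]]]; rewrite -(hga t').2.
rewrite sA sB; apply/eqP; rewrite eqn_leq; apply/andP; split.
  have [k hk] : exists k : G -> G, forall q, (exists2 t, t \in T & q \in fa t) ->
    H (k q) /\ (phi (k q) * q)%g \in P0.
    suff ex : forall q, exists h, (exists2 t, t \in T & q \in fa t) -> H h /\ (phi h * q)%g \in P0.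
      by have [k hk] := choice ex; exists k.
    move=> q.
    case: (pselect (exists2 t, t \in T & q \in fa t)) => [[t tT qt]|no].
      by have [h hh] := cP0 t q tT qt; exists h.
    by exists 1%g => /no.
  rewrite -(size_map (fun tq => ((phi (k tq.2) * tq.2)%g, (k tq.2 * tq.1)%g))).
  apply: uniq_leq_size.
    rewrite map_inj_in_uniq // => -[t q] [t' q'] /memA[tT qt] /memA[tT' qt'] /= [e1 e2].
    have [Hk _] : H (k q) /\ (phi (k q) * q)%g \in P0 by apply: hk; exists t.
    have [Hk' _] : H (k q') /\ (phi (k q') * q')%g \in P0 by apply: hk; exists t'.
    have tt : t = t'.
      apply: (iT t t' ((k q)^-1 * k q')%g) => //.
        by apply: (subM sgH) => //; apply: (subV sgH).
      by rewrite -mulgA -e2 mulKg.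
    subst t'; have kk : k q = k q' by apply: (@mulIg _ t).
    by rewrite kk in e1; rewrite (mulgI _ _ _ e1).
  move=> _ /mapP[[t q] /memA[tT qt] ->] /=.
  have [Hk kP] : H (k q) /\ (phi (k q) * q)%g \in P0 by apply: hk; exists t.
  apply/allpairsPdep; exists (phi (k q) * q)%g, (k q * t)%g; split=> //.
  by rewrite (hga _).2 ifa.
have [r hr] := choice cT; have [k hk] := choice hr.
rewrite -(size_map (fun px => (r px.2, ((phi (k px.2))^-1 * px.1)%g))).
apply: uniq_leq_size.
  rewrite map_inj_in_uniq // => -[p x] [p' x'] /memB[pP px] /memB[pP' px'] /= [e1 e2].
  have [_ Hk ex] := hk x; have [_ Hk' ex'] := hk x'.
  have HV := subV sgH Hk; have HV' := subV sgH Hk'.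
  have HM : H (k x' * (k x)^-1)%g by apply: (subM sgH).
  have pE : p' = (phi (k x' * (k x)^-1)%g * p)%g.
    by rewrite homphi // (phiV sgH homphi) // -mulgA e2 mulVKg.
  have pp : p' = p by rewrite pE; apply: iP0; rewrite -?pE.
  have kk : k x = k x'.
    by apply: phi_inj => //; apply: invg_inj; rewrite pp in e2; exact: (mulIg _ _ _ e2).
  congr pair; first by rewrite pp.
  by rewrite [LHS]ex [RHS]ex' e1 kk.
move=> _ /mapP[[p x] /memB[pP px] ->] /=; have [rT Hk ex] := hk x.
apply/allpairsPdep; exists (r x), ((phi (k x))^-1 * p)%g; split=> //.
by rewrite -(ifa (k x)) // -ex mulVKg.
Qed.

(* Both sums count H-orbits of pairs (x, p); they are regrouped along the     *)
(* orbits of p under phi(H), on which H acts freely since phi is injective.   *)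
Lemma mass_transport fa fb k V : invariant_family fa -> invariant_family fb ->
  (forall p A B, uniq A -> uniq B -> (forall x, (x \in A) = (p \in fa x)) ->
     (forall x, (x \in B) = (p \in fb x)) -> size A * k <= size B * V) ->
  (\sum_(t <- T) size (fa t)) * k <= (\sum_(t <- T) size (fb t)) * V.
Proof.
move=> ia ib hAB; have [ga hga] := fiber ia; have [gb hgb] := fiber ib.
pose P := flatten [seq fa t ++ fb t | t <- T].
pose R p q := exists h, H h /\ (phi h * p)%g = q.
have Rxx p : R p p by exists 1%g; rewrite (phi1 sgH homphi) mul1g; split=> //; exact: (sub1 sgH).
have Rsym p q : R p q -> R q p.
  move=> [h [Hh <-]]; exists h^-1%g; rewrite (phiV sgH homphi) // mulKg.
  by split=> //; apply: (subV sgH).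
have [P0 [uP0 sP0 cP0 iP0]] := irredundant P Rxx Rsym.
have c0 q : q \in P -> exists h, H h /\ (phi h * q)%g \in P0.
  by move=> /cP0[q' qP [h [Hh e]]]; exists h; rewrite e.
have i0 p h : p \in P0 -> H h -> (phi h * p)%g \in P0 -> (phi h * p)%g = p.
  by move=> pP Hh qP; symmetry; apply: iP0 => //; exists h.
rewrite (fiber_sum ia hga uP0 _ i0) ?(fiber_sum ib hgb uP0 _ i0).
- rewrite !big_distrl leq_sum //= => p _.
  by apply: hAB (hga p).1 (hgb p).1 (hga p).2 (hgb p).2.
- move=> t q tT qt; apply: c0; apply/flattenP; exists (fa t ++ fb t).
    by apply/mapP; exists t.
  by rewrite mem_cat qt orbT.
- move=> t q tT qt; apply: c0; apply/flattenP; exists (fa t ++ fb t).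
    by apply/mapP; exists t.
  by rewrite mem_cat qt.
Qed.

End MassTransport.

Lemma size_filterU (T : Type) (a b : pred T) (s : seq T) :
  (size [seq x <- s | a x || b x] <= size [seq x <- s | a x] + size [seq x <- s | b x])%N.
Proof. by rewrite !size_filter -count_predUI leq_addr. Qed.

(** * Good and bad points between the values of a map *)

Section EnergyBound.
Variables (G : groupType) (S : seq G).
Hypothesis genS : generates S.
Variable D : nat.
Hypothesis hypD : four_point S D.
Local Open Scope nat_scope.
Local Notation d := (word_dist S).
Local Notation len := (word_length S).
Local Notation gp := (gp S).

(** As p lies between [u] and [v] and sees [a] and [b] in a common direction, one of [u], [v] is in
    a direction different from both. From that point w, the distance to p is half of [gp w a b] up
    to a bounded error, which confines p to a slice. *)
Lemma ambiguous_count (A : seq G) (u v a b : G) W : uniq A ->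
  (forall p, p \in A -> gp p u v = 0 /\ 2 * D < gp p a b < W) ->
  size A <= 2 * vol S (W + 4 * D + 2).
Proof.
move=> uA hA; pose A1 := [seq p <- A | gp p u a <= D & gp p u b <= 2 * D].
pose A2 := [seq p <- A | gp p v a <= D + D & gp p v b <= 2 * D].
have half (B : seq G) (w w' : G) : uniq B -> (forall p, p \in B -> [/\ gp p w w' = 0,
    2 * D < gp p a b < W, gp p w a <= 2 * D & gp p w b <= 2 * D]) ->
    size B <= vol S (W + 4 * D + 2).
  move=> uB hB;
    have := @slice_count _ _ genS D hypD B w w' 0 (W + 3 * D + 2) ((gp w a b - W)./2) uB.
  move=> h; apply: leq_trans (h _) _; last first.
    by rewrite addn0 (_ : W + 3 * D + 2 + D = W + 4 * D + 2) //; lia.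
  move=> p /hB[-> /andP[h1 h2] h3 h4].
  have := gpE genS w a b; have := gpE genS p a b; have := gpE genS p w a; have := gpE genS p w b.
  by rewrite (d_sym genS p w) => *; split=> //; lia.
have sub : size A <= size A1 + size A2.
  apply: leq_trans (size_filterU _ _ _); rewrite (all_filterP _) //.
  apply/allP => p pA /=.
  have [uv /andP[h1 h2]] := hA p pA.
  have t1 := gp_tri hypD p u a v; have t2 := gp_tri hypD p u b a.
  have t3 := gp_tri hypD p v b a; have t4 := gp_tri hypD p u b v.
  rewrite (gpC genS p b a) in t2 t3; rewrite (gpC genS p b v) in t4.
  rewrite (gpC genS p a v) in t1.
  by rewrite uv in t1 t4; lia.
apply: (leq_trans sub); rewrite mul2n -addnn leq_add //.
  apply: (half _ u v); rewrite ?filter_uniq // => p.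
  by rewrite mem_filter => /andP[/andP[h1 h2] /hA[? ?]]; split=> //; lia.
apply: (half _ v u); rewrite ?filter_uniq // => p.
rewrite mem_filter => /andP[/andP[h1 h2] /hA[h3 ?]]; rewrite (gpC genS p v u).
by split=> //; lia.
Qed.

Section Maps.
Variable f : G -> G.

(** For c = 0 these are the points on geodesics from [f x] to the values at the neighbours of x; the
    ball only makes the list finite. *)
Definition between c x := undup (flatten
  [seq [seq p <- ball S (f x) (d (f x) (f (x * s)%g) + c) |
          gp p (f x) (f (x * s)%g) <= c] | s <- gens S]).

Lemma mem_between c x p : (p \in between c x) =
  has (fun s => gp p (f x) (f (x * s)%g) <= c) (gens S).
Proof.
rewrite mem_undup; apply/flattenP/hasP => [[_ /mapP[s sS ->]]|[s sS h]].
  by rewrite mem_filter => /andP[h _]; exists s.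
eexists; first by apply/mapP; exists s; [exact: sS|reflexivity].
rewrite mem_filter h mem_ball //; have := gpE genS p (f x) (f (x * s)%g).
by rewrite (d_sym genS p (f x)); lia.
Qed.

Lemma size_between c x : size (between c x) <=
  \sum_(s <- gens S) (d (f x) (f (x * s)%g) + c).+1 * vol S (c + D).
Proof.
apply: (leq_trans (size_undup _)); rewrite size_flatten /shape -map_comp sumnE big_map.
apply: leq_sum => s _ /=.
apply: (@slab_count _ _ genS D hypD _ (f x) (f (x * s)%g)).
  by rewrite filter_uniq // ball_uniq.
by move=> p; rewrite mem_filter mem_ball // => /andP[].
Qed.

Lemma between_ge x : \sum_(s <- gens S) d (f x) (f (x * s)%g) <=
  size (gens S) * size (between 0 x).
Proof.
rewrite -sum1_size big_distrl /= big_seq [leqRHS]big_seq leq_sum // => s sS.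
rewrite mul1n; have [c [c0 cd cc]] := geodesicP genS (f x) (f (x * s)%g).
set n := d _ _ in cd cc *; rewrite -(size_iota 0 n) -(size_map c).
apply: uniq_leq_size.
  rewrite map_inj_in_uniq ?iota_uniq // => i j; rewrite !mem_iota !add0n /= => il jl e.
  wlog ij : i j il jl e / i <= j.
    by move=> wl; case: (leqP i j) => h; [apply: wl|symmetry; apply: wl => //; exact: ltnW].
  by have := cc i j ij (ltnW jl); rewrite e dxx //; lia.
move=> q /mapP[i]; rewrite mem_iota add0n /= => il ->.
rewrite mem_between; apply/hasP; exists s => //.
have h1 := cc 0 i (leq0n _) (ltnW il); have h2 := cc i n (ltnW il) (leqnn _).
rewrite c0 in h1; rewrite cd in h2.
have := gpE genS (c i) (f x) (f (x * s)%g); rewrite (d_sym genS (c i) (f x)) h1 h2 -/n.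
by lia.
Qed.

(** The gap between [2 * D] and [W] gives the values of f on the ball well-defined directions from
    p: for W > 3 D, having a large product is then transitive. *)
Definition good R W x p :=
  all (fun y => (W <= d p (f y)) && all (fun y' =>
    (gp p (f y) (f y') <= 2 * D) || (W <= gp p (f y) (f y'))) (ball S x R)) (ball S x R).

Lemma goodP R W x p : reflect ((forall y, d x y <= R -> W <= d p (f y)) /\
   forall y y', d x y <= R -> d x y' <= R ->
     gp p (f y) (f y') <= 2 * D \/ W <= gp p (f y) (f y')) (good R W x p).
Proof.
apply: (iffP allP) => [h|[h1 h2] y]; last first.
  rewrite mem_ball // => yR; rewrite h1 //=; apply/allP => y'; rewrite mem_ball // => y'R.
  by apply/orP; apply: h2.
split=> [y yR|y y' yR y'R]; have := h y; rewrite mem_ball // => /(_ yR) /andP[] //.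
by move=> _ /allP /(_ y'); rewrite mem_ball // => /(_ y'R) /orP.
Qed.

Definition bad_const R W :=
  size (gens S) * (vol S R * vol S R) * (vol S W + 2 * vol S (W + 4 * D + 2)).

(** A bad p is within [W] of some value of f on the ball, or ambiguous for a pair of such values,
    and [ambiguous_count] applies. *)
Lemma bad_count R W x :
  size [seq p <- between 0 x | ~~ good R W x p] <= bad_const R W.
Proof.
pose I := [seq (s, yy) | s <- gens S, yy <- [seq (y, y') | y <- ball S x R, y' <- ball S x R]].
have sI : size I = size (gens S) * (vol S R * vol S R) by rewrite !size_allpairs !size_ball.
set L := [seq _ <- _ | _]; have uL : uniq L by rewrite filter_uniq // undup_uniq.
pose Q p (i : G * (G * G)) := (d (f i.2.1) p <= W) || ((gp p (f x) (f (x * i.1)%g) == 0) &&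
  (2 * D < gp p (f i.2.1) (f i.2.2) < W)).
rewrite -[size L]muln1 /bad_const -sI.
apply: (@size_pairs _ _ L I Q) => [p|[s [y y']] _].
  rewrite mem_filter => /andP[ng]; rewrite mem_between => /hasP[s sS].
  rewrite leqn0 => ps; rewrite -has_count.
  case: (allPn ng) => y yB; rewrite negb_and => /orP[h|/allPn[y' y'B]].
    apply/hasP; exists (s, (y, y)); first by rewrite !allpairs_f.
    by rewrite /Q /= d_sym // ltnW // ltnNge.
  rewrite negb_or -ltnNge -ltnNge => h; apply/hasP; exists (s, (y, y')).
    by rewrite !allpairs_f.
  by rewrite /Q /= ps h orbT.
rewrite /Q /= -size_filter.
apply: (leq_trans (size_filterU _ _ _)); rewrite leq_add //.
  apply: (@uniq_ball_size _ _ genS _ (f y)); first exact: filter_uniq.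
  by move=> p; rewrite mem_filter => /andP[].
apply: (@ambiguous_count _ (f x) (f (x * s)%g) (f y) (f y')); first exact: filter_uniq.
by move=> p; rewrite mem_filter => /andP[/andP[/eqP-> ->]].
Qed.

End Maps.
End EnergyBound.

Section MainBound.
Variables (G : groupType) (S : seq G).
Hypothesis genS : generates S.
Variable D : nat.
Hypothesis hypD : four_point S D.
Hypothesis rigidS : geometrically_rigid S.
Local Open Scope nat_scope.
Local Notation d := (word_dist S).
Local Notation gp := (gp S).
Variable h0 : nat.
Hypothesis nonam : forall A : seq G, uniq A ->
  size A <= h0 * \sum_(x <- A) \sum_(s <- gens S) (x * s \notin A)%g.

Section Invariance.
Variables (H : set G) (phi f : G -> G).
Hypotheses (sgH : subgroup H) (homphi : hom_on H phi) (ef : equivariant H phi f).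

Lemma between_invariant c h x p : H h ->
  (phi h * p \in between S f c (h * x))%g = (p \in between S f c x).
Proof.
move=> Hh; rewrite !mem_between //; apply: eq_has => s.
by rewrite -mulgA !(@ef h) // gp_left.
Qed.

Lemma good_invariant R W h x p : H h ->
  good S D f R W (h * x)%g (phi h * p)%g = good S D f R W x p.
Proof.
move=> Hh; have imp k z q : H k -> good S D f R W z q -> good S D f R W (k * z)%g (phi k * q)%g.
  move=> Hk /(goodP genS)[g1 g2]; apply/(goodP genS).
  have tr y : d (k * z)%g y <= R -> exists2 y0, y = (k * y0)%g & d z y0 <= R.
    move=> yR; exists (k^-1 * y)%g; first by rewrite mulVKg.
    by rewrite -(d_left S k) mulVKg.
  split=> [_ /tr[y -> yR]|_ _ /tr[y -> yR] /tr[y' -> y'R]].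
    by rewrite ef // d_left; apply: g1.
  by rewrite !ef // gp_left; apply: g2.
apply/idP/idP; last exact: imp.
move=> /(imp h^-1%g _ _ (subV sgH Hh)).
by rewrite (phiV sgH homphi) // !mulKg.
Qed.

End Invariance.

(* The 2 ^ m descendants of x along the cut defined by p again have p between *)
(* the images of their edges, and each of them has O(m) ancestors; m is such  *)
(* that the good pairs then account for at most half of the energy.           *)
Lemma energy_bound : exists R C, forall (H : set G) (phi : G -> G) T f,
  subgroup H -> hom_on H phi -> set_inj H phi -> transversal H T ->
  (forall h x, H h -> d x (h * x)%g <= 2 * (R + 2) -> h = 1%g) ->
  equivariant H phi f ->
  (forall g, equivariant H phi g -> energy S T f <= energy S T g) ->
  energy S T f <= C * size T.
Proof.
have [kappa [a [b growth]]] := local_growth genS hypD rigidS nonam.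
pose g := size (gens S); pose v2 := vol S (2 * D + D).
have [m hm] := exp_beats (2 * g * v2 * vol S (kappa + D)) a.
(* R is the radius on which [growth] requires minimality. W dominates the error in
   [energy_locally_minimal] and exceeds 3 D, as needed for directions. *)
pose R := m * a + b; pose W := 2 * D * (vol S (R + 1) * g) + 3 * D + 1.
pose Cb := bad_const S D (R + 1) W.
exists R, (2 * g * Cb + (2 * D + 1) * g) => H phi T f sgH homphi injphi hT emb ef fmin.
pose f0 x := between S f 0 x; pose f2 x := between S f (2 * D) x.
pose fg x := [seq p <- f0 x | good S D f (R + 1) W x p].
have invg : invariant_family H phi fg.
  split=> [x|h x p Hh]; first by rewrite filter_uniq // undup_uniq.
  by rewrite !mem_filter (between_invariant ef) // (good_invariant sgH homphi ef).
have inv2 : invariant_family H phi f2.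
  by split=> [x|h x p Hh]; [exact: undup_uniq|rewrite (between_invariant ef)].
have local x p : p \in fg x -> exists Z : seq G, [/\ uniq Z, 2 ^ m <= size Z &
    forall z, z \in Z -> [/\ p \in f2 z, d x z <= m * a & gp x 1%g z <= kappa]].
  rewrite mem_filter mem_between // => /andP[/(goodP genS)[gW ggap] /hasP[s0 s0S]].
  rewrite leqn0 => /eqP p0.
  pose U : pred G := fun y => (d x y <= R + 1) && (2 * D < gp p (f y) (f x)).
  have xR : d x x <= R + 1 by rewrite dxx.
  have Ux : U x.
    rewrite /U xR gpxx //; have := gW x xR; rewrite /W; lia.
  have sep y y' : d x y <= R + 1 -> d x y' <= R + 1 -> U y -> ~~ U y' -> gp p (f y) (f y') <= 2 * D.
    move=> yR y'R; rewrite /U yR y'R /= -leqNgt => Uy Uy'.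
    case: (ggap y y' yR y'R) => // h1; case: (ggap y x yR xR) => h2; first by lia.
    have := gp_tri hypD p (f y') (f y) (f x); rewrite (gpC genS p (f y') (f y)).
    by rewrite /W in h1 h2; lia.
  have sepC y y' : d x y <= R + 1 -> d x y' <= R + 1 -> predC U y -> ~~ predC U y' ->
    gp p (f y) (f y') <= 2 * D.
    by move=> yR y'R Uy; rewrite /= negbK gpC // => Uy'; apply: sep.
  have WR y : d x y <= R -> W <= d p (f y) by move=> yR; apply: gW; lia.
  have cW : 2 * D * (vol S (R + 1) * size (gens S)) < W by rewrite /W /g; lia.
  have bU : bdry S U x.
    rewrite /bdry Ux; apply/hasP; exists s0 => //.
    by rewrite /U negb_and -leqNgt (gpC genS) p0 orbT.
  have [||Z [uZ sZ hZ]] := growth m U x 1%g bU.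
  - exact: (energy_locally_minimal genS sgH homphi hT ef fmin emb sep WR cW).
  - exact: (energy_locally_minimal genS sgH homphi hT ef fmin emb sepC WR cW).
  exists Z; split=> // [|z /hZ[/andP[Uz /hasP[s sS Uzs]] zm zk]]; first by rewrite sZ.
  split=> //; rewrite mem_between //; apply/hasP; exists s => //.
  have zsR : d x (z * s)%g <= R + 1.
    by apply: leq_trans (d_lip genS x z sS) _; rewrite /R; lia.
  by apply: sep => //; case/andP: Uz.
have mt := mass_transport sgH homphi injphi hT (k := 2 ^ m)
  (V := (m * a).+1 * vol S (kappa + D)) invg inv2.
have {mt} mt : (\sum_(t <- T) size (fg t)) * 2 ^ m <=
    (\sum_(t <- T) size (f2 t)) * ((m * a).+1 * vol S (kappa + D)).
  apply: mt => p A B uA uB hA hB.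
  apply: (descendants_count genS hypD (o := 1%g)) => // x xA.
  have [Z [uZ sZ hZ]] := local x p (etrans (esym (hA x)) xA).
  by exists Z; split=> // z /hZ[pz zm zk]; rewrite hB.
have e0 : energy S T f <= g * \sum_(t <- T) size (f0 t).
  rewrite /energy big_distrr leq_sum //= => x _; exact: between_ge.
have e1 : \sum_(t <- T) size (f0 t) <= \sum_(t <- T) size (fg t) + Cb * size T.
  have -> : Cb * size T = \sum_(t <- T) Cb.
    by rewrite big_const_seq count_predT iter_addn_0.
  rewrite -big_split leq_sum //= => x _.
  rewrite -(count_predC (good S D f (R + 1) W x)) -!size_filter leq_add2l.
  exact: bad_count.
have e2 : \sum_(t <- T) size (f2 t) <= (energy S T f + (2 * D + 1) * g * size T) * v2.
  have -> : (2 * D + 1) * g * size T = \sum_(t <- T) (2 * D + 1) * g.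
    by rewrite big_const_seq count_predT iter_addn_0.
  rewrite /energy -big_split big_distrl leq_sum //= => x _.
  apply: (leq_trans (size_between genS hypD f (2 * D) x)).
  have -> : (2 * D + 1) * g = \sum_(s <- gens S) (2 * D + 1).
    by rewrite big_const_seq count_predT iter_addn_0.
  rewrite -big_split big_distrl leq_sum //= => s _; rewrite leq_mul2r /v2.
  by apply/orP; right; lia.
move: (energy S T f) (\sum_(t <- T) size (f0 t)) (\sum_(t <- T) size (fg t))
  (\sum_(t <- T) size (f2 t)) (size T) e0 e1 e2 mt.
move=> E s0 sg s2 n e0 e1 e2 mt; have : 0 < 2 ^ m by rewrite expn_gt0.
move: hm mt; rewrite addn1.
move: (vol S (kappa + D)) (2 ^ m) (m * a).+1 => vk e k hm mt e_gt0.
(* By the choice of m, the good pairs carry at most half of the energy, up to a multiple of the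
   index. *)
have E2 : 2 * g * sg <= E + (2 * D + 1) * g * n.
  rewrite -(leq_pmul2r e_gt0); apply: (leq_trans (n := 2 * g * (s2 * (k * vk)))).
    by rewrite -mulnA leq_mul2l mt orbT.
  move: (E + _) e2 => X e2; apply: (leq_trans (n := 2 * g * (X * v2 * (k * vk)))).
    by rewrite leq_mul2l leq_mul2r e2 !orbT.
  have -> : 2 * g * (X * v2 * (k * vk)) = X * (2 * g * v2 * vk * k).
    by rewrite (mulnC k) !mulnA -!(mulnC X) !mulnA.
  by rewrite leq_mul2l hm orbT.
have E1 : E <= g * sg + g * (Cb * n).
  by apply: (leq_trans e0); rewrite -mulnDr leq_mul2l e1 orbT.
by rewrite mulnDl -!mulnA in E2 *; lia.
Qed.

End MainBound.

(** * Subgroups of finite index *)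

Section FiniteIndex.
Variable G : groupType.

(** K is an intersection of kernels of finite quotients, one for each element of [L], and F records
    the images in all of them. *)
Lemma avoid_finite (L : seq G) : residually_finite G -> 1%g \notin L ->
  exists (K : set G) (Q : finType) (F : G -> Q), [/\ subgroup K,
    forall h x, K h -> K (x^-1 * h * x)%g, forall g, g \in L -> ~ K g &
    forall x y, F x = F y -> K (x^-1 * y)%g].
Proof.
move=> rf; elim: L => [|g L IH] L1.
  exists setT, unit, (fun=> tt); split=> //.
  by split=> [|x y _ _]; rewrite ?inE.
move: L1; rewrite inE negb_or => /andP[/eqP g1 /IH[K [Q [F [sK nK LK FK]]]]].
have [Q0 [f [fM fg]]] := rf g (fun e => g1 (esym e)).
have f1 : f 1%g = 1%g.
  by apply: (@mulgI _ (f 1%g)); rewrite -fM !mulg1.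
have fV x : f x^-1%g = (f x)^-1%g.
  by apply: (@mulgI _ (f x)); rewrite -fM !mulgV f1.
exists (fun x => K x /\ f x = 1%g), (Q * Q0)%type, (fun x => (F x, f x)); split.
- split=> [|x y]; rewrite /in_mem /=.
    by apply/mem_set; split=> //; exact: (sub1 sK).
  move=> /set_mem[Kx fx] /set_mem[Ky fy]; apply/mem_set; split.
    exact: (subF sK).
  by rewrite fM fV fx fy mulgV.
- by move=> h x [Kh fh]; split; [exact: nK|rewrite !fM fV fh mulg1 mulVg].
- by move=> z; rewrite inE => /orP[/eqP->|/LK nKz] [Kz fz]; [exact: fg|exact: nKz].
- move=> x y [/FK Kxy fxy]; split=> //.
  by rewrite fM fV fxy mulVg.
Qed.

Lemma finite_index_kernel (K : set G) (Q : finType) (F : G -> Q) : subgroup K ->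
  (forall x y, F x = F y -> K (x^-1 * y)%g) -> finite_index setT K.
Proof.
move=> sK FK; split; first by move=> x.
pose coset g : set G := [set (g * h)%g | h in K]%classic.
have [r hr] : exists r : Q -> G, forall g, F (r (F g)) = F g.
  suff ex : forall q, exists x, forall g, F g = q -> F x = q.
    by have [r hr] := choice ex; exists r => g; apply: hr.
  move=> q; case: (pselect (exists x, F x = q)) => [[x xq]|no]; first by exists x.
  by exists 1%g => g gq; case: no; exists g.
apply: sub_finite_set (finite_seq [seq coset (r q) | q <- enum Q]).
move=> _ [g _ <-] /=; apply/mapP; exists (F g); first by rewrite mem_enum.
have Kr := FK _ _ (hr g).
apply/seteqP; split=> _ [h Kh <-].
  exists ((r (F g))^-1 * g * h)%g; first exact: (subM sK).
  by rewrite -!mulgA mulVKg.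
exists (((r (F g))^-1 * g)^-1 * h)%g; first by apply: (subM sK) => //; exact: (subV sK).
by rewrite invMg invgK -mulgA mulVKg.
Qed.

Lemma index_reps (K H : set G) : subgroup H -> finite_index K H ->
  exists l : seq G, forall g : G, K g -> exists2 x, x \in l & H (x^-1 * g)%g.
Proof.
move=> sH [_ /finite_seqP[s sE]].
have ex : forall C : set G, exists x, forall g, C = [set (g * h)%g | h in H]%classic ->
  H (x^-1 * g)%g.
  move=> C; case: (pselect (exists x, C = [set (x * h)%g | h in H]%classic)) => [[x xC]|no].
    exists x => g gC; have : C g by rewrite gC; exists 1%g; rewrite ?mulg1 //; exact: (sub1 sH).
    by rewrite xC => -[h Hh <-]; rewrite mulKg.
  by exists 1%g => g gC; case: no; exists g.
have [r hr] := choice ex; exists (map r s) => g Kg.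
pose C := [set (g * h)%g | h in H]%classic.
exists (r C); last exact: hr.
apply: map_f; have : [set [set (g * h)%g | h in H] | g in K]%classic C by exists g.
by rewrite sE.
Qed.

Lemma finite_index_transversal (K H : set G) : subgroup H ->
  subgroup K -> finite_index setT K -> finite_index K H -> exists T, transversal H T.
Proof.
move=> sH sK /(index_reps sK)[l hl] /(index_reps sH)[l' hl'].
pose R x y := exists2 h, H h & x = (h * y)%g.
have Rxx x : R x x by exists 1%g; rewrite ?mul1g //; exact: (sub1 sH).
have Rsym x y : R x y -> R y x.
  by move=> [h Hh ->]; exists h^-1%g; rewrite ?mulKg //; exact: (subV sH).
(* Inverses turn representatives of left cosets into representatives of the cosets H x. *)
have [T [uT sT cT iT]] := irredundant [seq (x * y)^-1%g | x <- l, y <- l'] Rxx Rsym.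
exists T; split=> //; last by move=> t t' h tT tT' Hh e; apply: iT => //; exists h.
move=> x; have [y yl Ky] := hl x^-1%g I; have [z zl Hz] := hl' _ Ky.
have [t tT [h Hh e]] := cT _ (allpairs_f (fun x y => (x * y)^-1%g) yl zl).
exists t, ((z^-1 * (y^-1 * x^-1))^-1 * h)%g; split=> //.
  by apply: (subM sH) => //; exact: (subV sH).
by rewrite -mulgA -e !invMg !invgK !mulgA mulgK mulgK.
Qed.

(** If h in K moves x by at most [r], its conjugate by x lies in the normal subgroup K and in the
    ball of radius [r] around 1, whose nontrivial elements K avoids. *)
Lemma sparse_subgroup (S : seq G) (r : nat) : generates S -> residually_finite G ->
  exists K : set G, [/\ subgroup K, finite_index setT K &
    forall h x, K h -> (word_dist S x (h * x)%g <= r)%N -> h = 1%g].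
Proof.
move=> genS rf; pose L := [seq g <- ball1 S r | g != 1%g].
have [|K [Q [F [sK nK LK FK]]]] := avoid_finite rf (L := L); first by rewrite mem_filter eqxx.
exists K; split=> // [|h x Kh hr]; first exact: finite_index_kernel FK.
apply: contrapT => /eqP h1; apply: (LK (x^-1 * h * x)%g); last exact: nK.
rewrite mem_filter; apply/andP; split.
  apply: contraNneq h1 => e; apply/eqP; apply: (@mulgI _ x^-1%g); apply: (@mulIg _ x).
  by rewrite e mulg1 mulVg.
by rewrite mem_ball1 // -mulgA.
Qed.

End FiniteIndex.

(** * Graphs *)

Section Paths.
Variable X : graph.
Local Notation rev_path := Defs.rev_path.

Lemma edge_path_cat (u v w : vertex X) p q :
  edge_path u p v -> edge_path v q w -> edge_path u (p ++ q) w.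
Proof.
by elim: p u => [|e p IH] u /=; [move=> ->|move=> [-> pv] qw; split=> //; apply: IH].
Qed.

Lemma edge_path_rev (u v : vertex X) p : edge_path u p v -> edge_path v (rev_path p) u.
Proof.
elim: p u => [|e p IH] u /=; first by move=> ->.
move=> [eu /IH pv]; rewrite /rev_path /= rev_cons -cats1; apply: edge_path_cat pv _.
by rewrite /= /tgt flipK.
Qed.

Lemma rev_pathK : involutive (@rev_path X).
Proof.
move=> p; rewrite /rev_path map_rev revK -map_comp -[RHS]map_id.
by apply: eq_map => e /=; rewrite flipK.
Qed.

Lemma size_rev_path (p : seq (dart X)) : size (rev_path p) = size p.
Proof. by rewrite size_rev size_map. Qed.

Variables (G : groupType) (act : graph_action G X).

Lemma act_tgt g (e : dart X) : tgt (acte act g e) = actv act g (tgt e).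
Proof. by rewrite /tgt act_flip act_src. Qed.

Lemma edge_path_act g (u v : vertex X) p :
  edge_path u p v -> edge_path (actv act g u) (map (acte act g) p) (actv act g v).
Proof.
elim: p u => [|e p IH] u /=; first by move=> ->.
by move=> [<- /IH]; rewrite act_src act_tgt.
Qed.

Lemma rev_path_act g p : rev_path (map (acte act g) p) = map (acte act g) (rev_path p).
Proof.
rewrite /rev_path map_rev -!map_comp; congr rev.
by apply: eq_map => e /=; rewrite act_flip.
Qed.

(** Choose a base vertex in each orbit; by freeness, each vertex is a unique translate of it. *)
Lemma equivariant_coordinate (v0 : vertex X) : free_action act ->
  exists c : vertex X -> G, forall (g : G) u, c (actv act g u) = (g * c u)%g.
Proof.
move=> [freev _]; pose orb u : set (vertex X) := [set w | exists g, w = actv act g u]%classic.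
have ex : forall C : set (vertex X), exists v, (exists u, C u) -> C v.
  move=> C; case: (pselect (exists u, C u)) => [[v Cv]|no]; first by exists v.
  by exists v0 => /no.
have [r hr] := choice ex.
have orbE g u : orb (actv act g u) = orb u.
  apply/seteqP; split=> _ [k ->]; first by exists (k * g)%g; rewrite actvM.
  by exists (k * g^-1)%g; rewrite -actvM mulgVK.
have ex2 : forall u, exists g, u = actv act g (r (orb u)).
  move=> u; have [|g ->] := hr (orb u); first by exists u, 1%g; rewrite actv1.
  by exists g^-1%g; rewrite -actvM mulVg actv1.
have [c hc] := choice ex2; exists c => g u.
have e := hc (actv act g u); rewrite orbE {1}(hc u) -actvM in e.
have /freev e1 : actv act ((c (actv act g u))^-1 * (g * c u))%g (r (orb u)) = r (orb u).
  by rewrite actvM e -actvM mulVg actv1.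
by rewrite -[RHS](mulVKg (c (actv act g u))) e1 mulg1.
Qed.

End Paths.

Lemma sub_sum (I : eqType) (s s' : seq I) (F : I -> nat) : uniq s -> uniq s' -> {subset s <= s'} ->
  (\sum_(i <- s) F i <= \sum_(i <- s') F i)%N.
Proof. exact: (uniq_sub_le_big leqnn (fun m n => leq_addr n m)). Qed.

Section EdgeOrbits.
Local Open Scope nat_scope.
Variables (G : groupType) (X : graph) (act : graph_action G X).
Local Notation rev_path := Defs.rev_path.
Hypothesis freeX : free_action act.
Variables (H : set G) (T : seq G).
Hypotheses (sgH : subgroup H) (hT : transversal H T).

Lemma same_edge_orbit_refl e : same_edge_orbit act H e e.
Proof. by exists 1%g; [exact: (sub1 sgH)|left; rewrite acte1]. Qed.

Lemma same_edge_orbit_sym d e : same_edge_orbit act H d e -> same_edge_orbit act H e d.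
Proof.
move=> [h Hh de]; exists h^-1%g; first exact: (subV sgH).
by case: de => ->; [left|right]; rewrite -?act_flip -acteM mulVg acte1 ?flipK.
Qed.

Lemma same_edge_orbit_trans d e f : same_edge_orbit act H d e ->
  same_edge_orbit act H e f -> same_edge_orbit act H d f.
Proof.
move=> [h Hh de] [k Hk ef]; exists (h * k)%g; first exact: (subM sgH).
case: de => ->; case: ef => ->; rewrite ?acteM; first by left.
- by right; rewrite -act_flip.
- by right.
- by left; rewrite act_flip flipK.
Qed.

Lemma transversal_edge_orbit e (t t' : G) : t \in T -> t' \in T ->
  same_edge_orbit act H (acte act t e) (acte act t' e) -> t = t'.
Proof.
move=> tT t'T [h Hh te]; case: hT => _ _ iT; apply: (iT t t' h) => //.
suff : ((h * t')^-1 * t)%g = 1%g by move=> e1; rewrite -[LHS](mulVKg (h * t')%g) e1 mulg1.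
apply: (freeX.2 _ e); rewrite acteM.
by case: te => ->; [left|right]; rewrite -?act_flip -(acteM _ h) -acteM mulVg acte1.
Qed.

Lemma edge_repsE k (e : 'I_k -> dart X) : edge_reps act H e ->
  forall d i j, same_edge_orbit act H d (e i) -> same_edge_orbit act H d (e j) -> i = j.
Proof. by move=> he d i j di dj; have [l [_ lu]] := he d; rewrite -(lu i di) -(lu j dj). Qed.

(** By freeness, the translates of [d] by T lie in different H-orbits, hence contribute different
    terms on the right. *)
Lemma edge_reps_sum k (e : 'I_k -> dart X) (F : dart X -> nat) d : edge_reps act H e ->
  (forall h d, H h -> F (acte act h d) = F d) -> (forall d, F (flip d) = F d) ->
  \sum_(t <- T) F (acte act t d) <= \sum_(i < k) F (e i).
Proof.
move=> he FH Ff.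
have ex : forall t : G, exists i, same_edge_orbit act H (acte act t d) (e i).
  by move=> t; have [i [ti _]] := he (acte act t d); exists i.
have [r hr] := choice ex.
have -> : \sum_(t <- T) F (acte act t d) = \sum_(i <- map r T) F (e i).
  rewrite big_map; apply: eq_bigr => t _.
  by have [h Hh [->|->]] := hr t; rewrite ?Ff FH.
have uT : uniq T by case: hT.
rewrite -[X in _ <= X]big_enum /=; apply: sub_sum.
  rewrite map_inj_in_uniq // => t t' tT t'T rt; apply: (transversal_edge_orbit (e := d)) => //.
  by apply: same_edge_orbit_trans (hr t) _; rewrite rt; apply: same_edge_orbit_sym.
by exact: enum_uniq.
by move=> i; rewrite mem_enum.
Qed.

Lemma edge_reps_exist (n : nat) (e0 : 'I_n -> dart X) :
  (forall d, exists i g, d = acte act g (e0 i)) ->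
  exists s : seq (G * 'I_n), [/\ uniq s, {subset s <= [seq (t, j) | t <- T, j <- enum 'I_n]} &
    edge_reps act H (fun i : 'I_(size s) => let p := tnth (in_tuple s) i in acte act p.1 (e0 p.2))].
Proof.
move=> he0; pose D (p : G * 'I_n) := acte act p.1 (e0 p.2).
have [s [us ss cs is_]] := irredundant (R := fun p q => same_edge_orbit act H (D p) (D q))
  [seq (t, j) | t <- T, j <- enum 'I_n]
  (fun _ => same_edge_orbit_refl _) (fun _ _ => @same_edge_orbit_sym _ _).
exists s; split=> // d; have [j [g de]] := he0 d.
have [_ cT _] := hT; have [t [h [tT Hh gE]]] := cT g.
have [q qs tq] := cs (t, j) (allpairs_f _ tT (mem_enum _ j)).
have dq : same_edge_orbit act H d (D q).
  by apply: same_edge_orbit_trans tq; exists h => //; left; rewrite de gE acteM.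
have iq : index q s < size s by rewrite index_mem.
exists (Ordinal iq); split=> [|i di]; first by rewrite (tnth_nth q) /= nth_index.
apply: val_inj => /=; rewrite -(index_uniq q (ltn_ord i) us); congr index.
apply: is_ => //; first by rewrite mem_nth.
apply: same_edge_orbit_trans (same_edge_orbit_sym dq) _.
by move: di; rewrite (tnth_nth q).
Qed.

Variable phi : G -> G.
Hypothesis homphi : hom_on H phi.

(** Since no element inverts an edge, each dart is h e_i or its flip for a unique i, h and
    orientation, so that equivariance prescribes its image without conflict. *)
Lemma extend_over_edges k (e : 'I_k -> dart X)
    (M : vertex X -> vertex X) (q : 'I_k -> seq (dart X)) :
  edge_reps act H e ->
  (forall h v, H h -> M (actv act h v) = actv act (phi h) (M v)) ->
  (forall i, edge_path (M (src (e i))) (q i) (M (tgt (e i)))) ->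
  exists Phi : equivariant_map act H phi, mapv Phi = M /\ forall i, mape Phi (e i) = q i.
Proof.
move=> he eM hq.
pose D i h (b : bool) := let d := acte act h (e i) in if b then flip d else d.
pose Q i h (b : bool) := let p := map (acte act (phi h)) (q i) in if b then rev_path p else p.
have Dflip i h b : flip (D i h b) = D i h (~~ b) by case: b; rewrite /D ?flipK.
have Dact i g h b : acte act g (D i h b) = D i (g * h)%g b.
  by case: b; rewrite /D -?act_flip acteM.
have ex : forall d, exists c : 'I_k * G * bool, H c.1.2 /\ d = D c.1.1 c.1.2 c.2.
  move=> d; have [i [[h Hh de] _]] := he d.
  by case: de => de; [exists (i, h, false)|exists (i, h, true)].
have orbD i h b : H h -> same_edge_orbit act H (D i h b) (e i).
  by move=> Hh; exists h => //; case: b; [right|left].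
have Dinj i h b i' h' b' : H h -> H h' -> D i h b = D i' h' b' -> (i, h, b) = (i', h', b').
  move=> Hh Hh' DD.
  have ii : i = i'.
    by apply: (edge_repsE he (orbD i h b Hh)); rewrite DD; apply: orbD.
  subst i'; have hh : h = h'.
    suff : (h'^-1 * h)%g = 1%g by move=> e1; rewrite -[LHS](mulVKg h') e1 mulg1.
    apply: (freeX.2 _ (e i)); rewrite acteM.
    move: DD; rewrite /D; case: b; case: b' => /= DD.
    - by left; rewrite (can_inj (@flipK X) DD) -acteM mulVg acte1.
    - by right; rewrite -(flipK (acte act h (e i))) DD -act_flip -acteM mulVg acte1.
    - by right; rewrite DD -act_flip -acteM mulVg acte1.
    - by left; rewrite DD -acteM mulVg acte1.
  subst h'; congr pair; move: DD; rewrite /D; case: b; case: b' => //= DD.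
    by case: (flip_neq DD).
  by case: (flip_neq (esym DD)).
have [c hc] := choice ex; pose mp d := Q (c d).1.1 (c d).1.2 (c d).2.
have mpD i h b : H h -> mp (D i h b) = Q i h b.
  move=> Hh; have [Hc DD] := hc (D i h b); rewrite /mp.
  by have := Dinj _ _ _ _ _ _ Hh Hc DD; case: (c _) => [[i' h'] b'] /= [<- <- <-].
have path_ d : edge_path (M (src d)) (mp d) (M (tgt d)).
  have [Hh dE] := hc d; rewrite dE mpD //; move: (c d).1.1 (c d).1.2 (c d).2 Hh => i h b Hh.
  have base : edge_path (M (src (D i h false))) (Q i h false) (M (tgt (D i h false))).
    by rewrite /D /Q act_src act_tgt !eM //; apply: edge_path_act.
  by case: b => //; rewrite -(Dflip i h false) /tgt flipK; exact: edge_path_rev.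
have flip_ d : mp (flip d) = rev_path (mp d).
  have [Hh dE] := hc d; rewrite dE Dflip !mpD //.
  by case: (c d).2; rewrite /Q //= rev_pathK.
have equiv_ h d : H h -> mp (acte act h d) = map (acte act (phi h)) (mp d).
  move=> Hh; have [Hc dE] := hc d; rewrite dE Dact !mpD //; last exact: (subM sgH).
  have qE i : [seq acte act (phi (h * (c d).1.2)%g) x | x <- q i] =
      map (acte act (phi h)) (map (acte act (phi (c d).1.2)) (q i)).
    by rewrite -map_comp; apply: eq_map => x; rewrite /= homphi // acteM.
  by rewrite /Q qE; case: (c d).2 => //; rewrite rev_path_act.
exists (@EquivariantMap _ _ _ _ _ M mp path_ flip_ eM equiv_); split=> //= i.
have := mpD i 1%g false (sub1 sgH); rewrite /D /Q acte1 (phi1 sgH homphi) => ->.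
by rewrite -[RHS]map_id; apply: eq_map => x; rewrite acte1.
Qed.

End EdgeOrbits.

(** * Average distortion and energy *)

Section Comparison.
Local Open Scope nat_scope.
Variables (G : groupType) (S : seq G).
Hypothesis genS : generates S.
Variables (X : graph) (act : graph_action G X).
Hypotheses (connX : graph_connected X) (freeX : free_action act).
Local Notation d := (word_dist S).

Lemma dart_exists (g : G) : g <> 1%g -> exists e : dart X, True.
Proof.
move=> g1; have [[v] conn] := connX; have [[|e p]] := conn v (actv act g v).
  by move=> /= /esym /freeX.1.
by exists e.
Qed.

Lemma path_length_bound (v0 : vertex X) : exists L, forall x y : G,
  exists2 p, edge_path (actv act x v0) p (actv act y v0) & size p <= L * d x y.
Proof.
have [_ conn] := connX.
have [P hP] := choice (fun s : G => conn (actv act s v0) v0).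
exists (\sum_(s <- gens S) size (P s)) => x y.
move en : (d x y) => n; elim: n y en => [|n IH] y en.
  by exists [::]; rewrite //= (d_eq0 genS en).
have [s sS /IH[p px pn]] := d_step genS en.
exists (p ++ map (acte act y) (P s)).
  apply: edge_path_cat px _; rewrite actvM; exact: edge_path_act.
rewrite size_cat size_map mulnS addnC leq_add //.
by rewrite (big_rem s sS) leq_addr.
Qed.

Section Map.
Variables (H : set G) (phi : G -> G) (T : seq G).
Hypotheses (sgH : subgroup H) (homphi : hom_on H phi) (hT : transversal H T).

Lemma transversal_translate (b : G) : transversal H [seq (t * b)%g | t <- T].
Proof.
have [uT cT iT] := hT; split.
- by rewrite map_inj_uniq //; exact: mulIg.
- move=> x; have [t [h [tT Hh e]]] := cT (x * b^-1)%g.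
  by exists (t * b)%g, h; split; [exact: map_f| |rewrite mulgA -e mulgVK].
- move=> _ _ h /mapP[t tT ->] /mapP[t' tT' ->] Hh; rewrite mulgA => /(mulIg _ _ _) e.
  by rewrite (iT t t' h).
Qed.

(** Translating T on the right yields another transversal, so that each edge of a geodesic from [a]
    to [b] contributes at most the energy. *)
Lemma energy_stretch f (a b : G) : equivariant H phi f ->
  \sum_(t <- T) d (f (t * a)%g) (f (t * b)%g) <= d a b * energy S T f.
Proof.
move=> ef; move en : (d a b) => n; elim: n b en => [|n IH] b en.
  by rewrite (d_eq0 genS en) big1 // => t _; rewrite dxx.
have [s sS /IH an] := d_step genS en; rewrite mulSn addnC.
apply: (@leq_trans (\sum_(t <- T) (d (f (t * a)%g) (f (t * (b * s))%g) +
  d (f (t * (b * s))%g) (f (t * b)%g)))).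
  by apply: leq_sum => t _; exact: d_tri.
rewrite big_split leq_add //=.
rewrite (energy_transversal S sgH hT (transversal_translate b) ef) /energy big_map.
apply: leq_sum => t _; rewrite (big_rem s sS) /= mulgA d_sym // leq_addr //.
Qed.

(** Phi sends a vertex u to the translate of [v0] by [f (c u)] and an edge to a path of length at
    most [L] times the distance of these group elements. [energy_stretch] then bounds the sum over
    the translates of each [e0 j]. *)
Lemma total_dist_energy (v0 : vertex X) (n : nat) (e0 : 'I_n -> dart X) c L
    (s : seq (G * 'I_n)) f :
  (forall (g : G) u, c (actv act g u) = (g * c u)%g) ->
  (forall x y : G, exists2 p, edge_path (actv act x v0) p (actv act y v0) & size p <= L * d x y) ->
  uniq s -> {subset s <= [seq (t, j) | t <- T, j <- enum 'I_n]} ->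
  edge_reps act H (fun i : 'I_(size s) => let p := tnth (in_tuple s) i in acte act p.1 (e0 p.2)) ->
  equivariant H phi f ->
  exists Phi : equivariant_map act H phi,
    total_dist (fun i : 'I_(size s) => let p := tnth (in_tuple s) i in acte act p.1 (e0 p.2)) Phi
    <= L * (\sum_(j < n) d (c (src (e0 j))) (c (tgt (e0 j)))) * energy S T f.
Proof.
move=> hc hL us ss he ef; set e := (fun i : 'I_(size s) => _) in he *.
pose M u := actv act (f (c u)) v0.
have eM h u : H h -> M (actv act h u) = actv act (phi h) (M u).
  by move=> Hh; rewrite /M hc (ef h) // actvM.
have ex : forall i, exists p, edge_path (M (src (e i))) p (M (tgt (e i))) /\
    size p <= L * d (f (c (src (e i)))) (f (c (tgt (e i)))).
  by move=> i; have [p pe pL] := hL (f (c (src (e i)))) (f (c (tgt (e i)))); exists p.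
have [q hq] := choice ex.
have [Phi [_ PhiE]] := extend_over_edges freeX sgH homphi he eM (fun i => (hq i).1).
exists Phi; rewrite /total_dist.
pose F (p : G * 'I_n) := d (f (p.1 * c (src (e0 p.2)))%g) (f (p.1 * c (tgt (e0 p.2)))%g).
apply: (@leq_trans (\sum_(i < size s) L * F (tnth (in_tuple s) i))).
  apply: leq_sum => i _; rewrite PhiE; have [_] := hq i.
  by rewrite /e /= act_src act_tgt !hc.
rewrite -big_distrr /= -mulnA leq_mul2l; apply/orP; right.
have -> : \sum_(i < size s) F (tnth (in_tuple s) i) = \sum_(p <- s) F p.
  by rewrite [RHS]big_tnth.
apply: (leq_trans (sub_sum F us _ ss)).
  by apply: allpairs_uniq => [||[a b] [a' b']]; rewrite ?enum_uniq //; case: hT.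
rewrite big_allpairs_dep exchange_big /= big_enum big_distrl leq_sum //= => j _.
exact: energy_stretch.
Qed.

Lemma equivariant_exists : exists f, equivariant H phi f.
Proof.
have [uT cT iT] := hT; have [r hr] := choice cT; have [k hk] := choice hr.
exists (fun x => phi (k x)) => h x Hh; rewrite -homphi //; last by case: (hk x).
have [rT Hk e] := hk x; have [rT' Hk' e'] := hk (h * x)%g.
have rr : r (h * x)%g = r x.
  apply: (iT _ _ ((k (h * x))^-1 * (h * k x))%g) => //.
    by apply: (subM sgH); [exact: (subV sgH)|exact: (subM sgH)].
  by rewrite -!mulgA -e [X in (_^-1 * X)%g]e' mulKg.
by congr phi; apply: (mulIg (r x)); rewrite -{1}rr -e' -mulgA -e.
Qed.

Lemma zero_length_path (Phi : equivariant_map act H phi) u p v : edge_path u p v ->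
  \sum_(e <- p) size (mape Phi e) = 0 -> mapv Phi u = mapv Phi v.
Proof.
elim: p u => [|e p IH] u /=; first by move=> ->.
rewrite big_cons => -[<- /IH pv] /eqP; rewrite addn_eq0 => /andP[/eqP/size0nil e0 /eqP/pv <-].
by have := mape_path Phi e; rewrite e0.
Qed.

(** Let f be induced by Phi on the orbit of [v0]. By nonamenability, a definite proportion of each
    finite fibre of f consists of points moved by some generator s; [mass_transport] averages this
    over T. At a moved point x, the translate of [P s] by x contains an edge which is not
    collapsed. *)
Lemma total_dist_lower (v0 : vertex X) c h0 P k
    (e : 'I_k -> dart X) (Phi : equivariant_map act H phi) :
  set_inj H phi ->
  (forall A : seq G, uniq A ->
     size A <= h0 * \sum_(x <- A) \sum_(s <- gens S) (x * s \notin A)%g) ->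
  (forall (g : G) u, c (actv act g u) = (g * c u)%g) ->
  (forall s : G, edge_path v0 (P s) (actv act s v0)) ->
  edge_reps act H e ->
  size T <= h0 * size (gens S) * (\sum_(s <- gens S) size (P s)) * total_dist e Phi.
Proof.
move=> injphi nonam hc hP he; pose f x := c (mapv Phi (actv act x v0)).
have ef : equivariant H phi f by move=> h x Hh; rewrite /f actvM mapv_equiv // hc.
pose moved x := has (fun s : G => f (x * s)%g != f x) (gens S).
pose fa (x : G) := [:: f x]; pose fb x := if moved x then [:: f x] else [::].
have movedH h x : H h -> moved (h * x)%g = moved x.
  move=> Hh; apply: eq_has => s; rewrite -mulgA !(ef h) //.
  by congr negb; apply/eqP/eqP => [/(mulgI _ _ _)|->].
have ia : invariant_family H phi fa.
  split=> // h x p Hh; rewrite !inE (ef h) //.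
  by apply/eqP/eqP => [/(mulgI _ _ _)|->].
have ib : invariant_family H phi fb.
  split=> [x|h x p Hh]; first by rewrite /fb; case: ifP.
  rewrite /fb movedH //; case: ifP => // _; rewrite !inE (ef h) //.
  by apply/eqP/eqP => [/(mulgI _ _ _)|->].
have main : (\sum_(t <- T) size (fa t)) * 1 <= (\sum_(t <- T) size (fb t)) * (h0 * size (gens S)).
  apply: (mass_transport sgH homphi injphi hT ia ib) => p A B uA uB hA hB.
  rewrite muln1; apply: (leq_trans (nonam A uA)).
  rewrite [X in _ <= X]mulnC -mulnA leq_mul2l; apply/orP; right.
  apply: (@leq_trans (\sum_(x <- A) (x \in B) * size (gens S))).
    rewrite [leqLHS]big_seq [leqRHS]big_seq leq_sum // => x xA; rewrite hB /fb.
    have fx : f x = p by move: xA; rewrite hA inE => /eqP.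
    case: ifP => mx.
      by rewrite inE fx eqxx mul1n -sum1_size leq_sum // => s _; case: (_ \notin _).
    rewrite big_seq big1 // => s sS; apply/eqP; rewrite eqb0 negbK hA inE -fx eq_sym.
    by move/hasPn: mx => /(_ s sS); rewrite negbK.
  rewrite -big_distrl /= mulnC leq_mul2l; apply/orP; right.
  rewrite -sum1_size -big_mkcond /= sum1_count sum1_size -size_filter.
  by apply: uniq_leq_size; [exact: filter_uniq|move=> x; rewrite mem_filter => /andP[]].
have -> : size T = (\sum_(t <- T) size (fa t)) * 1 by rewrite muln1 sum1_size.
apply: (leq_trans main); rewrite [leqLHS]mulnC -[leqRHS]mulnA leq_mul2l; apply/orP; right.
apply: (@leq_trans (\sum_(t <- T) \sum_(s <- gens S) \sum_(b <- P s)
  size (mape Phi (acte act t b)))).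
  apply: leq_sum => t _; rewrite /fb; case: ifP => // /hasP[s sS fs].
  rewrite (big_rem s sS) /= addn_gt0; apply/orP; left; rewrite lt0n.
  apply: contraNneq fs => z; rewrite eq_sym /f actvM; apply/eqP; congr c.
  apply: (zero_length_path (edge_path_act act t (hP s))).
  by rewrite big_map.
rewrite exchange_big /= big_distrl leq_sum //= => s _.
rewrite exchange_big /= -sum1_size big_distrl leq_sum //= => b _; rewrite mul1n.
apply: (edge_reps_sum freeX sgH hT _ he (F := fun b => size (mape Phi b))).
  by move=> h b' Hh; rewrite mape_equiv // size_map.
by move=> b'; rewrite mape_flip size_rev_path.
Qed.

End Map.
End Comparison.

Local Open Scope classical_set_scope.
Local Open Scope ring_scope.

Theorem theoremA (R : realType) (G : groupType) (S : seq G)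
    (genS : generates S) (hypS : hyperbolic S R)
    (rigidS : geometrically_rigid S) (rfG : residually_finite G)
    (X : graph) (act : graph_action G X) (connX : graph_connected X)
    (freeX : free_action act) (cocompactX : cocompact_action act) :
  exists (Gdot : set G) (C : R),
    [/\ subgroup Gdot, finite_index setT Gdot, 0 <= C &
        forall (H : set G) (phi : G -> G),
          subgroup H -> finite_index Gdot H ->
          hom_on H phi -> set_inj H phi ->
          exists a : R,
            [/\ is_AvgDist act H phi a, a <= C &
                finite_index setT (phi @` H) ->
                0 < C /\ C^-1 <= a <= C]].
Proof.
have [D hypD] := hyperbolic_four_point genS hypS.
have [oneS _] := rigidS.
have [rho hrho] := tripod_one_ended genS hypD oneS (D + 2 + 3 * D).+1.
have [h0 nonam] := nonamenable genS hypD hrho (ltnSn _).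
have [r [C0 hC0]] := energy_bound genS hypD rigidS nonam.
have [Gdot [sGdot fGdot sparse]] := sparse_subgroup (2 * (r + 2))%N genS rfG.
have [g1 g1len] := one_ended_infinite genS oneS 1.
have g1neq : g1 <> 1%g by move=> e; rewrite e (len1 genS) in g1len.
have [d0 _] := dart_exists connX freeX g1neq.
have [[v0] conn] := connX.
have [c hc] := equivariant_coordinate v0 freeX.
have [L hL] := path_length_bound genS act connX v0.
have [P hP] := choice (fun s : G => conn v0 (actv act s v0)).
have [_ [n [e0 he0]]] := cocompactX.
pose M := (L * (\sum_(j < n) word_dist S (c (src (e0 j))) (c (tgt (e0 j)))))%N.
pose W := (h0 * size (gens S) * (\sum_(s <- gens S) size (P s)))%N.
(* [M * C0] serves the upper bound and [W * n] the lower one; the successor makes C positive. *)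
pose C := (M * C0 + W * n).+1.
exists Gdot, C%:R; split=> // H phi sH fH homphi injphi.
have [T hT] := finite_index_transversal sH sGdot fGdot fH.
have Tgt0 : (0 < size T)%N.
  by have [_ cT _] := hT; have [t [h [+ _ _]]] := cT 1%g; case: (T).
have [s [us ss]] := edge_reps_exist sH hT he0.
set e := (fun i : 'I_(size s) => _) => he.
(* The number of edge orbits lies between the index and n times the index; the first bound counts
   the translates of [d0]. *)
have Tk : (size T <= size s)%N.
  have := edge_reps_sum freeX sH hT (F := fun=> 1%N) d0 he.
  by rewrite sum1_size sum_nat_const card_ord muln1; apply.
have kT : (size s <= size T * n)%N.
  apply: leq_trans (uniq_leq_size us ss) _.
  by rewrite size_allpairs -cardE card_ord.
have kgt0 : 0 < (size s)%:R :> R by rewrite ltr0n (leq_trans Tgt0).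
have [f ef fmin] : exists2 f, equivariant H phi f &
    forall g, equivariant H phi g -> (energy S T f <= energy S T g)%N.
  have ex : exists m, `[< exists2 f, equivariant H phi f & energy S T f = m >].
    have [f ef] := equivariant_exists sH homphi hT.
    by exists (energy S T f); apply/asboolP; exists f.
  case: (ex_minnP ex) => m /asboolP[f ef <-] fmin; exists f => // g eg.
  by apply: fmin; apply/asboolP; exists g.
have [Phif Phifle] := total_dist_energy genS freeX sH homphi hT hc hL us ss he ef.
have [Phi Phimin] : exists Phi : equivariant_map act H phi, forall Psi : equivariant_map act H phi,
    (total_dist e Phi <= total_dist e Psi)%N.
  have ex : exists m, `[< exists Phi : equivariant_map act H phi, total_dist e Phi = m >].
    by exists (total_dist e Phif); apply/asboolP; exists Phif.
  case: (ex_minnP ex) => m /asboolP[Phi <-] Phimin; exists Phi => Psi.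
  by apply: Phimin; apply/asboolP; exists Psi.
have upper : (total_dist e Phi <= C * size s)%N.
  apply: leq_trans (Phimin Phif) _; apply: leq_trans Phifle _.
  apply: (@leq_trans (M * (C0 * size s))%N).
    rewrite leq_mul2l; apply/orP; right; apply: leq_trans (_ : _ <= C0 * size T)%N _.
      by apply: (hC0 H phi) => // h x Hh; apply: sparse; case: fH => + _; apply.
    by rewrite leq_mul2l Tk orbT.
  by rewrite mulnA leq_mul2r /C -addSn leqW ?leq_addr ?orbT.
have lower : (size s <= C * total_dist e Phi)%N.
  apply: leq_trans kT _.
  have := total_dist_lower freeX sH homphi hT Phi injphi nonam hc hP he.
  rewrite -/W => TW; apply: (@leq_trans (W * total_dist e Phi * n)%N).
    by rewrite leq_mul2r TW orbT.
  by rewrite mulnAC leq_mul2r /C ltnW ?orbT // ltnS leq_addl.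
exists (avg_dist R e Phi); rewrite /avg_dist.
have a_le : (total_dist e Phi)%:R / (size s)%:R <= C%:R :> R.
  by rewrite ler_pdivrMr // -natrM ler_nat.
split=> // [|_].
  exists (size s), e; split=> //; first by exists Phi.
  by move=> Psi; rewrite ler_pM2r ?invr_gt0 // ler_nat Phimin.
have C_gt0 : 0 < C%:R :> R by rewrite ltr0n.
by split=> //; rewrite a_le andbT ler_pdivlMr // mulrC ler_pdivrMr // mulrC -natrM ler_nat.
Qed.
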